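(* Let $T$ be injective, bisectorial of angle $\omega\in(0,\frac{\pi}{2})$ and have a bounded $H^\infty$-functional calculus. Let $P_\pm=\mathds{1}_\pm(T)$, $V_\pm=\operatorname{ran}P_\pm$, and let $T_\pm$ be the restriction of $T$ to $V_\pm$, an operator in $V_\pm$ with $\operatorname{dom}T_\pm=V_\pm\cap\operatorname{dom}T$. Then, with the half spaces $\mathbb{R}^{n+1}_\pm:=\{s\in\mathbb{R}^{n+1}\mid\pm s_0>0\}$, there is $$\sigma_S(T_\pm)\setminus\{0\}=\sigma_S(T)\cap\mathbb{R}^{n+1}_\pm.$$ For $s=0$ on the other hand, there is $$0\in\sigma_S(T)\quad\Leftrightarrow\quad0\in\sigma_S(T_+)\cup\sigma_S(T_-).$$
   Context: **Clifford algebra and modules.** Let $n\in\mathbb{N}$ and let $\mathbb{R}_n$ be the real Clifford algebra generated by $e_1,\dots,e_n$ with $e_i^2=-1$, $e_ie_j=-e_je_i$ for $i\neq j$. $\overline{\,\cdot\,}$ is Clifford conjugation (the real-linear anti-automorphism with $\overline{e_i}=-e_i$), $\operatorname{Sc}$ is the scalar part, $|\cdot|$ is the Euclidean norm. Paravectors: $\mathbb{R}^{n+1}=\{x_0+x_1e_1+\dots+x_ne_n\mid x_i\in\mathbb{R}\}$, with $s_0=\operatorname{Sc}(s)$. $\mathbb{S}=\{x_1e_1+\dots+x_ne_n\mid x_1^2+\dots+x_n^2=1\}$; for $J\in\mathbb{S}$, $\mathbb{C}_J=\{x+Jy\mid x,y\in\mathbb{R}\}$. $V$ is a right Hilbert module: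 a real vector space which is a right $\mathbb{R}_n$-module (extending real scalar multiplication), with an $\mathbb{R}$-bilinear form $\langle\cdot,\cdot\rangle:V\times V\to\mathbb{R}_n$ satisfying $\langle vs,w\rangle=\overline{s}\langle v,w\rangle$, $\langle v,ws\rangle=\langle v,w\rangle s$, $\overline{\langle v,w\rangle}=\langle w,v\rangle$, and such that $(V,\operatorname{Sc}\langle\cdot,\cdot\rangle)$ is a real Hilbert space; $\|v\|^2=\operatorname{Sc}\langle v,v\rangle$. **Operators and $S$-spectrum.** $T:\operatorname{dom}T\to V$ is right linear if $\operatorname{dom}T$ is a right submodule, $T$ is additive and $T(vs)=(Tv)s$ for $s\in\mathbb{R}_n$. $\mathcal{K}(V)$ is the set of closed right linear operators, $\mathcal{B}(V)$ the set of everywhere defined bounded right linear operators. For $s\in\mathbb{R}^{n+1}$: $Q_s[T]=T^2-2s_0T+|s|^2$ with domain $\operatorname{dom}T^2$; $\rho_S(T)=\{s\in\mathbb{R}^{n+1}\mid Q_s[T]^{-1}\in\mathcal{B}(V)\}$, $\sigma_S(T)=\mathbb{R}^{n+1}\setminus\rho_S(T)$. $\mathcal{I}^Rs:V\to V$ is right multiplication $v\mapsto vs$. One has $s\in\rho_S(T)$ iff $\mathcal{I}^Rs-T$ is bijective from $\operatorname{dom}T$ onto $V$. **Bisectorial operators.** $S_\omega=\{s\in\mathbb{R}^{n+1}\setminus\{0\}\mid|\operatorname{Arg}(s)|<\omega\}$, where $\operatorname{Arg}(s)=\arccos(s_0/|s|)$; $D_\omega=S_\omega\cup(-S_\omega)$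 for $\omega\in(0,\frac{\pi}{2})$. $T\in\mathcal{K}(V)$ is bisectorial of angle $\omega\in(0,\frac{\pi}{2})$ if $\sigma_S(T)\subseteq\overline{D_\omega}$ and for every $\varphi\in(\omega,\frac{\pi}{2})$ there is $C_\varphi\ge0$ with $\|(\mathcal{I}^Rs-T)^{-1}\|\le C_\varphi/|s|$ for all $s\in\mathbb{R}^{n+1}\setminus(D_\varphi\cup\{0\})$. **Functions.** For $U\subseteq\mathbb{R}^{n+1}$ open and axially symmetric ($x+Jy\in U$ implies $x+Iy\in U$ for all $I\in\mathbb{S}$), $f:U\to\mathbb{R}^{n+1}$ is intrinsic if $f(x+Jy)=\alpha(x,y)+J\beta(x,y)$ with real-valued $\alpha,\beta$ independent of $J$, satisfying the Cauchy–Riemann equations, $\alpha$ even and $\beta$ odd in $y$. $\mathcal{N}^0(U)$: intrinsic $f$ with $|f(s)|\le C|s|^\alpha/(1+|s|^{2\alpha})$ for some $\alpha>0$, $C\ge0$. $\mathcal{N}^\infty(U)$: bounded intrinsic $f$, with $\|f\|_\infty=\sup_U|f|$. **Functional calculus.** Let $T$ be injective and bisectorial of angle $\omega$. For $f\in\mathcal{N}^0(D_\theta)$, $\theta\in(\omega,\frac{\pi}{2})$, $$f(T)v=\frac{1}{2\pi}\int_{\partial D_\varphi\cap\mathbb{C}_J}(\mathcal{I}^Rs-T)^{-1}vf(s)\,ds_J,$$ with $\varphi\in(\omega,\theta)$ and $J\in\mathbb{S}$ arbitrary, $ds_J=ds/J$, and the boundary oriented so that the double sector lies to its left. For $f\in\mathcal{N}^\infty(D_\theta)$,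 $f(T)=e(T)^{-1}(ef)(T)$ (with natural domain), where $e\in\mathcal{N}^0(D_\theta)$ is any function with $ef\in\mathcal{N}^0(D_\theta)$ and $e(T)$ injective, e.g. $e(s)=\frac{s}{1+s^2}$; $f(T)$ is independent of the choice of $e$. An injective bisectorial operator $T$ of angle $\omega$ has a bounded $H^\infty$-functional calculus if for every $\theta\in(\omega,\frac{\pi}{2})$ there is $C_\theta\ge0$ such that $f(T)\in\mathcal{B}(V)$ and $\|f(T)\|\le C_\theta\|f\|_\infty$ for all $f\in\mathcal{N}^\infty(D_\theta)$. **Spectral projectors and restrictions.** $\mathds{1}_+(s)=1$ if $\operatorname{Sc}(s)>0$ and $0$ if $\operatorname{Sc}(s)<0$; $\mathds{1}_-(s)=0$ if $\operatorname{Sc}(s)>0$ and $1$ if $\operatorname{Sc}(s)<0$ (functions in $\mathcal{N}^\infty(D_\theta)$). For $T$ injective, bisectorial with bounded $H^\infty$-functional calculus, $P_\pm=\mathds{1}_\pm(T)\in\mathcal{B}(V)$ are projections, $V_\pm=\operatorname{ran}P_\pm$ are closed right submodules with $V=V_+\overset{\bullet}{+}V_-$ (direct sum), and $T$ maps $V_\pm\cap\operatorname{dom}T$ into $V_\pm$, so that $T_\pm$ is a closed right linear operator in the right Hilbert module $V_\pm$, with $S$-spectrum taken in $V_\pm$. *)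

(* Defs.v *)
From HB Require Import structures.
From mathcomp Require Import all_boot all_order all_algebra.
From mathcomp Require Import all_classical all_reals all_analysis.
From mathcomp Require Import ring.

Set Implicit Arguments.
Unset Strict Implicit.
Unset Printing Implicit Defensive.

Import Order.TTheory GRing.Theory Num.Theory.
Import numFieldNormedType.Exports.

Local Open Scope classical_set_scope.
Local Open Scope ring_scope.

(** * The real Clifford algebra R_n

    x : clifford R n stands for \sum_A x A *: e_A, where A runs over the
    subsets of {0, .., n-1} and e_A is the product of the generators e_i, i in
    A, in increasing order.  With e_i ^+ 2 = -1 one has
    e_A * e_B = cliff_sign A B *: e_(A symmdiff B): every pair (i, j) in A x B
    with j < i costs one anticommutation, every pair with j = i one square. *)

Definition symdiff (T : finType) (A B : {set T}) : {set T} :=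
  ((A :\: B) :|: (B :\: A))%SET.

Definition cliff_sign (R : realType) (n : nat) (A B : {set 'I_n}) : R :=
  \prod_(i in A) \prod_(j in B) (if (j <= i)%N then -1 else 1).

Record clifford (R : realType) (n : nat) : Type :=
  Clifford { cliff_val : {ffun {set 'I_n} -> R} }.

HB.instance Definition _ (R : realType) (n : nat) :=
  [isNew for @cliff_val R n].
HB.instance Definition _ (R : realType) (n : nat) :=
  [Choice of clifford R n by <:].

Definition cliff_coef (R : realType) (n : nat) (x : clifford R n)
  (A : {set 'I_n}) : R := cliff_val x A.

Definition cliff_of (R : realType) (n : nat) (F : {set 'I_n} -> R) :
  clifford R n := Clifford [ffun A => F A].

Lemma cliff_ofE (R : realType) (n : nat) (F : {set 'I_n} -> R) A :
  cliff_coef (cliff_of F) A = F A.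
Proof. by rewrite /cliff_coef ffunE. Qed.

Lemma cliffP (R : realType) (n : nat) (x y : clifford R n) :
  (forall A, cliff_coef x A = cliff_coef y A) <-> x = y.
Proof.
split=> [xy|-> //]; case: x y xy => [x] [y] xy.
by congr Clifford; apply/ffunP => A; exact: xy.
Qed.

Definition cliff_zero (R : realType) (n : nat) : clifford R n :=
  cliff_of (fun=> 0).

Definition cliff_add (R : realType) (n : nat) (x y : clifford R n) :
  clifford R n := cliff_of (fun A => cliff_coef x A + cliff_coef y A).

Definition cliff_opp (R : realType) (n : nat) (x : clifford R n) :
  clifford R n := cliff_of (fun A => - cliff_coef x A).

Definition cliff_scale (R : realType) (n : nat) (a : R) (x : clifford R n) :
  clifford R n := cliff_of (fun A => a * cliff_coef x A).

Definition cliff_one (R : realType) (n : nat) : clifford R n :=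
  cliff_of (fun A : {set 'I_n} => (A == finset.set0)%:R).

Definition cliff_mul (R : realType) (n : nat) (x y : clifford R n) :
    clifford R n :=
  cliff_of (fun C : {set 'I_n} => \sum_(A : {set 'I_n})
     cliff_sign R A (symdiff A C) * cliff_coef x A
       * cliff_coef y (symdiff A C)).

Lemma cliff_addA (R : realType) (n : nat) : associative (@cliff_add R n).
Proof. by move=> x y z; apply/cliffP => A; rewrite !cliff_ofE addrA. Qed.

Lemma cliff_addC (R : realType) (n : nat) : commutative (@cliff_add R n).
Proof. by move=> x y; apply/cliffP => A; rewrite !cliff_ofE addrC. Qed.

Lemma cliff_add0 (R : realType) (n : nat) :
  left_id (cliff_zero R n) (@cliff_add R n).
Proof. by move=> x; apply/cliffP => A; rewrite !cliff_ofE add0r. Qed.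

Lemma cliff_addN (R : realType) (n : nat) :
  left_inverse (cliff_zero R n) (@cliff_opp R n) (@cliff_add R n).
Proof. by move=> x; apply/cliffP => A; rewrite !cliff_ofE addNr. Qed.

HB.instance Definition _ (R : realType) (n : nat) :=
  GRing.isZmodule.Build (clifford R n)
    (@cliff_addA R n) (@cliff_addC R n) (@cliff_add0 R n) (@cliff_addN R n).

Lemma cliff_scaleA (R : realType) (n : nat) (a b : R) (x : clifford R n) :
  cliff_scale a (cliff_scale b x) = cliff_scale (a * b) x.
Proof. by apply/cliffP => A; rewrite !cliff_ofE mulrA. Qed.

Lemma cliff_scale1 (R : realType) (n : nat) :
  left_id 1 (@cliff_scale R n).
Proof. by move=> x; apply/cliffP => A; rewrite !cliff_ofE mul1r. Qed.

Lemma cliff_scaleDr (R : realType) (n : nat) :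
  right_distributive (@cliff_scale R n) +%R.
Proof. by move=> a x y; apply/cliffP => A; rewrite !cliff_ofE mulrDr. Qed.

Lemma cliff_scaleDl (R : realType) (n : nat) (x : clifford R n) :
  {morph (@cliff_scale R n)^~ x : a b / a + b}.
Proof. by move=> a b; apply/cliffP => A; rewrite !cliff_ofE mulrDl. Qed.

HB.instance Definition _ (R : realType) (n : nat) :=
  GRing.Zmodule_isLmodule.Build R (clifford R n)
    (@cliff_scaleA R n) (@cliff_scale1 R n) (@cliff_scaleDr R n)
    (@cliff_scaleDl R n).

Lemma cliff_coef0 (R : realType) (n : nat) A :
  cliff_coef (0 : clifford R n) A = 0.
Proof. exact: cliff_ofE. Qed.

Lemma cliff_coefD (R : realType) (n : nat) (x y : clifford R n) A :
  cliff_coef (x + y) A = cliff_coef x A + cliff_coef y A.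
Proof. exact: cliff_ofE. Qed.

Lemma cliff_coefN (R : realType) (n : nat) (x : clifford R n) A :
  cliff_coef (- x) A = - cliff_coef x A.
Proof. exact: cliff_ofE. Qed.

Lemma cliff_coefZ (R : realType) (n : nat) (a : R) (x : clifford R n) A :
  cliff_coef (a *: x) A = a * cliff_coef x A.
Proof. exact: cliff_ofE. Qed.

Lemma in_symdiff (T : finType) (A B : {set T}) (i : T) :
  (i \in symdiff A B) = (i \in A) (+) (i \in B).
Proof. by rewrite !inE; case: (i \in A); case: (i \in B). Qed.

Lemma symdiffA (T : finType) (A B C : {set T}) :
  symdiff A (symdiff B C) = symdiff (symdiff A B) C.
Proof. by apply/finset.setP => i; rewrite !in_symdiff addbA. Qed.

Lemma symdiffC (T : finType) (A B : {set T}) : symdiff A B = symdiff B A.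
Proof. by apply/finset.setP => i; rewrite !in_symdiff addbC. Qed.

Lemma symdiffK (T : finType) (A B : {set T}) : symdiff A (symdiff A B) = B.
Proof. by apply/finset.setP => i; rewrite !in_symdiff addKb. Qed.

Lemma symdiff0 (T : finType) (A : {set T}) : symdiff finset.set0 A = A.
Proof. by apply/finset.setP => i; rewrite in_symdiff inE. Qed.

Lemma symdiffv (T : finType) (A : {set T}) : symdiff A A = finset.set0.
Proof. by apply/finset.setP => i; rewrite in_symdiff addbb inE. Qed.

Lemma symdiff_eq0 (T : finType) (A B : {set T}) :
  (symdiff A B == finset.set0) = (A == B).
Proof.
apply/eqP/eqP => [AB0|->]; last exact: symdiffv.
by rewrite -[B](symdiffK A) AB0 symdiffC symdiff0.
Qed.

Lemma prod_symdiff (R : realType) (T : finType) (F : T -> R) (A B : {set T}) :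
  (forall i, F i * F i = 1) ->
  \prod_(i in symdiff A B) F i = (\prod_(i in A) F i) * \prod_(i in B) F i.
Proof.
move=> F1; rewrite big_mkcond [\prod_(i in A) _]big_mkcond.
rewrite [\prod_(i in B) _]big_mkcond -big_split; apply: eq_bigr => i _ /=.
rewrite in_symdiff.
by case: (i \in A); case: (i \in B); rewrite /= ?F1 ?mulr1 ?mul1r.
Qed.

Lemma cliff_sign_sqr (R : realType) (n : nat) (A B : {set 'I_n}) :
  cliff_sign R A B * cliff_sign R A B = 1.
Proof.
rewrite -big_split big1 // => i _; rewrite -big_split big1 // => j _ /=.
by case: ifP; rewrite ?mulrNN mulr1.
Qed.

Lemma cliff_signDl (R : realType) (n : nat) (A B C : {set 'I_n}) :
  cliff_sign R (symdiff A B) C = cliff_sign R A C * cliff_sign R B C.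
Proof.
apply: prod_symdiff => i; rewrite -big_split big1 // => j _ /=.
by case: ifP; rewrite ?mulrNN mulr1.
Qed.

Lemma cliff_signDr (R : realType) (n : nat) (A B C : {set 'I_n}) :
  cliff_sign R A (symdiff B C) = cliff_sign R A B * cliff_sign R A C.
Proof.
rewrite -big_split; apply: eq_bigr => i _; apply: prod_symdiff => j /=.
by case: ifP; rewrite ?mulrNN mulr1.
Qed.

Lemma cliff_sign0l (R : realType) (n : nat) (A : {set 'I_n}) :
  cliff_sign R finset.set0 A = 1.
Proof. by rewrite /cliff_sign big_set0. Qed.

Lemma cliff_sign0r (R : realType) (n : nat) (A : {set 'I_n}) :
  cliff_sign R A finset.set0 = 1.
Proof. by rewrite /cliff_sign big1 // => i _; rewrite big_set0. Qed.

Lemma symdiff_reindex (R : realType) (n : nat) (C : {set 'I_n})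
    (F : {set 'I_n} -> R) : \sum_A F A = \sum_A F (symdiff C A).
Proof.
rewrite (reindex_inj (h := symdiff C)) //.
by apply: (can_inj (g := symdiff C)) => A; rewrite symdiffK.
Qed.

Lemma cliff_mulA (R : realType) (n : nat) : associative (@cliff_mul R n).
Proof.
move=> x y z; apply/cliffP => D; rewrite !cliff_ofE.
transitivity (\sum_A \sum_B cliff_sign R A (symdiff A D)
   * cliff_sign R (symdiff A B) (symdiff B D)
   * cliff_coef x A * cliff_coef y (symdiff A B)
   * cliff_coef z (symdiff B D)).
  apply: eq_bigr => A _; rewrite cliff_ofE mulr_sumr (symdiff_reindex A).
  apply: eq_bigr => B _.
  rewrite -symdiffA [symdiff B (symdiff A D)]symdiffA [symdiff B A]symdiffC.
  by rewrite -symdiffA symdiffK; ring.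
rewrite exchange_big /=; apply: eq_bigr => B _; rewrite cliff_ofE.
rewrite mulr_sumr mulr_suml; apply: eq_bigr => A _.
by rewrite !cliff_signDr !cliff_signDl; ring: (cliff_sign_sqr R A D).
Qed.

Lemma cliff_mul1l (R : realType) (n : nat) :
  left_id (cliff_one R n) (@cliff_mul R n).
Proof.
move=> x; apply/cliffP => C; rewrite cliff_ofE (bigD1 finset.set0) //= big1.
  by rewrite cliff_ofE eqxx symdiff0 cliff_sign0l !mul1r addr0.
by move=> A A0; rewrite cliff_ofE (negbTE A0) mulr0 mul0r.
Qed.

Lemma cliff_mul1r (R : realType) (n : nat) :
  right_id (cliff_one R n) (@cliff_mul R n).
Proof.
move=> x; apply/cliffP => C; rewrite cliff_ofE (bigD1 C) //= big1.
  by rewrite cliff_ofE symdiffv eqxx cliff_sign0r mul1r mulr1 addr0.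
by move=> A ACB; rewrite cliff_ofE symdiff_eq0 (negbTE ACB) mulr0.
Qed.

Lemma cliff_mulDl (R : realType) (n : nat) :
  left_distributive (@cliff_mul R n) +%R.
Proof.
move=> x y z; apply/cliffP => C; rewrite cliff_coefD !cliff_ofE -big_split.
by apply: eq_bigr => A _; rewrite cliff_coefD mulrDr mulrDl.
Qed.

Lemma cliff_mulDr (R : realType) (n : nat) :
  right_distributive (@cliff_mul R n) +%R.
Proof.
move=> x y z; apply/cliffP => C; rewrite cliff_coefD !cliff_ofE -big_split.
by apply: eq_bigr => A _; rewrite cliff_coefD mulrDr.
Qed.

Lemma cliff_oner_neq0 (R : realType) (n : nat) :
  cliff_one R n != 0 :> clifford R n.
Proof.
apply/eqP => /cliffP /(_ finset.set0); rewrite cliff_coef0 cliff_ofE eqxx.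
by move=> /eqP; rewrite oner_eq0.
Qed.

HB.instance Definition _ (R : realType) (n : nat) :=
  GRing.Zmodule_isNzRing.Build (clifford R n)
    (@cliff_mulA R n) (@cliff_mul1l R n) (@cliff_mul1r R n)
    (@cliff_mulDl R n) (@cliff_mulDr R n) (@cliff_oner_neq0 R n).

Lemma cliff_coefM (R : realType) (n : nat) (x y : clifford R n) C :
  cliff_coef (x * y) C = \sum_(A : {set 'I_n}) cliff_sign R A (symdiff A C)
    * cliff_coef x A * cliff_coef y (symdiff A C).
Proof. exact: cliff_ofE. Qed.

Lemma cliff_scalerAl (R : realType) (n : nat) (a : R) (x y : clifford R n) :
  a *: (x * y) = (a *: x) * y.
Proof.
apply/cliffP => C; rewrite cliff_coefZ !cliff_coefM mulr_sumr.
by apply: eq_bigr => A _; rewrite cliff_coefZ; ring.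
Qed.

HB.instance Definition _ (R : realType) (n : nat) :=
  GRing.Lmodule_isLalgebra.Build R (clifford R n) (@cliff_scalerAl R n).

Lemma cliff_scalerAr (R : realType) (n : nat) (a : R) (x y : clifford R n) :
  a *: (x * y) = x * (a *: y).
Proof.
apply/cliffP => C; rewrite cliff_coefZ !cliff_coefM mulr_sumr.
by apply: eq_bigr => A _; rewrite cliff_coefZ; ring.
Qed.

HB.instance Definition _ (R : realType) (n : nat) :=
  GRing.Lalgebra_isAlgebra.Build R (clifford R n) (@cliff_scalerAr R n).

Definition cliff_basis (R : realType) (n : nat) (A : {set 'I_n}) :
  clifford R n := cliff_of (fun B => (B == A)%:R).

Definition cliff_gen (R : realType) (n : nat) (i : 'I_n) : clifford R n :=
  cliff_basis R [set i]%SET.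

Definition Sc (R : realType) (n : nat) (x : clifford R n) : R :=
  cliff_coef x finset.set0.

Definition cnorm (R : realType) (n : nat) (x : clifford R n) : R :=
  Num.sqrt (\sum_(A : {set 'I_n}) cliff_coef x A ^+ 2).

(** The conjugate of e_A is the inverse of e_A, that is, e_A times the sign
    e_A ^+ 2. *)
Definition cliff_conj (R : realType) (n : nat) (x : clifford R n) :
    clifford R n :=
  cliff_of (fun A => cliff_sign R A A * cliff_coef x A).

Lemma cliff_basisM (R : realType) (n : nat) (A B : {set 'I_n}) :
  cliff_basis R A * cliff_basis R B
  = cliff_sign R A B *: cliff_basis R (symdiff A B).
Proof.
apply/cliffP => C; rewrite cliff_coefZ cliff_coefM (bigD1 A) //= big1.
  rewrite !cliff_ofE eqxx mulr1 addr0; have [<-|ACB] := eqVneq (symdiff A C) B.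
    by rewrite symdiffK eqxx.
  rewrite !mulr0; case: eqP => [CE|_]; last by rewrite mulr0.
  by rewrite CE symdiffK eqxx in ACB.
by move=> D DA; rewrite !cliff_ofE (negbTE DA) mulr0 mul0r.
Qed.

Lemma cliff_basis0 (R : realType) (n : nat) :
  cliff_basis R finset.set0 = 1 :> clifford R n.
Proof. by []. Qed.

Lemma cliff_gen_sqr (R : realType) (n : nat) (i : 'I_n) :
  cliff_gen R i * cliff_gen R i = -1.
Proof.
rewrite cliff_basisM symdiffv /cliff_sign !big_set1 leqnn scaleN1r.
by rewrite cliff_basis0.
Qed.

Lemma cliff_gen_anticomm (R : realType) (n : nat) (i j : 'I_n) : i != j ->
  cliff_gen R i * cliff_gen R j = - (cliff_gen R j * cliff_gen R i).
Proof.
move=> ij; rewrite !cliff_basisM symdiffC -scaleNr; congr (_ *: _).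
rewrite /cliff_sign !big_set1; case: ltngtP => // [_|/val_inj ijE].
  by rewrite opprK.
by rewrite ijE eqxx in ij.
Qed.

Lemma cliff_conj_gen (R : realType) (n : nat) (i : 'I_n) :
  cliff_conj (cliff_gen R i) = - cliff_gen R i.
Proof.
apply/cliffP => A; rewrite cliff_coefN !cliff_ofE.
have [->|Ai] := eqVneq A [set i]%SET; last by rewrite mulr0 oppr0.
by rewrite /cliff_sign !big_set1 leqnn mulr1.
Qed.

Lemma cliff_conj_linear (R : realType) (n : nat) :
  linear (@cliff_conj R n).
Proof.
move=> a x y; apply/cliffP => A.
rewrite cliff_coefD cliff_coefZ !cliff_ofE.
by ring.
Qed.

Lemma cliff_conjM (R : realType) (n : nat) (x y : clifford R n) :
  cliff_conj (x * y) = cliff_conj y * cliff_conj x.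
Proof.
apply/cliffP => C; rewrite [LHS]cliff_ofE !cliff_coefM mulr_sumr.
rewrite (symdiff_reindex C); apply: eq_bigr => A _; rewrite !cliff_ofE.
rewrite [symdiff (symdiff C A) C]symdiffC symdiffK [symdiff A C]symdiffC.
have : C = symdiff A (symdiff C A) by rewrite [symdiff C A]symdiffC symdiffK.
move: (symdiff C A) => B ->; rewrite !cliff_signDr !cliff_signDl.
transitivity (cliff_sign R A A * cliff_sign R B B * cliff_sign R A B
  * (cliff_sign R B A * cliff_sign R B A) * cliff_coef x B * cliff_coef y A).
  by ring.
by rewrite cliff_sign_sqr; ring.
Qed.

(** * Paravectors: R^(n+1) as a subset of R_n *)

Definition paravector (R : realType) (n : nat) : set (clifford R n) :=
  [set x | forall A : {set 'I_n}, (1 < #|A|)%N -> cliff_coef x A = 0].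

Definition sphere (R : realType) (n : nat) : set (clifford R n) :=
  [set x | [/\ paravector x, Sc x = 0 & cnorm x = 1]].

Definition slice (R : realType) (n : nat) (J : clifford R n) (x y : R) :
  clifford R n := x *: 1 + y *: J.

Definition Arg (R : realType) (n : nat) (s : clifford R n) : R :=
  acos (Sc s / cnorm s).

Definition sector (R : realType) (n : nat) (w : R) : set (clifford R n) :=
  [set s | [/\ paravector s, s != 0 & `|Arg s| < w]].

Definition double_sector (R : realType) (n : nat) (w : R) :
    set (clifford R n) :=
  sector w `|` [set s | sector w (- s)].
Arguments double_sector {R} n w.

(** Closure in the Euclidean topology. *)
Definition cclosure (R : realType) (n : nat) (D : set (clifford R n)) :
    set (clifford R n) :=
  [set s | forall e : R, 0 < e -> exists2 x, D x & cnorm (s - x) < e].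

(** * Right Hilbert modules over R_n *)

Record rightHilbertModule (R : realType) (n : nat) := RightHilbertModule {
  hilb_sort :> completeNormedModType R;
  ract : hilb_sort -> clifford R n -> hilb_sort;
  inner : hilb_sort -> hilb_sort -> clifford R n;
  ractDl : forall u v s, ract (u + v) s = ract u s + ract v s;
  ractDr : forall v s t, ract v (s + t) = ract v s + ract v t;
  ractM : forall v s t, ract v (s * t) = ract (ract v s) t;
  ract_real : forall v (a : R), ract v (a *: 1) = a *: v;
  inner_linearl : forall (a : R) u v w,
    inner (a *: u + v) w = a *: inner u w + inner v w;
  inner_linearr : forall (a : R) u v w,
    inner w (a *: u + v) = a *: inner w u + inner w v;
  inner_ractl : forall v w s, inner (ract v s) w = cliff_conj s * inner v w;
  inner_ractr : forall v w s, inner v (ract w s) = inner v w * s;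
  inner_conj : forall v w, cliff_conj (inner v w) = inner w v;
  inner_norm : forall v : hilb_sort, `|v| ^+ 2 = Sc (inner v v) }.

(** * Operators

    An operator is given by its graph.  Operators in a closed right submodule
    W of V are operators whose graph is contained in W `*` W. *)

Definition operator (R : realType) (n : nat) (V : rightHilbertModule R n) :=
  set (V * V).

Definition opdom (R : realType) (n : nat) (V : rightHilbertModule R n)
  (A : operator V) : set V := [set v | exists w, A (v, w)].

Definition opran (R : realType) (n : nat) (V : rightHilbertModule R n)
  (A : operator V) : set V := [set w | exists v, A (v, w)].

Definition opinv (R : realType) (n : nat) (V : rightHilbertModule R n)
  (A : operator V) : operator V := [set p | A (p.2, p.1)].

(** First A, then B. *)
Definition opcomp (R : realType) (n : nat) (V : rightHilbertModule R n)
  (B A : operator V) : operator V :=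
  [set p | exists2 y, A (p.1, y) & B (y, p.2)].

Definition oprestrict (R : realType) (n : nat) (V : rightHilbertModule R n)
  (A : operator V) (W : set V) : operator V := [set p | A p /\ W p.1].

Definition single_valued (R : realType) (n : nat) (V : rightHilbertModule R n)
    (A : operator V) : Prop :=
  forall v w w', A (v, w) -> A (v, w') -> w = w'.

Definition op_injective (R : realType) (n : nat) (V : rightHilbertModule R n)
    (A : operator V) : Prop :=
  forall v v' w, A (v, w) -> A (v', w) -> v = v'.

Definition right_linear (R : realType) (n : nat) (V : rightHilbertModule R n)
    (A : operator V) : Prop :=
  [/\ single_valued A,
      A (0, 0),
      forall v w v' w', A (v, w) -> A (v', w') -> A (v + v', w + w') &
      forall v w s, A (v, w) -> A (ract v s, ract w s)].

(** K(V) *)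
Definition closed_operator (R : realType) (n : nat)
    (V : rightHilbertModule R n) (A : operator V) : Prop :=
  right_linear A /\ closed A.

(** The operator norm of A is at most c. *)
Definition opnorm_le (R : realType) (n : nat) (V : rightHilbertModule R n)
    (A : operator V) (c : R) : Prop :=
  forall v w : V, A (v, w) -> `|w| <= c * `|v|.

(** B(W), for a closed right submodule W of V *)
Definition bounded_operator (R : realType) (n : nat)
    (V : rightHilbertModule R n) (W : set V) (A : operator V) : Prop :=
  [/\ right_linear A, opdom A = W, opran A `<=` W
    & exists c : R, opnorm_le A c].

Definition Qop (R : realType) (n : nat) (V : rightHilbertModule R n)
    (T : operator V) (s : clifford R n) : operator V :=
  [set p | exists y z, [/\ T (p.1, y), T (y, z) &
     p.2 = z - (2 * Sc s) *: y + cnorm s ^+ 2 *: p.1]].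

(** S-resolvent set and S-spectrum of an operator T in the closed right
    submodule W of V *)
Definition S_resolvent_set (R : realType) (n : nat)
    (V : rightHilbertModule R n) (W : set V) (T : operator V) :
    set (clifford R n) :=
  [set s | paravector s /\ bounded_operator W (opinv (Qop T s))].

Definition S_spectrum (R : realType) (n : nat)
    (V : rightHilbertModule R n) (W : set V) (T : operator V) :
    set (clifford R n) :=
  @paravector R n `\` S_resolvent_set W T.

(** I^R s - T *)
Definition shiftop (R : realType) (n : nat) (V : rightHilbertModule R n)
    (T : operator V) (s : clifford R n) : operator V :=
  [set p | exists2 y, T (p.1, y) & p.2 = ract p.1 s - y].

(** (I^R s - T)^-1 v; meaningful when I^R s - T is bijective onto V *)
Definition resolvent (R : realType) (n : nat) (V : rightHilbertModule R n)
    (T : operator V) (s : clifford R n) (v : V) : V :=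
  xget 0 [set w | shiftop T s (w, v)].

Definition bisectorial (R : realType) (n : nat) (V : rightHilbertModule R n)
    (T : operator V) (w : R) : Prop :=
  [/\ closed_operator T,
      0 < w < pi / 2,
      S_spectrum setT T `<=` cclosure (double_sector n w) &
      forall phi, w < phi < pi / 2 -> exists2 C : R, 0 <= C &
        forall s, paravector s -> ~ double_sector n phi s -> s != 0 ->
          opnorm_le (opinv (shiftop T s)) (C / cnorm s)].

(** * Intrinsic functions

    Functions on a subset U of R^(n+1) are represented by total functions
    on R_n, of which only the values on U matter. *)

Definition partialx (R : realType) (h : R -> R -> R) (x y : R) : R :=
  derive1 (h ^~ y) x.

Definition partialy (R : realType) (h : R -> R -> R) (x y : R) : R :=
  derive1 (h x) y.

Definition C1_at (R : realType) (h : R -> R -> R) (x y : R) : Prop :=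
  [/\ derivable (h ^~ y) x 1,
      derivable (h x) y 1,
      {for (x, y), continuous (fun p : R * R => partialx h p.1 p.2)} &
      {for (x, y), continuous (fun p : R * R => partialy h p.1 p.2)}].

Definition cauchy_riemann (R : realType) (a b : R -> R -> R) (x y : R) :
    Prop :=
  [/\ C1_at a x y, C1_at b x y,
      partialx a x y = partialy b x y &
      partialy a x y = - partialx b x y].

Definition intrinsic (R : realType) (n : nat) (U : set (clifford R n))
    (f : clifford R n -> clifford R n) : Prop :=
  exists a b : R -> R -> R, forall J x y, sphere J -> U (slice J x y) ->
    [/\ f (slice J x y) = slice J (a x y) (b x y),
        a x (- y) = a x y, b x (- y) = - b x y &
        cauchy_riemann a b x y].

Definition N0 (R : realType) (n : nat) (U : set (clifford R n))
    (f : clifford R n -> clifford R n) : Prop :=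
  intrinsic U f /\
  exists a C : R, [/\ 0 < a, 0 <= C &
    forall s, U s ->
      cnorm (f s) <= C * (cnorm s `^ a / (1 + cnorm s `^ (2 * a)))].

Definition Ninfty (R : realType) (n : nat) (U : set (clifford R n))
    (f : clifford R n -> clifford R n) : Prop :=
  intrinsic U f /\ exists C : R, forall s, U s -> cnorm (f s) <= C.

Definition supnorm (R : realType) (n : nat) (U : set (clifford R n))
    (f : clifford R n -> clifford R n) : R :=
  sup [set cnorm (f s) | s in U].

(** * Bochner integral *)

Record stepfun (T : Type) (E : Type) := StepFun {
  step_size : nat;
  step_set : 'I_step_size -> set T;
  step_val : 'I_step_size -> E }.

Definition step_eval (R : realType) (T : Type) (E : normedModType R)
    (h : stepfun T E) (x : T) : E :=
  \sum_(i < step_size h) (\1_(step_set i) x : R) *: step_val i.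

Definition step_integral (d : measure_display) (T : measurableType d)
    (R : realType) (mu : {measure set T -> \bar R}) (E : normedModType R)
    (h : stepfun T E) : E :=
  \sum_(i < step_size h) fine (mu (step_set i)) *: step_val i.

(** u is the Bochner integral of g over D: there are integrable step
    functions h k on D with \int_D `|g - h k| --> 0 and \int h k --> u. *)
Definition is_bochner (d : measure_display) (T : measurableType d)
    (R : realType) (mu : {measure set T -> \bar R}) (E : normedModType R)
    (D : set T) (g : T -> E) (u : E) : Prop :=
  exists h : nat -> stepfun T E,
    [/\ forall k (i : 'I_(step_size (h k))),
          [/\ measurable (step_set i), step_set i `<=` D
            & (mu (step_set i) < +oo)%E],
        forall k, measurable_fun D (fun x => `|g x - step_eval (h k) x|),
        (fun k => \int[mu]_(x in D) (`|g x - step_eval (h k) x|)%:E)%E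
          @ \oo --> 0%E &
        (fun k => step_integral mu (h k)) @ \oo --> u].

(** * Functional calculus *)

(** For a unit vector a in C_J, u is the integral of
    (I^R s - T)^-1 v f(s) ds_J along the ray s = r *: a, 0 < r < +oo,
    oriented away from 0; there ds_J = ds / J = a * (- J) dr. *)
Definition is_ray_integral (R : realType) (n : nat)
    (V : rightHilbertModule R n) (T : operator V)
    (f : clifford R n -> clifford R n) (J a : clifford R n) (v u : V) : Prop :=
  is_bochner (@lebesgue_measure R) `]0, +oo[
    (fun r : R => ract (ract (resolvent T (r *: a) v) (f (r *: a)))
                       (a * - J)) u.

(** With D_phi to the left, the boundary of D_phi in C_J consists of the rays
    through exp(- J phi) and - exp(- J phi), run through away from 0, and the
    rays through exp(J phi) and - exp(J phi), run through towards 0. *)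
Definition contour_calculus (R : realType) (n : nat)
    (V : rightHilbertModule R n) (T : operator V)
    (f : clifford R n -> clifford R n) (phi : R) (J : clifford R n) :
    operator V :=
  let a := slice J (cos phi) (sin phi) in
  let b := slice J (cos phi) (- sin phi) in
  [set p | exists u1 u2 u3 u4 : V,
     [/\ is_ray_integral T f J b p.1 u1,
         is_ray_integral T f J a p.1 u2,
         is_ray_integral T f J (- b) p.1 u3,
         is_ray_integral T f J (- a) p.1 u4 &
         p.2 = (2 * pi)^-1 *: (u1 - u2 + u3 - u4)]].

(** A = f(T) for f in N^0(D_theta), T bisectorial of angle w *)
Definition is_N0_calculus (R : realType) (n : nat)
    (V : rightHilbertModule R n) (T : operator V) (w theta : R)
    (f : clifford R n -> clifford R n) (A : operator V) : Prop :=
  exists phi J, [/\ w < phi < theta, sphere J & A = contour_calculus T f phi J].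

(** A = f(T) for f in N^oo(D_theta), T bisectorial of angle w; e is an
    arbitrary regularizer of f *)
Definition is_Hinfty_calculus (R : realType) (n : nat)
    (V : rightHilbertModule R n) (T : operator V) (w theta : R)
    (f : clifford R n -> clifford R n) (A : operator V) : Prop :=
  exists e : clifford R n -> clifford R n,
  exists eT efT : operator V,
    let ef := fun s => e s * f s in
    [/\ N0 (double_sector n theta) e /\ N0 (double_sector n theta) ef,
        is_N0_calculus T w theta e eT,
        is_N0_calculus T w theta ef efT,
        op_injective eT &
        A = opcomp (opinv eT) efT].

Definition bounded_Hinfty (R : realType) (n : nat)
    (V : rightHilbertModule R n) (T : operator V) (w : R) : Prop :=
  forall theta, w < theta < pi / 2 -> exists2 C : R, 0 <= C &
    forall f, Ninfty (double_sector n theta) f ->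
    forall A, is_Hinfty_calculus T w theta f A ->
      bounded_operator setT A /\
      opnorm_le A (C * supnorm (double_sector n theta) f).

Definition ind_plus (R : realType) (n : nat) (s : clifford R n) :
  clifford R n := if 0 < Sc s then 1 else 0.

Definition ind_minus (R : realType) (n : nat) (s : clifford R n) :
  clifford R n := if Sc s < 0 then 1 else 0.

Definition half_plus (R : realType) (n : nat) : set (clifford R n) :=
  [set s | paravector s /\ 0 < Sc s].

Definition half_minus (R : realType) (n : nat) : set (clifford R n) :=
  [set s | paravector s /\ Sc s < 0].

(* Main.v *)
(** Fix J in S.  Right multiplication by J turns V into a complex space, and
    s = x + J y acts as the complex number z = x + iy.  Testing against bounded
    functionals turns f(T) v into contour integrals of L((z - T)^-1 v) f(z) for
    complex linear functionals L; pairing conjugate points of the contour shows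
    that they depend neither on J nor, by Cauchy's theorem, on the angle.

    Boundedness of the calculus makes h(T)^-1 (h g)(T) everywhere defined for
    every bounded intrinsic g, where h is the regularizer of 1_+ or of 1_-.
    If g1 and g2 live on opposite half sectors then g1(T) g2(T) = 0: by the
    resolvent identity the product is a double contour integral with kernel
    1 / (s - p), in which each integral can be evaluated to 0 by Cauchy's theorem.
    Hence P_+ and P_- are complementary projections commuting with T.

    For s != 0 with Sc s <= 0 the zeros of q(z) = z^2 - 2 s_0 z + |s|^2 lie
    outside of the right half sector, so g = 1_+ / q and z g are bounded and g(T)
    inverts Q_s[T] on V_+.  Thus the spectrum of T_+ outside of 0 lies in the
    right half space, and that of T_- in the left one.  Finally, s is in the
    resolvent set of T iff it is in those of T_+ and T_-. *)

Require Import Defs.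
From mathcomp Require Import all_boot all_order all_algebra.
From mathcomp Require Import complex.
From mathcomp Require Import all_classical all_reals all_analysis.
From mathcomp Require Import measurable_realfun.
From mathcomp Require Import ring lra.

Set Implicit Arguments.
Unset Strict Implicit.
Unset Printing Implicit Defensive.

Import Order.TTheory GRing.Theory Num.Theory.
Import numFieldNormedType.Exports.
Import ComplexField.Normc.

Local Open Scope classical_set_scope.
Local Open Scope ring_scope.
Local Open Scope complex_scope.

Local Notation Re := complex.Re.
Local Notation Im := complex.Im.

(** * The complex slices of a right Hilbert module *)

(** [Pp] and [Pm] arrive with regularizers, angles and imaginary units of their own. Angles and
    units can be moved, regularizers cannot: two functions of T are compared only under one
    regularizer, and across two of them the single relation is that opposite supports give the
    product 0. This dictates the algebra. Write A and N for 1_+(T) and 1_-(T). Then A N = 0; the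
    complements 1 - A and 1 - N are again functions with opposite supports, so (1 - A) (1 - N) = 0;
    together A + N = 1, and A A = A follows from N A = 0.

    Opposite supports also allow both variables of the double integral to run over the same contour.
    Where s and p lie in the same half plane the numerator vanishes; otherwise |s - p| is at least a
    constant times |s| and times |p|. So the kernel has no singularity on the diagonal, and a
    product of two integrable functions of |s| and |p| dominates it.

    No vector integral is ever constructed by estimates: the candidates h(T)^-1 (h g)(T) are
    relations, and the hypothesis on the calculus says that their domain is V, which contains the
    existence of the integrals. From there on only the real integrals obtained by applying
    functionals are computed. *)

Section CliffordFacts.
Context (R : realType) (n : nat).
Implicit Types (x y s J : clifford R n) (z : R[i]).

Lemma cnorm_ge0 x : 0 <= cnorm x.
Proof. exact: sqrtr_ge0. Qed.

Lemma sqr_cnorm x : cnorm x ^+ 2 = \sum_A cliff_coef x A ^+ 2.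
Proof. by rewrite sqr_sqrtr // sumr_ge0 // => A _; exact: sqr_ge0. Qed.

Lemma abs_coef_le_cnorm x A : `|cliff_coef x A| <= cnorm x.
Proof.
rewrite -sqrtr_sqr ler_wsqrtr // (bigD1 A) //= lerDl.
by rewrite sumr_ge0 // => B _; exact: sqr_ge0.
Qed.

Lemma abs_Sc_le_cnorm x : `|Sc x| <= cnorm x.
Proof. exact: abs_coef_le_cnorm. Qed.

Lemma cnorm_eq0 x : (cnorm x == 0) = (x == 0).
Proof.
apply/eqP/eqP => [x0|->].
  apply/cliffP => A; apply/eqP; rewrite cliff_coef0 -normr_le0 -x0.
  exact: abs_coef_le_cnorm.
rewrite /cnorm big1 ?sqrtr0 // => A _.
by rewrite cliff_coef0 expr0n.
Qed.

Lemma cnormZ (a : R) x : cnorm (a *: x) = `|a| * cnorm x.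
Proof.
rewrite /cnorm -sqrtr_sqr -sqrtrM ?sqr_ge0 // mulr_sumr; congr Num.sqrt.
by apply: eq_bigr => A _; rewrite cliff_coefZ exprMn.
Qed.

Lemma cnormN x : cnorm (- x) = cnorm x.
Proof. by rewrite -scaleN1r cnormZ normrN1 mul1r. Qed.

Lemma cnormD x y : cnorm (x + y) <= cnorm x + cnorm y.
Proof.
have [->|x0] := eqVneq x 0; first by rewrite add0r lerDr cnorm_ge0.
have [->|y0] := eqVneq y 0; first by rewrite addr0 lerDl cnorm_ge0.
have nx : 0 < cnorm x by rewrite lt_def cnorm_eq0 x0 cnorm_ge0.
have ny : 0 < cnorm y by rewrite lt_def cnorm_eq0 y0 cnorm_ge0.
rewrite -(@ler_pXn2r _ 2) ?nnegrE ?addr_ge0 ?cnorm_ge0 //.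
pose P := \sum_A cliff_coef x A * cliff_coef y A.
have -> : cnorm (x + y) ^+ 2 = cnorm x ^+ 2 + P *+ 2 + cnorm y ^+ 2.
  rewrite !sqr_cnorm -sumrMnl -!big_split; apply: eq_bigr => A _ /=.
  by rewrite cliff_coefD sqrrD.
rewrite sqrrD lerD2r lerD2l ler_pMn2r // -subr_ge0.
(* the sum of the squares of the coefficients of x / |x| - y / |y| *)
have : 0 <= \sum_A (cnorm y * cliff_coef x A - cnorm x * cliff_coef y A) ^+ 2.
  by rewrite sumr_ge0 // => A _; exact: sqr_ge0.
have -> : \sum_A (cnorm y * cliff_coef x A - cnorm x * cliff_coef y A) ^+ 2
  = cnorm x * cnorm y * ((cnorm x * cnorm y - P) *+ 2).
  transitivity (cnorm y ^+ 2 * cnorm x ^+ 2 - 2 * (cnorm x * cnorm y) * P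
    + cnorm x ^+ 2 * cnorm y ^+ 2); last by rewrite -mulr_natr; ring.
  rewrite [cnorm x ^+ 2 in X in X - _]sqr_cnorm [cnorm y ^+ 2 in X in _ + X]sqr_cnorm.
  rewrite /P !mulr_sumr -sumrB -big_split; apply: eq_bigr => A _ /=.
  by ring.
by rewrite pmulr_rge0 ?mulr_gt0 // pmulrn_lge0.
Qed.

Lemma ScM x y :
  Sc (x * y) = \sum_A cliff_sign R A A * cliff_coef x A * cliff_coef y A.
Proof.
rewrite /Sc cliff_coefM; apply: eq_bigr => A _.
by rewrite symdiffC symdiff0.
Qed.

Lemma ScC x y : Sc (x * y) = Sc (y * x).
Proof. by rewrite !ScM; apply: eq_bigr => A _; ring. Qed.

Lemma ScD x y : Sc (x + y) = Sc x + Sc y.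
Proof. exact: cliff_coefD. Qed.

Lemma ScN x : Sc (- x) = - Sc x.
Proof. exact: cliff_coefN. Qed.

Lemma ScZ a x : Sc (a *: x) = a * Sc x.
Proof. exact: cliff_coefZ. Qed.

Lemma Sc1 : Sc (1 : clifford R n) = 1.
Proof. by rewrite /Sc [LHS]cliff_ofE eqxx. Qed.

Lemma Sc_conj x : Sc (cliff_conj x) = Sc x.
Proof. by rewrite /Sc cliff_ofE cliff_sign0l mul1r. Qed.

Lemma coef1 A : cliff_coef (1 : clifford R n) A = (A == finset.set0)%:R.
Proof. exact: cliff_ofE. Qed.

Lemma paravector1 : paravector (1 : clifford R n).
Proof.
move=> A A1; rewrite coef1; case: eqP => // A0.
by rewrite A0 cards0 in A1.
Qed.

Lemma paravector_lin (a b : R) x y : paravector x -> paravector y ->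
  paravector (a *: x + b *: y).
Proof.
move=> px py A A1.
by rewrite cliff_coefD !cliff_coefZ px // py // !mulr0 addr0.
Qed.

Lemma sphere_coef J A : sphere J -> cliff_coef J A != 0 ->
  exists i, A = [set i]%SET.
Proof.
move=> [pJ J0 _] JA; have A1 : (#|A| <= 1)%N.
  by rewrite leqNgt; apply: contra JA => A1; rewrite pJ.
case: (posnP #|A|) => [/eqP|A0].
  by rewrite cards_eq0 => /eqP A0; rewrite A0 [cliff_coef _ _]J0 eqxx in JA.
by apply/cards1P; rewrite eqn_leq A1.
Qed.

Lemma sphere_conj J : sphere J -> cliff_conj J = - J.
Proof.
move=> sJ; apply/cliffP => A; rewrite cliff_coefN cliff_ofE.
have [->|JA] := eqVneq (cliff_coef J A) 0; first by rewrite mulr0 oppr0.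
have [i ->] := sphere_coef sJ JA.
by rewrite /cliff_sign !big_set1 leqnn mulN1r.
Qed.

(* J * J is invariant under conjugation, while the conjugate of a basis element
   of degree two is its opposite. *)
Lemma sphere_sqr J : sphere J -> J * J = -1.
Proof.
move=> sJ; have JJ := sphere_conj sJ.
apply/cliffP => C; rewrite cliff_coefN coef1.
have [->|C0] := eqVneq C finset.set0.
  rewrite -[LHS]/(Sc (J * J)) ScM.
  have -> : \sum_A cliff_sign R A A * cliff_coef J A * cliff_coef J A
    = - cnorm J ^+ 2.
    rewrite sqr_cnorm -sumrN; apply: eq_bigr => A _.
    have := congr1 (fun x => cliff_coef x A) JJ; rewrite cliff_ofE cliff_coefN.
    by move=> ->; rewrite mulNr expr2.
  by case: sJ => _ _ ->; rewrite expr1n.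
rewrite oppr0.
have c2 : cliff_conj (J * J) = J * J by rewrite cliff_conjM JJ mulrNN.
have [//|JC] := eqVneq (cliff_coef (J * J) C) 0.
have sC : cliff_sign R C C = 1.
  have := congr1 (fun x => cliff_coef x C) c2; rewrite cliff_ofE.
  by move=> /(congr1 (fun t => t / cliff_coef (J * J) C)); rewrite mulfK ?divff.
have [A JA] : exists A, cliff_coef J A * cliff_coef J (symdiff A C) != 0.
  apply/existsP; apply: contra_neqT JC; rewrite negb_exists => /forallP /= h.
  rewrite cliff_coefM big1 // => A _; have := h A.
  by rewrite negbK -mulrA => /eqP ->; rewrite mulr0.
move: JA; rewrite mulf_eq0 negb_or => /andP[JA JB].
have [i Ai] := sphere_coef sJ JA; have [j Bj] := sphere_coef sJ JB.
have CE : C = symdiff A [set j]%SET by rewrite -Bj symdiffK.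
rewrite Ai in CE; move: sC C0; rewrite CE symdiff_eq0 => sC ij.
have {}ij : i != j by apply: contra ij => /eqP ->.
suff : cliff_sign R (symdiff [set i]%SET [set j]%SET)
  (symdiff [set i]%SET [set j]%SET) = -1.
  rewrite sC => /eqP; rewrite -subr_eq0 opprK -[1 + 1]/(2%:R : R).
  by rewrite pnatr_eq0.
rewrite cliff_signDl !cliff_signDr /cliff_sign !big_set1 !leqnn.
have [lij|lji|eij] := ltngtP i j; last by rewrite (val_inj eij) eqxx in ij.
  by rewrite mulrNN !mulr1.
by rewrite mulrNN !mul1r.
Qed.

Definition emb J z : clifford R n := slice J (Re z) (Im z).

Lemma ReD z z' : Re (z + z') = Re z + Re z'.
Proof. by case: z; case: z'. Qed.
Lemma ImD z z' : Im (z + z') = Im z + Im z'.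
Proof. by case: z; case: z'. Qed.
Lemma ReN z : Re (- z) = - Re z. Proof. by case: z. Qed.
Lemma ImN z : Im (- z) = - Im z. Proof. by case: z. Qed.
Lemma ReM z z' : Re (z * z') = Re z * Re z' - Im z * Im z'.
Proof. by case: z; case: z'. Qed.
Lemma ImM z z' : Im (z * z') = Re z * Im z' + Im z * Re z'.
Proof. by case: z; case: z'. Qed.
Lemma eqC z z' : Re z = Re z' -> Im z = Im z' -> z = z'.
Proof. by case: z z' => a b [c d] /= -> ->. Qed.

Lemma embD J z z' : emb J (z + z') = emb J z + emb J z'.
Proof. by rewrite /emb /slice ReD ImD !scalerDl addrACA. Qed.

Lemma embN J z : emb J (- z) = - emb J z.
Proof. by rewrite /emb /slice ReN ImN !scaleNr opprD. Qed.

Lemma embM J z z' : sphere J -> emb J (z * z') = emb J z * emb J z'.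
Proof.
move=> sJ; rewrite /emb /slice ReM ImM mulrDl !mulrDr.
rewrite -!scalerAl -!scalerAr !mul1r mulr1 (sphere_sqr sJ) !scalerA.
rewrite scalerBl scalerDl scalerN -!addrA; congr (_ + _).
by rewrite [_ + (_ - _)]addrA [LHS]addrC.
Qed.

Lemma emb_real J (a : R) : emb J a%:C = a *: 1.
Proof. by rewrite /emb /slice /= scale0r addr0. Qed.

Lemma Sc_emb J z : sphere J -> Sc (emb J z) = Re z.
Proof. by move=> [_ J0 _]; rewrite ScD !ScZ Sc1 J0 mulr0 addr0 mulr1. Qed.

Lemma cnorm_emb J z : sphere J -> cnorm (emb J z) = normc z.
Proof.
move=> sJ; case: (sJ) => pJ J0 J1; case: z => a b /=.
congr Num.sqrt.
transitivity (\sum_A (a ^+ 2 * cliff_coef (1 : clifford R n) A ^+ 2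
   + b ^+ 2 * cliff_coef J A ^+ 2)).
  apply: eq_bigr => A _; rewrite cliff_coefD !cliff_coefZ coef1.
  have [->|A0] := eqVneq A finset.set0; last by rewrite /=; ring.
  by rewrite [cliff_coef J _]J0 /=; ring.
rewrite big_split -!mulr_sumr /= -!sqr_cnorm J1 expr1n mulr1; congr (_ + _).
rewrite sqr_cnorm (bigD1 finset.set0) //= coef1 eqxx big1.
  by rewrite expr1n addr0 mulr1.
by move=> A A0; rewrite coef1 (negbTE A0) expr0n.
Qed.

Lemma paravector_emb J z : sphere J -> paravector (emb J z).
Proof. by move=> [pJ _ _]; apply: paravector_lin => //; exact: paravector1. Qed.

(** The direction of the vector part serves as J. A real s fits every J, and [J0] supplies one: for
    n = 0 the sphere is empty. *)
Lemma paravector_is_emb J0 s : sphere J0 -> paravector s ->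
  exists J z, sphere J /\ s = emb J z.
Proof.
move=> sJ0 ps; set v := s - Sc s *: 1.
have pv : paravector v.
  have -> : v = 1 *: s + (- Sc s) *: 1 by rewrite scale1r scaleNr.
  by apply: paravector_lin => //; exact: paravector1.
have Sv : Sc v = 0 by rewrite ScD ScN ScZ Sc1 mulr1 subrr.
have [v0|v0] := eqVneq v 0.
  exists J0, (Sc s)%:C; split => //; rewrite emb_real.
  by apply/eqP; rewrite -subr_eq0 -/v v0.
have nv : cnorm v != 0 by rewrite cnorm_eq0.
exists ((cnorm v)^-1 *: v), (Sc s +i* cnorm v); split.
  split.
  - by move=> A A1; rewrite cliff_coefZ pv // mulr0.
  - by rewrite ScZ Sv mulr0.
  - by rewrite cnormZ ger0_norm ?invr_ge0 ?cnorm_ge0 // mulVf.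
by rewrite /emb /slice /= scalerA divff // scale1r addrC subrK.
Qed.

End CliffordFacts.

Section ModuleFacts.
Context (R : realType) (n : nat) (V : rightHilbertModule R n).
Implicit Types (u v w : V) (s J : clifford R n) (z : R[i]).

Lemma ract0l s : ract (0 : V) s = 0.
Proof. by apply: (addIr (ract (0 : V) s)); rewrite -ractDl !add0r. Qed.

Lemma ractNl v s : ract (- v) s = - ract v s.
Proof. by apply: (addIr (ract v s)); rewrite -ractDl !addNr ract0l. Qed.

Lemma ractBl u v s : ract (u - v) s = ract u s - ract v s.
Proof. by rewrite ractDl ractNl. Qed.

Lemma ract1 v : ract v 1 = v.
Proof. by rewrite -[1]scale1r ract_real scale1r. Qed.

Lemma ractZl a v s : ract (a *: v) s = a *: ract v s.
Proof. by rewrite -!ract_real -!ractM -scalerAl mul1r -scalerAr mulr1. Qed.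

Lemma ractZr a v s : ract v (a *: s) = a *: ract v s.
Proof. by rewrite -[s in LHS]mulr1 scalerAr ractM ract_real. Qed.

Lemma ractNr v s : ract v (- s) = - ract v s.
Proof. by rewrite -scaleN1r ractZr scaleN1r. Qed.

Definition vmul J v z : V := Re z *: v + Im z *: ract v J.

Lemma vmulE J v z : vmul J v z = ract v (emb J z).
Proof. by rewrite ractDr !ractZr ract1. Qed.

Lemma vmulM J v z z' : sphere J -> vmul J (vmul J v z) z' = vmul J v (z * z').
Proof. by move=> sJ; rewrite !vmulE embM // ractM. Qed.

Lemma vmulDl J u v z : vmul J (u + v) z = vmul J u z + vmul J v z.
Proof. by rewrite !vmulE ractDl. Qed.

Lemma vmulNl J v z : vmul J (- v) z = - vmul J v z.
Proof. by rewrite !vmulE ractNl. Qed.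

Lemma vmulDr J v z z' : vmul J v (z + z') = vmul J v z + vmul J v z'.
Proof. by rewrite !vmulE embD ractDr. Qed.

Lemma vmulNr J v z : vmul J v (- z) = - vmul J v z.
Proof. by rewrite !vmulE embN ractNr. Qed.

Lemma vmulZl J a v z : vmul J (a *: v) z = a *: vmul J v z.
Proof. by rewrite !vmulE ractZl. Qed.

Lemma vmul1 J v : vmul J v 1 = v.
Proof. by rewrite /vmul /= scale1r scale0r addr0. Qed.

Lemma vmul_real J v (a : R) : vmul J v a%:C = a *: v.
Proof. by rewrite /vmul /= scale0r addr0. Qed.

Definition rinner u v : R := Sc (inner u v).

Lemma rinner_lin w a u v : rinner w (a *: u + v) = a * rinner w u + rinner w v.
Proof. by rewrite /rinner inner_linearr ScD ScZ. Qed.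

Lemma rinnerC u v : rinner u v = rinner v u.
Proof. by rewrite /rinner -inner_conj Sc_conj. Qed.

Lemma rinnerD w u v : rinner w (u + v) = rinner w u + rinner w v.
Proof. by have := rinner_lin w 1 u v; rewrite scale1r mul1r. Qed.

Lemma rinner0 w : rinner w 0 = 0.
Proof. by apply: (addIr (rinner w 0)); rewrite -rinnerD !add0r. Qed.

Lemma rinnerZ w a v : rinner w (a *: v) = a * rinner w v.
Proof. by have := rinner_lin w a v 0; rewrite rinner0 !addr0. Qed.

Lemma rinner_ractJ J u v : sphere J -> rinner (ract u J) (ract v J) = rinner u v.
Proof.
move=> sJ; rewrite /rinner inner_ractl inner_ractr (sphere_conj sJ) mulrA ScC.
by rewrite mulrA mulrN (sphere_sqr sJ) opprK mul1r.
Qed.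

Lemma norm_ractJ J v : sphere J -> `|ract v J| = `|v|.
Proof.
move=> sJ; apply/eqP; rewrite -(@eqrXn2 _ 2) // !inner_norm; apply/eqP.
exact: rinner_ractJ.
Qed.

(** Right multiplication by J is skew, as conjugation sends J to - J. With [rinner_ractJ] this makes
    |v z| = |z| |v| for complex z. *)
Lemma rinner_vJ J v : sphere J -> rinner v (ract v J) = 0.
Proof.
move=> sJ; have : rinner v (ract v J) = - rinner v (ract v J).
  rewrite {1}rinnerC /rinner inner_ractl inner_ractr (sphere_conj sJ) mulNr ScN.
  by rewrite ScC.
by lra.
Qed.

Lemma norm_vmul J v z : sphere J -> `|vmul J v z| = normc z * `|v|.
Proof.
move=> sJ; apply/eqP; rewrite -(@eqrXn2 _ 2) ?mulr_ge0 ?sqrtr_ge0 //; last first.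
  by case: z => a b; exact: sqrtr_ge0.
rewrite inner_norm -/(rinner _ _) exprMn.
rewrite /vmul rinnerD 2![rinner (_ + _) _]rinnerC !rinnerD !rinnerZ.
rewrite ![rinner (_ *: _) _]rinnerC !rinnerZ (rinnerC (ract v J) v) rinner_vJ //.
rewrite rinner_ractJ // inner_norm -/(rinner _ _); case: z => a b /=.
by rewrite sqr_sqrtr ?addr_ge0 ?sqr_ge0 //; apply/eqP; ring.
Qed.

Lemma abs_rinner_le u v : `|rinner u v| <= `|u| * `|v|.
Proof.
suff h w w' : rinner w w' <= `|w| * `|w'|.
  rewrite ler_norml h andbT lerNl -mulN1r -rinnerZ scaleN1r -[`|v|]normrN.
  exact: h.
have [->|w0] := eqVneq w 0.
  by rewrite rinnerC rinner0 normr0 mul0r.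
have [->|w'0] := eqVneq w' 0; first by rewrite rinner0 normr0 mulr0.
have : 0 <= `| `|w'| *: w + (- `|w|) *: w'| ^+ 2 by exact: sqr_ge0.
rewrite inner_norm -/(rinner _ _) rinnerD 2![rinner (_ + _) _]rinnerC.
rewrite !rinnerD !rinnerZ ![rinner (_ *: _) _]rinnerC !rinnerZ (rinnerC w' w).
rewrite /rinner -!inner_norm -/(rinner _ _).
have -> : `|w'| * (`|w'| * `|w| ^+ 2) + - `|w| * (`|w'| * rinner w w') +
    (`|w'| * (- `|w| * rinner w w') + - `|w| * (- `|w| * `|w'| ^+ 2))
  = `|w| * `|w'| * ((`|w| * `|w'| - rinner w w') *+ 2).
  by rewrite -mulr_natr; ring.
rewrite pmulr_rge0 ?mulr_gt0 ?normr_gt0 // pmulrn_lge0 // subr_ge0.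
by apply.
Qed.

Definition bounded_functional (l : V -> R) :=
  (forall a u v, l (a *: u + v) = a * l u + l v) /\
  exists2 M : R, 0 <= M & forall v, `|l v| <= M * `|v|.

Lemma bounded_functional_rinner w : bounded_functional (rinner w).
Proof.
split; first exact: rinner_lin.
by exists `|w| => // v; exact: abs_rinner_le.
Qed.

(** Tested on the inner product with u - v, which returns the square of |u - v|. *)
Lemma functional_ext u v :
  (forall l, bounded_functional l -> l u = l v) -> u = v.
Proof.
move=> h; apply/eqP; rewrite -subr_eq0 -normr_eq0 -sqrf_eq0.
rewrite inner_norm -/(rinner _ _) rinnerD -scaleN1r rinnerZ.
have := h (rinner (u + -1 *: v)) (bounded_functional_rinner _).
by move=> ->; rewrite mulN1r subrr.
Qed.

Section Functional.
Variables (l : V -> R) (bl : bounded_functional l).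

Lemma functionalD u v : l (u + v) = l u + l v.
Proof. by have := bl.1 1 u v; rewrite scale1r mul1r. Qed.

Lemma functional0 : l 0 = 0.
Proof. by apply: (addIr (l 0)); rewrite -functionalD !add0r. Qed.

Lemma functionalZ a v : l (a *: v) = a * l v.
Proof. by have := bl.1 a v 0; rewrite functional0 !addr0. Qed.

Lemma functionalN v : l (- v) = - l v.
Proof. by rewrite -scaleN1r functionalZ mulN1r. Qed.

End Functional.

(* The complex linear functional with real part l, for the complex structure
   v |-> v J. *)
Definition cfun J (l : V -> R) v : R[i] := l v +i* (- l (ract v J)).

Lemma cfunD J l u v : bounded_functional l ->
  cfun J l (u + v) = cfun J l u + cfun J l v.
Proof. by move=> bl; rewrite /cfun ractDl !functionalD // opprD. Qed.

Lemma cfunN J l v : bounded_functional l -> cfun J l (- v) = - cfun J l v.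
Proof. by move=> bl; rewrite /cfun ractNl !functionalN. Qed.

Lemma cfun_vmul J l v z : sphere J -> bounded_functional l ->
  cfun J l (vmul J v z) = cfun J l v * z.
Proof.
move=> sJ bl; rewrite /cfun /vmul ractDl !ractZl -ractM (sphere_sqr sJ).
rewrite ractNr ract1 !functionalD // !functionalZ // functionalN //.
by case: z => a b; apply: eqC; rewrite /=; ring.
Qed.

Lemma le_normc_abs (z : R[i]) : normc z <= `|Re z| + `|Im z|.
Proof.
case: z => a b /=; rewrite -(@ler_pXn2r _ 2) ?nnegrE ?addr_ge0 ?sqrtr_ge0 //.
rewrite sqr_sqrtr ?addr_ge0 ?sqr_ge0 // sqrrD !real_normK ?num_real //.
by rewrite lerD2r lerDl mulrn_wge0 // mulr_ge0.
Qed.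

Lemma abs_Re_le_normc (z : R[i]) : `|Re z| <= normc z.
Proof.
by case: z => a b /=; rewrite -sqrtr_sqr ler_wsqrtr // lerDl sqr_ge0.
Qed.

Lemma abs_Im_le_normc (z : R[i]) : `|Im z| <= normc z.
Proof.
by case: z => a b /=; rewrite -sqrtr_sqr ler_wsqrtr // lerDr sqr_ge0.
Qed.

Lemma normc_ge0 (z : R[i]) : 0 <= normc z.
Proof. by case: z => a b; exact: sqrtr_ge0. Qed.

Lemma cfunZ J l a v : bounded_functional l ->
  cfun J l (a *: v) = a%:C * cfun J l v.
Proof.
move=> bl; rewrite /cfun ractZl !functionalZ //.
by apply: eqC => /=; ring.
Qed.

Lemma cfun_ext J u v :
  (forall l, bounded_functional l -> cfun J l u = cfun J l v) -> u = v.
Proof. by move=> h; apply: functional_ext => l /h []. Qed.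

Lemma cfun_bound J l : sphere J -> bounded_functional l ->
  exists2 M, 0 <= M & forall v, normc (cfun J l v) <= M * `|v|.
Proof.
move=> sJ [_ [M M0 lM]]; exists (M + M); first by rewrite addr_ge0.
move=> v; apply: le_trans (le_normc_abs _) _; rewrite mulrDl lerD //=.
by rewrite normrN (le_trans (lM _)) // norm_ractJ.
Qed.

(** Only commutation with J is asked: multiplication by a complex scalar and the resolvent at a
    nonreal point need not commute with the whole Clifford algebra. *)
Definition bounded_linear J (A : V -> V) :=
  [/\ forall a u v, A (a *: u + v) = a *: A u + A v,
      forall v, A (ract v J) = ract (A v) J &
      exists2 M : R, 0 <= M & forall v, `|A v| <= M * `|v|].

Section BoundedLinear.
Variables (J : clifford R n) (A : V -> V) (bA : bounded_linear J A).

Lemma blinD u v : A (u + v) = A u + A v.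
Proof. by case: bA => /(_ 1 u v) + _ _; rewrite !scale1r. Qed.

Lemma blin0 : A 0 = 0.
Proof. by apply: (addIr (A 0)); rewrite -blinD !add0r. Qed.

Lemma blinZ a v : A (a *: v) = a *: A v.
Proof. by case: bA => /(_ a v 0) + _ _; rewrite blin0 !addr0. Qed.

Lemma blinN v : A (- v) = - A v.
Proof. by rewrite -scaleN1r blinZ scaleN1r. Qed.

Lemma blin_vmul v z : A (vmul J v z) = vmul J (A v) z.
Proof. by case: (bA) => _ AJ _; rewrite /vmul blinD !blinZ AJ. Qed.

Lemma cfun_comp l v : cfun J (l \o A) v = cfun J l (A v).
Proof. by case: bA => _ AJ _; rewrite /cfun /= AJ. Qed.

Lemma bounded_functional_comp l : bounded_functional l ->
  bounded_functional (l \o A).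
Proof.
move=> [llin [M M0 lM]]; case: (bA) => Alin _ [N N0 AN]; split.
  by move=> a u v /=; rewrite Alin llin.
exists (M * N); first exact: mulr_ge0.
by move=> v /=; rewrite (le_trans (lM _)) // -mulrA ler_wpM2l.
Qed.

End BoundedLinear.

Lemma bounded_linear_vmul J z : sphere J -> bounded_linear J ((vmul J)^~ z).
Proof.
move=> sJ; split.
- by move=> a u v; rewrite vmulDl vmulZl.
- by move=> v; rewrite /vmul ractDl !ractZl.
- exists (normc z); first exact: normc_ge0.
  by move=> v; rewrite norm_vmul.
Qed.

End ModuleFacts.

(** Identities between complex combinations of vectors become polynomial identities over [R[i]] once
    every functional [cfun J l] is applied. *)
Ltac cmodule sJ :=
  let l := fresh in let bl := fresh in
  match type of sJ with sphere ?J => apply: (@cfun_ext _ _ _ J) => l bl;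
  rewrite ?(@cfun_vmul _ _ _ J l _ _ sJ bl, @cfunD _ _ _ J l _ _ bl,
    @cfunN _ _ _ J l _ bl, @cfunZ _ _ _ J l _ _ bl);
  ring end.

(** * The resolvent outside of the double sector *)

Section Sectors.
Context (R : realType) (n : nat).
Implicit Types (s : clifford R n) (z : R[i]).

Lemma cos_lt_of_lt (a b : R) : 0 <= a -> a < b -> b <= pi -> cos b < cos a.
Proof.
move=> a0 ab bpi; rewrite ltr_cos // in_itv /=.
  by rewrite a0 (le_trans (ltW ab)).
by rewrite bpi andbT (le_trans a0 (ltW ab)).
Qed.

Lemma cos_gt0_angle (a : R) : 0 < a < pi / 2 -> 0 < cos a.
Proof.
move=> /andP[a0 api]; apply: cos_gt0_pihalf; rewrite api andbT.
by rewrite (lt_trans _ a0) // oppr_lt0 divr_gt0 // pi_gt0.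
Qed.

(** The cosine decreases on [0, pi], so the sector is a cone given by one inequality between [Sc]
    and [cnorm]. Strictness excludes 0. *)
Lemma sectorE (t : R) s : 0 < t < pi / 2 ->
  sector t s <-> paravector s /\ cos t * cnorm s < Sc s.
Proof.
move=> /andP[t0 tpi].
have cq : s != 0 -> -1 <= Sc s / cnorm s <= 1.
  move=> s0; rewrite -ler_norml normrM normfV (ger0_norm (cnorm_ge0 s)).
  rewrite ler_pdivrMr; first by rewrite mul1r abs_Sc_le_cnorm.
  by rewrite lt_def cnorm_eq0 s0 cnorm_ge0.
have tpi' : t <= pi by rewrite (le_trans (ltW tpi)) // ler_pdivrMr // ler_peMr // ?pi_ge0 // ler1n.
have E : s != 0 -> (`|Arg s| < t) = (cos t * cnorm s < Sc s).
  move=> s0; have := cq s0 => /[dup] q1 /andP[q2 q3].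
  rewrite /Arg ger0_norm ?acos_ge0 // -(@ltr_cos _ (acos _) t); first last.
  - by rewrite in_itv /= tpi' ltW.
  - by rewrite in_itv /= acos_ge0 // acos_lepi.
  rewrite acosK ?in_itv //= ltr_pdivlMr //.
  by rewrite lt_def cnorm_eq0 s0 cnorm_ge0.
split; first by move=> [ps s0]; rewrite E.
move=> [ps h]; have [s0|s0] := eqVneq s 0; last by split => //; rewrite E.
move: h; rewrite s0 (_ : cnorm _ = 0) ?mulr0 /Sc ?cliff_coef0 ?ltxx //.
by apply/eqP; rewrite cnorm_eq0.
Qed.

Lemma double_sectorE (t : R) s : 0 < t < pi / 2 ->
  double_sector n t s <-> paravector s /\ cos t * cnorm s < `|Sc s|.
Proof.
move=> ht; rewrite /double_sector /=; split.
  move=> [|] /(sectorE _ ht)[ps h]; split => //.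
  - by rewrite (lt_le_trans h) // ler_norm.
  - by move=> A /ps; rewrite cliff_coefN => /eqP; rewrite oppr_eq0 => /eqP.
  - by rewrite -(cnormN s) (lt_le_trans h) // ScN -normrN ler_norm.
move=> [ps]; rewrite ltr_normr => /orP[h|h].
  by left; apply/(sectorE _ ht).
right; apply/(sectorE _ ht); rewrite cnormN ScN; split => //.
by move=> A /ps; rewrite cliff_coefN => ->; rewrite oppr0.
Qed.

Lemma cclosure_double_sector (t : R) s : 0 < t < pi / 2 ->
  cclosure (double_sector n t) s -> cos t * cnorm s <= `|Sc s|.
Proof.
move=> ht cs; rewrite leNgt; apply/negP => h.
set e := (cos t * cnorm s - `|Sc s|) / 2.
have e0 : 0 < e by rewrite divr_gt0 // subr_gt0.
have [x /(double_sectorE _ ht)[_ xD] sx] := cs _ e0.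
have c1 := cos_le1 t; have c0 := cos_gt0_angle ht.
have S1 : `|Sc x| <= `|Sc s| + e.
  have -> : Sc x = Sc s - Sc (s - x) by rewrite ScD ScN; ring.
  apply: le_trans (ler_normB _ _) _; rewrite lerD2l.
  exact: le_trans (abs_Sc_le_cnorm _) (ltW sx).
have S2 : cnorm s <= cnorm x + e.
  have -> : s = x + (s - x) by rewrite addrC subrK.
  by apply: le_trans (cnormD _ _) _; rewrite lerD2l ltW.
have : cos t * cnorm s <= cos t * cnorm x + cos t * e.
  by rewrite -mulrDr ler_pM2l.
have : cos t * e <= e by rewrite ler_piMl // ltW.
by move: h; rewrite /e in e0 S1 S2 *; lra.
Qed.

End Sectors.

Section Resolvent.
Context (R : realType) (n : nat) (V : rightHilbertModule R n).
Context (T : operator V) (w : R).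
Hypothesis T_bisect : bisectorial T w.
Implicit Types (u v : V) (J : clifford R n) (z : R[i]).

Definition off_sector (c : R) z := `|Re z| < c * normc z.

Lemma off_sector_neq0 c z : off_sector c z -> z != 0.
Proof.
rewrite /off_sector; apply: contraTneq => ->.
by rewrite normc0 mulr0 -leNgt.
Qed.

Lemma off_sector_conj c z : off_sector c z -> off_sector c (conjc z).
Proof. by case: z => a b; rewrite /off_sector /= sqrrN. Qed.

Lemma normc_conj z : normc (conjc z) = normc z.
Proof. by case: z => a b /=; rewrite sqrrN. Qed.

Lemma angle_w : 0 < w < pi / 2. Proof. by case: T_bisect. Qed.

Lemma T_linear : right_linear T. Proof. by case: T_bisect => -[]. Qed.

Lemma T_add v v' y y' : T (v, y) -> T (v', y') -> T (v + v', y + y').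
Proof. by case: T_linear => _ _ + _; apply. Qed.

Lemma T_ract v y s : T (v, y) -> T (ract v s, ract y s).
Proof. by case: T_linear => _ _ _; apply. Qed.

Lemma T_vmul J v y z : T (v, y) -> T (vmul J v z, vmul J y z).
Proof. by rewrite !vmulE; exact: T_ract. Qed.

Lemma T_scale a v y : T (v, y) -> T (a *: v, a *: y).
Proof. by move=> /(T_ract (a *: 1)); rewrite !ract_real. Qed.

Lemma T_sub v v' y y' : T (v, y) -> T (v', y') -> T (v - v', y - y').
Proof.
by move=> h /(T_scale (-1)); rewrite !scaleN1r; exact: T_add.
Qed.

Definition resolv J z v : V := resolvent T (emb J z) v.

Lemma off_sector_rho J z : sphere J -> off_sector (cos w) z ->
  S_resolvent_set setT T (emb J z).
Proof.
move=> sJ zO; case: T_bisect => _ hw + _ => /(_ (emb J z)) h.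
apply: contrapT => nr; have /(cclosure_double_sector hw) :
  cclosure (double_sector n w) (emb J z).
  by apply: h; split => //; exact: paravector_emb.
by rewrite leNgt cnorm_emb // Sc_emb // -/(off_sector _ _) zO.
Qed.

Lemma Qop_emb J z : sphere J ->
  Qop T (emb J z) = [set p | exists y x, [/\ T (p.1, y), T (y, x) &
     p.2 = x - (2 * Re z) *: y + normc z ^+ 2 *: p.1]].
Proof. by move=> sJ; rewrite /Qop Sc_emb // cnorm_emb. Qed.

Lemma sqr_normcE z : normc z ^+ 2 = Re z ^+ 2 + Im z ^+ 2.
Proof. by case: z => a b; rewrite /= sqr_sqrtr ?addr_ge0 ?sqr_ge0. Qed.

Lemma shiftopE J z u y :
  T (u, y) -> shiftop T (emb J z) (u, vmul J u z - y).
Proof. by move=> uy; exists y => //=; rewrite vmulE. Qed.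

Lemma shiftopP J z u v :
  shiftop T (emb J z) (u, v) -> T (u, vmul J u z - v).
Proof. by move=> [y /= uy ->]; rewrite -vmulE opprB addrC subrK. Qed.

(* Q_s[T] = (T - conj s) (T - s), where s acts by right multiplication. *)
Lemma shiftop_surj J z v : sphere J -> off_sector (cos w) z ->
  exists q y, T (q, y) /\
   forall J', sphere J' -> shiftop T (emb J' z) (vmul J' q (conjc z) - y, v).
Proof.
move=> sJ zO; have [_ [_ dom _ _]] := off_sector_rho sJ zO.
have [q] : opdom (opinv (Qop T (emb J z))) v by rewrite dom.
rewrite /opinv /= Qop_emb // => -[y [x [/= qy yx vE]]].
exists q, y; split=> // J' sJ'; have h := T_sub (T_vmul J' (conjc z) qy) yx.
have := shiftopE J' z h; rewrite vmulDl vmulNl vmulM //.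
congr shiftop; congr (_, _); rewrite vE.
have -> : conjc z * z = (normc z ^+ 2)%:C.
  by rewrite sqr_normcE; case: (z) => a b; apply: eqC => /=; ring.
rewrite vmul_real; have yE : (2 * Re z) *: y = vmul J' y z + vmul J' y (conjc z).
  rewrite -vmulDr -(vmul_real J'); congr vmul.
  by case: (z) => a b; apply: eqC => /=; ring.
by rewrite yE; cmodule sJ'.
Qed.

(** If T u = u z then Q_s[T] u is u times the value at z of its own real quadratic polynomial, which
    is 0, and Q_s[T] is injective. *)
Lemma shiftop_inj J z u : sphere J -> off_sector (cos w) z ->
  T (u, vmul J u z) -> u = 0.
Proof.
move=> sJ zO uz; have [_ [[sv Q0 _ _] _ _ _]] := off_sector_rho sJ zO.
apply: sv Q0; rewrite /opinv /= Qop_emb //.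
have uzz := T_vmul J z uz.
exists (vmul J u z), (vmul J (vmul J u z) z); split=> //=.
rewrite -!(vmul_real J) !vmulM // -vmulNr -!vmulDr.
suff -> : z * z - z * (2 * Re z)%:C + (normc z ^+ 2)%:C = 0.
  by rewrite /vmul /= !scale0r addr0.
by rewrite sqr_normcE; case: (z) => a b; apply: eqC => /=; ring.
Qed.

Lemma resolv_uniq J z u y : sphere J -> off_sector (cos w) z ->
  T (u, y) -> resolv J z (vmul J u z - y) = u.
Proof.
move=> sJ zO uy; rewrite /resolv /resolvent.
have := @xgetPex _ 0 [set x | shiftop T (emb J z) (x, vmul J u z - y)].
move: (xget _ _) => x /(_ (ex_intro _ u (shiftopE J z uy))).
move=> /= /shiftopP xy.
apply/eqP; rewrite -subr_eq0; apply/eqP/(shiftop_inj sJ zO).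
have := T_sub xy uy; congr (T (_, _)); cmodule sJ.
Qed.

Lemma resolv_def J z v u : sphere J -> off_sector (cos w) z ->
  T (u, vmul J u z - v) -> resolv J z v = u.
Proof.
by move=> sJ zO /(resolv_uniq sJ zO) <-; congr resolv; rewrite opprB addrC subrK.
Qed.

Lemma resolvP J z v : sphere J -> off_sector (cos w) z ->
  T (resolv J z v, vmul J (resolv J z v) z - v).
Proof.
move=> sJ zO; have [q [y [_ /(_ _ sJ) /shiftopP h]]] := shiftop_surj v sJ zO.
by rewrite (resolv_def sJ zO h).
Qed.

(* In terms of q = Q_s[T]^-1 v and y = T q, which depend on z and its conjugate,
   but not on J. *)
Lemma resolv_pseudo z J v : sphere J -> off_sector (cos w) z ->
  exists q y, forall J', sphere J' ->
    resolv J' z v = vmul J' q (conjc z) - y /\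
    resolv J' (conjc z) v = vmul J' q z - y.
Proof.
move=> sJ zO; have [q [y [qy h]]] := shiftop_surj v sJ zO.
exists q, y => J' sJ'; have /shiftopP h1 := h _ sJ'; split.
  exact: resolv_def h1.
apply: resolv_def (off_sector_conj zO) _ => //.
have := T_add h1 (T_vmul J' (z - conjc z) qy).
by congr (T (_, _)); cmodule sJ'.
Qed.

Lemma resolv_lin J z a u v : sphere J -> off_sector (cos w) z ->
  resolv J z (a *: u + v) = a *: resolv J z u + resolv J z v.
Proof.
move=> sJ zO; apply: resolv_def => //.
have := T_add (T_scale a (resolvP u sJ zO)) (resolvP v sJ zO).
by congr (T (_, _)); cmodule sJ.
Qed.

Lemma resolv_ractJ J z v : sphere J -> off_sector (cos w) z ->
  resolv J z (ract v J) = ract (resolv J z v) J.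
Proof.
move=> sJ zO; apply: resolv_def => //.
have := T_ract J (resolvP v sJ zO).
by rewrite ractBl /vmul ractDl !ractZl.
Qed.

Lemma resolv_bound (p : R) : w < p < pi / 2 ->
  exists2 C, 0 <= C & forall J z v, sphere J -> z != 0 ->
    `|Re z| <= cos p * normc z -> `|resolv J z v| <= C / normc z * `|v|.
Proof.
move=> /andP[wp ppi]; have [w0 wpi] := andP angle_w.
case: T_bisect => _ _ _ /(_ p); rewrite wp ppi => /(_ isT)[C C0 hC].
have hp : 0 < p < pi / 2 by rewrite (lt_trans w0).
exists C => // J z v sJ z0 zp.
have zO : off_sector (cos w) z.
  apply: le_lt_trans zp _; rewrite ltr_pM2r; last first.
    by rewrite lt_def normc_ge0 andbT; apply: contra z0 => /eqP/eq0_normc ->.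
  by rewrite cos_lt_of_lt // ?(ltW w0) // (le_trans (ltW ppi)) // ler_pdivrMr //
    ler_peMr ?pi_ge0 // ler1n.
rewrite -(cnorm_emb z sJ); apply: (hC _ (paravector_emb z sJ)).
- by rewrite (double_sectorE _ hp) cnorm_emb // Sc_emb // => -[_]; rewrite ltNge zp.
- by rewrite -cnorm_eq0 cnorm_emb //; apply: contra z0 => /eqP/eq0_normc ->.
- have := shiftopE J z (resolvP v sJ zO).
  by rewrite opprB addrC subrK.
Qed.

Lemma resolv_bounded_linear J z : sphere J -> off_sector (cos w) z ->
  bounded_linear J (resolv J z).
Proof.
move=> sJ zO; split; first by move=> a u v; exact: resolv_lin.
  by move=> v; exact: resolv_ractJ.
have [_ [_ dom _ [C hC]]] := off_sector_rho sJ zO.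
have z0 := off_sector_neq0 zO.
have nz : 0 < normc z.
  by rewrite lt_def normc_ge0 andbT; apply: contra z0 => /eqP/eq0_normc ->.
have [w0 wpi] := andP angle_w.
have hc : -1 <= `|Re z| / normc z <= 1.
  rewrite -ler_norml normrM normr_id normfV (ger0_norm (normc_ge0 _)).
  by rewrite ler_pdivrMr // mul1r abs_Re_le_normc.
have [a1 a2] := andP (acos_def hc).1; have a3 := (acos_def hc).2.
have wa : w < acos (`|Re z| / normc z).
  rewrite -ltr_cos ?in_itv /= ?a1 ?a2 ?(ltW w0) //=.
    by rewrite a3 ltr_pdivrMr.
  by rewrite (le_trans (ltW wpi)) // ler_pdivrMr // ler_peMr ?pi_ge0 // ler1n.
(* An angle strictly between w and pi / 2 that does not exceed the angle of z to the real axis, so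
   that z is outside of D_p and the resolvent estimate for p applies. *)
pose p := Num.min (acos (`|Re z| / normc z)) ((w + pi / 2) / 2).
have hp : w < p < pi / 2.
  rewrite /p lt_min wa gt_min /=; apply/andP; split; first by lra.
  by apply/orP; right; lra.
have [C' C'0 hC'] := resolv_bound hp.
exists (C' / normc z); first by rewrite divr_ge0 // ltW.
move=> v; apply: hC' => //; rewrite -ler_pdivrMr // -a3.
have [w0' ppi] := andP hp.
rewrite leNgt ltr_cos ?in_itv /= ?a1 ?a2 //; last first.
  apply/andP; split; first by rewrite (le_trans (ltW w0)) // ltW.
  rewrite (le_trans (ltW ppi)) // ler_pdivrMr // ler_peMr ?pi_ge0 // ler1n //.
by rewrite -leNgt ge_min lexx.
Qed.

Lemma resolvent_identity J z z' v : sphere J ->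
  off_sector (cos w) z -> off_sector (cos w) z' ->
  vmul J (resolv J z (resolv J z' v)) (z - z') = resolv J z' v - resolv J z v.
Proof.
move=> sJ zO zO'; suff -> : resolv J z v =
    resolv J z' v - vmul J (resolv J z (resolv J z' v)) (z - z').
  by rewrite opprB addrCA subrr addr0.
apply: resolv_def => //.
have := T_sub (resolvP v sJ zO') (T_vmul J (z - z') (resolvP (resolv J z' v) sJ zO)).
by congr (T (_, _)); cmodule sJ.
Qed.

Lemma resolv_comm J z z' v : sphere J ->
  off_sector (cos w) z -> off_sector (cos w) z' ->
  resolv J z (resolv J z' v) = resolv J z' (resolv J z v).
Proof.
move=> sJ zO zO'; have [->//|zz'] := eqVneq z z'.
have zz0 : z - z' != 0 by rewrite subr_eq0.
have h1 := resolvent_identity v sJ zO zO'.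
have h2 := resolvent_identity v sJ zO' zO.
have : vmul J (resolv J z (resolv J z' v)) (z - z')
  = vmul J (resolv J z' (resolv J z v)) (z - z').
  by rewrite h1 -[z - z']opprB vmulNr h2 opprB.
move=> /(congr1 (fun x => vmul J x (z - z')^-1)).
by rewrite !vmulM // divff // !vmul1.
Qed.

End Resolvent.

(** * Complex differentiability and Cauchy's theorem *)

Section ComplexDifferentiation.
Context (R : realType).
Implicit Types (z d : R[i]) (h k F : R[i] -> R[i]) (g : R -> R[i]).

Lemma is_deriveP (f : R -> R) (t d : R) :
  is_derive t 1 f d <-> e^-1 * (f (e + t) - f t) @[e --> 0^'] --> d.
Proof.
split => [[df <-]|h].
  have := df; rewrite /derivable /derive /= => /cvgP.
  by under eq_fun do rewrite [_%:A]mulr1.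
have {}h : e^-1 *: (f (e *: 1 + t) - f t) @[e --> 0^'] --> d.
  by under eq_fun do rewrite [_%:A]mulr1.
by split; [apply/cvg_ex; exists d | exact/cvg_lim].
Qed.

Definition cnbhs z : set_system R[i] :=
  filter_from [set e : R | 0 < e] (fun e => [set z' | normc (z' - z) < e]).

Lemma normcB z z' : normc (z - z') = normc (z' - z).
Proof. by rewrite -normcN opprB. Qed.

Global Instance cnbhs_filter z : ProperFilter (cnbhs z).
Proof.
apply: filter_from_proper; last first.
  by move=> e e0; exists z => /=; rewrite subrr normc0.
apply: filter_from_filter; first by exists 1 => /=.
move=> i j i0 j0; exists (Num.min i j); first by rewrite /= lt_min; apply/andP.
by move=> z' /=; rewrite lt_min => /andP.
Qed.

Lemma cnbhs_singleton z (P : set R[i]) : cnbhs z P -> P z.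
Proof. by move=> [e e0]; apply; rewrite /= subrr normc0. Qed.

(** Real and imaginary parts are kept apart, so that limits along any filter reduce to limits of
    real functions. *)
Definition clim (U : Type) (g : U -> R[i]) (FF : set_system U) (l : R[i]) :=
  Re (g x) @[x --> FF] --> Re l /\ Im (g x) @[x --> FF] --> Im l.

Lemma climM (U : Type) (FF : set_system U) {FFF : Filter FF} (g g' : U -> R[i]) l l' :
  clim g FF l -> clim g' FF l' -> clim (fun x => g x * g' x) FF (l * l').
Proof.
move=> [gR gI] [gR' gI']; split.
  by rewrite ReM; under eq_fun do rewrite ReM; apply: cvgB; exact: cvgM.
by rewrite ImM; under eq_fun do rewrite ImM; apply: cvgD; exact: cvgM.
Qed.

Lemma climD (U : Type) (FF : set_system U) {FFF : Filter FF} (g g' : U -> R[i]) l l' :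
  clim g FF l -> clim g' FF l' -> clim (fun x => g x + g' x) FF (l + l').
Proof.
move=> [gR gI] [gR' gI']; split.
  by rewrite ReD; under eq_fun do rewrite ReD; exact: cvgD.
by rewrite ImD; under eq_fun do rewrite ImD; exact: cvgD.
Qed.

Lemma clim_cvg (U : Type) (FF : set_system U) {FFF : Filter FF} (g : U -> R[i]) l :
  clim g FF l -> g x @[x --> FF] `=>` cnbhs l.
Proof.
move=> [/cvgrPdist_lt cR /cvgrPdist_lt cI] P [e e0 eP].
have e20 : 0 < e / 2 by rewrite divr_gt0.
move: (cR _ e20) (cI _ e20); apply: filterS2 => x xR xI; apply: eP => /=.
apply: le_lt_trans (le_normc_abs _) _.
by rewrite !(ReD, ImD, ReN, ImN) distrC (distrC (Im _)) [e]splitr ltrD.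
Qed.

Definition ccont h z := clim h (cnbhs z) (h z).

Lemma ccontP h z : ccont h z <->
  forall e, 0 < e -> \forall z' \near cnbhs z, normc (h z' - h z) < e.
Proof.
split=> [/clim_cvg hz e e0|H].
  by apply: (hz [set x | normc (x - h z) < e]); exists e.
split; apply/cvgrPdist_lt => e /H; apply: filterS => x; apply: le_lt_trans.
  by rewrite -ReN -ReD normcB abs_Re_le_normc.
by rewrite -ImN -ImD normcB abs_Im_le_normc.
Qed.

Lemma clim_comp (U : Type) (FF : set_system U) {FFF : Filter FF} (g : U -> R[i])
    F l : clim g FF l -> ccont F l -> clim (fun x => F (g x)) FF (F l).
Proof.
by move=> /clim_cvg gl [cR cI]; split; [exact: cvg_comp gl cR | exact: cvg_comp gl cI].
Qed.

Lemma ccont_cst d z : ccont (fun=> d) z.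
Proof. by split; exact: cvg_cst. Qed.

Lemma ccont_id z : ccont id z.
Proof. by apply/ccontP => e e0; exists e. Qed.

Lemma ccontD h k z : ccont h z -> ccont k z -> ccont (fun x => h x + k x) z.
Proof. exact: climD. Qed.

Lemma ccontN h z : ccont h z -> ccont (fun x => - h x) z.
Proof.
move=> [hR hI]; split.
  by rewrite ReN; under eq_fun do rewrite ReN; exact: cvgN.
by rewrite ImN; under eq_fun do rewrite ImN; exact: cvgN.
Qed.

Lemma ccontM h k z : ccont h z -> ccont k z -> ccont (fun x => h x * k x) z.
Proof. exact: climM. Qed.

Lemma ReV z : Re z^-1 = Re z / (Re z ^+ 2 + Im z ^+ 2).
Proof. by case: z. Qed.

Lemma ImV z : Im z^-1 = - (Im z / (Re z ^+ 2 + Im z ^+ 2)).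
Proof. by case: z. Qed.

Lemma normc_eq0 z : (normc z == 0) = (z == 0).
Proof. by apply/eqP/eqP => [/eq0_normc|->]; rewrite ?normc0. Qed.

Lemma normc_gt0 z : (0 < normc z) = (z != 0).
Proof. by rewrite lt_def normc_eq0 normc_ge0 andbT. Qed.

Lemma ccontV h z : h z != 0 -> ccont h z -> ccont (fun x => (h x)^-1) z.
Proof.
move=> h0 [hR hI].
have n0 : Re (h z) ^+ 2 + Im (h z) ^+ 2 != 0.
  by rewrite -sqr_normcE sqrf_eq0 normc_eq0.
have hn : (Re (h x) ^+ 2 + Im (h x) ^+ 2)^-1 @[x --> cnbhs z] -->
    (Re (h z) ^+ 2 + Im (h z) ^+ 2)^-1.
  by apply: cvgV => //; apply: cvgD; apply: cvgM.
split.
  by rewrite ReV; under eq_fun do rewrite ReV; exact: cvgM.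
by rewrite ImV; under eq_fun do rewrite ImV; apply: cvgN; exact: cvgM.
Qed.

Lemma near_ccont h k z : (\forall x \near cnbhs z, h x = k x) ->
  ccont h z -> ccont k z.
Proof.
move=> hk /ccontP hc; apply/ccontP => e /hc; have hz := cnbhs_singleton hk.
by apply: filterS2 hk => x /= <-; rewrite hz.
Qed.

(* Caratheodory's form of differentiability. *)
Definition cdiff h z d := exists k,
  [/\ \forall x \near cnbhs z, h x - h z = (x - z) * k x, k z = d & ccont k z].

Lemma cdiff_ccont h z d : cdiff h z d -> ccont h z.
Proof.
move=> [k [hk kz kc]].
apply: (@near_ccont (fun x => h z + (x - z) * k x)).
  by apply: filterS hk => x <-; rewrite addrC subrK.
apply: ccontD; first exact: ccont_cst.
by apply: ccontM => //; apply: ccontD (ccont_id _) (ccont_cst _ _).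
Qed.

Lemma cdiff_cst c z : cdiff (fun=> c) z 0.
Proof.
exists (fun=> 0); split => //; last exact: ccont_cst.
by near=> x; rewrite subrr mulr0.
Unshelve. all: end_near. Qed.

Lemma cdiff_id z : cdiff id z 1.
Proof.
exists (fun=> 1); split => //; last exact: ccont_cst.
by near=> x; rewrite mulr1.
Unshelve. all: end_near. Qed.

Lemma cdiffD h h' z d d' : cdiff h z d -> cdiff h' z d' ->
  cdiff (fun x => h x + h' x) z (d + d').
Proof.
move=> [k [hk kz kc]] [k' [hk' kz' kc']]; exists (fun x => k x + k' x); split.
- by apply: filterS2 hk hk' => x e e'; rewrite mulrDr -e -e'; ring.
- by rewrite kz kz'.
- exact: ccontD.
Qed.

Lemma cdiffN h z d : cdiff h z d -> cdiff (fun x => - h x) z (- d).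
Proof.
move=> [k [hk kz kc]]; exists (fun x => - k x); split.
- by apply: filterS hk => x e; rewrite mulrN -e opprB opprK addrC.
- by rewrite kz.
- exact: ccontN.
Qed.

Lemma cdiffM h h' z d d' : cdiff h z d -> cdiff h' z d' ->
  cdiff (fun x => h x * h' x) z (d * h' z + h z * d').
Proof.
move=> dh dh'; have hc' := cdiff_ccont dh'.
case: dh dh' => [k [hk kz kc]] [k' [hk' kz' kc']].
exists (fun x => k x * h' x + h z * k' x); split.
- apply: filterS2 hk hk' => x e e'; rewrite mulrDr mulrA -e.
  by rewrite mulrCA -e'; ring.
- by rewrite kz kz'.
- apply: ccontD; apply: ccontM => //; exact: ccont_cst.
Qed.

Lemma ccont_neq0 h z : ccont h z -> h z != 0 ->
  \forall x \near cnbhs z, h x != 0.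
Proof.
move=> /ccontP hc h0; have := hc (normc (h z)).
rewrite normc_gt0 => /(_ h0); apply: filterS => x.
by apply: contraTneq => ->; rewrite sub0r normcN ltxx.
Qed.

Lemma cdiffV h z d : h z != 0 -> cdiff h z d ->
  cdiff (fun x => (h x)^-1) z (- d / h z ^+ 2).
Proof.
move=> h0 dh; have hc := cdiff_ccont dh; case: dh => [k [hk kz kc]].
exists (fun x => - k x * (h x)^-1 * (h z)^-1); split.
- apply: filterS2 (ccont_neq0 hc h0) hk => x hx e.
  rewrite mulrA mulrA mulrN -e; field.
  by rewrite h0 hx.
- by rewrite kz expr2 invfM mulrA.
- apply: ccontM (ccont_cst _ _); apply: ccontM; first exact: ccontN.
  exact: ccontV.
Qed.

Lemma near_cdiff h k z d : (\forall x \near cnbhs z, h x = k x) ->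
  cdiff h z d -> cdiff k z d.
Proof.
move=> hk [l [hl lz lc]]; exists l; split => //.
have hz := cnbhs_singleton hk.
by apply: filterS2 hk hl => x /= <-; rewrite -hz.
Qed.

Definition cder g (t : R) d :=
  is_derive t 1 (fun x => Re (g x)) (Re d) /\
  is_derive t 1 (fun x => Im (g x)) (Im d).

Lemma cder_clim g t d : cder g t d -> clim g (nbhs t) (g t).
Proof.
move=> [[/derivable1_diffP/differentiable_continuous cR _]].
by move=> [/derivable1_diffP/differentiable_continuous cI _]; split; [exact: cR | exact: cI].
Qed.

(** In Caratheodory's form the difference quotient of h along g is k (g (e + t)) times that of g,
    and k is continuous at g t. *)
Lemma cder_comp h g t d d' : cdiff h (g t) d -> cder g t d' ->
  cder (fun x => h (g x)) t (d * d').
Proof.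
move=> [k [hk kz [kR kI]]] dg; have gc := clim_cvg (cder_clim dg).
have ge : g (e + t) @[e --> 0^'] `=>` cnbhs (g t).
  move=> P /gc /= H; apply: cvg_within; move: H.
  by rewrite -{1}[t]add0r; exact: (cvgD (@cvg_id _ (nbhs (0:R))) (cvg_cst t)).
have kRe : Re (k (g (e + t))) @[e --> 0^'] --> Re d.
  by rewrite -kz; apply: cvg_comp ge kR.
have kIm : Im (k (g (e + t))) @[e --> 0^'] --> Im d.
  by rewrite -kz; apply: cvg_comp ge kI.
have hE := ge _ hk; case: dg => /is_deriveP dR /is_deriveP dI.
split; apply/is_deriveP.
  rewrite ReM; have : Re (k (g (e + t))) * (e^-1 * (Re (g (e + t)) - Re (g t)))
      - Im (k (g (e + t))) * (e^-1 * (Im (g (e + t)) - Im (g t)))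
      @[e --> 0^'] --> Re d * Re d' - Im d * Im d'.
    by apply: cvgB; exact: cvgM.
  apply: cvg_trans; apply: near_eq_cvg; near=> e.
  have E : h (g (e + t)) - h (g t) = (g (e + t) - g t) * k (g (e + t)).
    by near: e; exact: hE.
  have -> : Re (h (g (e + t))) - Re (h (g t)) = Re (h (g (e + t)) - h (g t)).
    by rewrite ReD ReN.
  by rewrite E ReM ReD ImD ReN ImN; ring.
rewrite ImM; have : Re (k (g (e + t))) * (e^-1 * (Im (g (e + t)) - Im (g t)))
    + Im (k (g (e + t))) * (e^-1 * (Re (g (e + t)) - Re (g t)))
    @[e --> 0^'] --> Re d * Im d' + Im d * Re d'.
  by apply: cvgD; exact: cvgM.
apply: cvg_trans; apply: near_eq_cvg; near=> e.
have E : h (g (e + t)) - h (g t) = (g (e + t) - g t) * k (g (e + t)).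
  by near: e; exact: hE.
have -> : Im (h (g (e + t))) - Im (h (g t)) = Im (h (g (e + t)) - h (g t)).
  by rewrite ImD ImN.
by rewrite E ImM ReD ImD ReN ImN; ring.
Unshelve. all: end_near. Qed.

End ComplexDifferentiation.

Section Holomorphy.
Context (R : realType).
Implicit Types (z d : R[i]) (h k : R[i] -> R[i]) (D : set R[i]).

(** Continuity of the derivative is included: it matches the C1 condition in [intrinsic] and is used
    to differentiate under the integral sign. *)
Definition holo D h h' := forall z, D z -> cdiff h z (h' z) /\ ccont h' z.

Definition copen D := forall z, D z -> \forall x \near cnbhs z, D x.

Lemma holo_ccont D h h' z : holo D h h' -> D z -> ccont h z.
Proof. by move=> hh /hh[/cdiff_ccont]. Qed.

Lemma holoD D h h' k k' : holo D h h' -> holo D k k' ->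
  holo D (fun z => h z + k z) (fun z => h' z + k' z).
Proof.
move=> hh kk z Dz; have [h1 h2] := hh z Dz; have [k1 k2] := kk z Dz.
by split; [exact: cdiffD | exact: ccontD].
Qed.

Lemma holoM D h h' k k' : holo D h h' -> holo D k k' ->
  holo D (fun z => h z * k z) (fun z => h' z * k z + h z * k' z).
Proof.
move=> hh kk z Dz; have [h1 h2] := hh z Dz; have [k1 k2] := kk z Dz.
split; first exact: cdiffM.
by apply: ccontD; apply: ccontM => //; apply: cdiff_ccont; eassumption.
Qed.

Lemma holoV D h h' : holo D h h' -> (forall z, D z -> h z != 0) ->
  holo D (fun z => (h z)^-1) (fun z => - h' z / h z ^+ 2).
Proof.
move=> hh h0 z Dz; have [h1 h2] := hh z Dz; have hz := h0 z Dz.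
split; first exact: cdiffV.
apply: ccontM; first exact: ccontN.
apply: ccontV; first by rewrite expf_eq0.
by apply: ccontM; apply: cdiff_ccont; eassumption.
Qed.

Lemma holo_cst D c : holo D (fun=> c) (fun=> 0).
Proof. by move=> z _; split; [exact: cdiff_cst | exact: ccont_cst]. Qed.

Lemma holo_id D : holo D id (fun=> 1).
Proof. by move=> z _; split; [exact: cdiff_id | exact: ccont_cst]. Qed.

Lemma holoS D D' h h' : D' `<=` D -> holo D h h' -> holo D' h h'.
Proof. by move=> DD hh z /DD/hh. Qed.

Lemma eq_holo D h k h' : copen D -> (forall z, D z -> h z = k z) ->
  holo D h h' -> holo D k h'.
Proof.
move=> oD hk hh z Dz; have [h1 h2] := hh z Dz; split => //.
by apply: near_cdiff h1; apply: filterS (oD z Dz) => x; exact: hk.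
Qed.

Lemma near_complex z (P : R -> R -> Prop) :
  (\forall p \near (Re z, Im z), P p.1 p.2) <->
  (\forall x \near cnbhs z, P (Re x) (Im x)).
Proof.
split.
  move=> /nbhs_ballP[e /= e0 eP]; exists e => // x /= xz; apply: (eP (_, _)).
  split; rewrite /ball /= distrC.
    by rewrite -ReN -ReD (le_lt_trans (abs_Re_le_normc _)).
  by rewrite -ImN -ImD (le_lt_trans (abs_Im_le_normc _)).
move=> [e e0 eP]; apply/nbhs_ballP; exists (e / 2) => /=; first by rewrite divr_gt0.
move=> [x y] [/= bx by_]; apply: (eP (x +i* y)) => /=.
apply: le_lt_trans (le_normc_abs _) _.
rewrite ReD ImD ReN ImN /= distrC (distrC y) [e]splitr ltrD //.
Qed.

(** The increment is split at the corner (Re z, Im x). The horizontal part is handled by the mean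
    value theorem and the continuity of the x-derivative, the vertical part by differentiability in
    y at z. *)
Lemma C1_expansion (H : R -> R -> R) z (e : R) : 0 < e ->
  (\forall x \near cnbhs z, C1_at H (Re x) (Im x)) ->
  \forall x \near cnbhs z,
  `|H (Re x) (Im x) - H (Re z) (Im z) - (partialx H (Re z) (Im z) * (Re x - Re z)
    + partialy H (Re z) (Im z) * (Im x - Im z))|
  <= e * (`|Re x - Re z| + `|Im x - Im z|).
Proof.
move=> e0 HC; have [_ dy cx _] := cnbhs_singleton HC.
move/cvgrPdist_lt: cx => /(_ _ e0) /= cx.
have {}cx := (near_complex z
  (fun a b => `|partialx H (Re z) (Im z) - partialx H a b| < e)).1 cx.
have [r r0 hr] : cnbhs z (fun x => derivable (H ^~ (Im x)) (Re x) 1 /\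
    `|partialx H (Re z) (Im z) - partialx H (Re x) (Im x)| < e).
  by apply: filterS2 HC cx => x [].
have dy' : \forall t \near Im z,
    `|H (Re z) t - H (Re z) (Im z) - partialy H (Re z) (Im z) * (t - Im z)|
    <= e * `|t - Im z|.
  have /is_deriveP : is_derive (Im z) 1 (H (Re z)) (partialy H (Re z) (Im z)).
    by split => //; rewrite /partialy derive1E.
  move=> /cvgrPdist_lt /(_ _ e0); rewrite near_withinE => -[s /= s0 hs].
  exists s => //= t /=; rewrite distrC => ts; have [->|tz] := eqVneq t (Im z).
    by rewrite !subrr mulr0 subrr normr0 mulr0.
  have t0 : t - Im z != 0 by rewrite subr_eq0.
  have := hs (t - Im z); rewrite /= sub0r normrN => /(_ ts t0).
  rewrite subrK => /ltW; rewrite -(ler_pM2r (_ : 0 < `|t - Im z|)); last first.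
    by rewrite normr_gt0.
  rewrite -normrM -normrN; congr (`|_| <= _).
  by field.
have {}dy' : \forall x \near cnbhs z,
    `|H (Re z) (Im x) - H (Re z) (Im z) - partialy H (Re z) (Im z) * (Im x - Im z)|
    <= e * `|Im x - Im z|.
  case: dy' => s /= s0 hs; exists s => //= x xz; apply: hs => /=.
  by rewrite distrC -ImN -ImD (le_lt_trans (abs_Im_le_normc _)).
near=> x; pose f t := H t (Im x).
have xr : normc (x - z) < r by near: x; exists r.
have near_c c : `|c - Re z| <= `|Re x - Re z| -> normc ((c +i* Im x) - z) < r.
  move=> hc; apply: le_lt_trans xr; rewrite -(@ler_pXn2r _ 2) ?nnegrE ?normc_ge0 //.
  rewrite !sqr_normcE !(ReD, ImD, ReN, ImN) /= lerD2r.
  by rewrite -(real_normK (num_real (c - _))) -(real_normK (num_real (Re x - _)))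
    ler_pXn2r ?nnegrE.
have [c cI cE] : exists2 c, `|c - Re z| <= `|Re x - Re z| &
    f (Re x) - f (Re z) = partialx H c (Im x) * (Re x - Re z).
  have seg c : `|c - Re z| <= `|Re x - Re z| ->
      is_derive c 1 f (partialx H c (Im x)).
    by move=> /near_c /hr /= [dc _]; split => //; rewrite /partialx derive1E.
  have [xz|zx] := leP (Re x) (Re z).
    have seg' c : c \in `[Re x, Re z] -> is_derive c 1 f (partialx H c (Im x)).
      rewrite in_itv /= => /andP[c1 c2]; apply: seg.
      by rewrite !ler0_norm ?subr_le0 // lerN2 lerD2r.
    have fc : {within `[Re x, Re z], continuous f}.
      by apply: derivable_within_continuous => c /seg'[].
    have [c] := MVT_segment xz (fun c hc => seg' c (subset_itv_oo_cc hc)) fc.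
    rewrite in_itv /= => /andP[c1 c2] cE; exists c.
      by rewrite !ler0_norm ?subr_le0 // lerN2 lerD2r.
    by rewrite -[LHS]opprB cE -mulrN opprB.
  have seg' c : c \in `[Re z, Re x] -> is_derive c 1 f (partialx H c (Im x)).
    rewrite in_itv /= => /andP[c1 c2]; apply: seg.
    by rewrite !ger0_norm ?subr_ge0 ?lerD2r // ltW.
  have fc : {within `[Re z, Re x], continuous f}.
    by apply: derivable_within_continuous => c /seg'[].
  have [c] := MVT_segment (ltW zx) (fun c hc => seg' c (subset_itv_oo_cc hc)) fc.
  rewrite in_itv /= => /andP[c1 c2] cE; exists c => //.
  by rewrite !ger0_norm ?subr_ge0 ?lerD2r // ltW.
have dc : `|partialx H (Re z) (Im z) - partialx H c (Im x)| < e.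
  by have /hr /= [] := near_c _ cI.
have -> : H (Re x) (Im x) - H (Re z) (Im z) - (partialx H (Re z) (Im z) *
    (Re x - Re z) + partialy H (Re z) (Im z) * (Im x - Im z)) =
  (partialx H c (Im x) - partialx H (Re z) (Im z)) * (Re x - Re z) +
  (H (Re z) (Im x) - H (Re z) (Im z) - partialy H (Re z) (Im z) * (Im x - Im z)).
  have -> : H (Re x) (Im x) = H (Re z) (Im x) + partialx H c (Im x) * (Re x - Re z).
    by rewrite -cE /f addrC subrK.
  by ring.
apply: le_trans (ler_normD _ _) _; rewrite [leRHS]mulrDr lerD //; last first.
  by near: x.
by rewrite normrM ler_wpM2r // distrC ltW.
Unshelve. all: end_near. Qed.

Definition cpair (a b : R -> R -> R) z : R[i] := a (Re z) (Im z) +i* b (Re z) (Im z).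

Lemma cauchy_riemann_holo D a b : copen D ->
  (forall z, D z -> cauchy_riemann a b (Re z) (Im z)) ->
  holo D (cpair a b) (cpair (partialx a) (partialx b)).
Proof.
move=> oD CR z Dz; have Dn := oD z Dz.
have Ca : \forall x \near cnbhs z, C1_at a (Re x) (Im x).
  by apply: filterS Dn => x /CR[].
have Cb : \forall x \near cnbhs z, C1_at b (Re x) (Im x).
  by apply: filterS Dn => x /CR[].
have [ca cb exy eyx] := CR z Dz; split; last first.
  have cont (H : R -> R -> R) : {for (Re z, Im z), continuous
      (fun p : R * R => partialx H p.1 p.2)} ->
      partialx H (Re x) (Im x) @[x --> cnbhs z] --> partialx H (Re z) (Im z).
    move=> /cvgrPdist_lt hc; apply/cvgrPdist_lt => e /hc /=.
    exact: (near_complex z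
      (fun a b => `|partialx H (Re z) (Im z) - partialx H a b| < e)).1.
  by split; apply: cont; [case: ca | case: cb].
set d := cpair _ _ z; set h := cpair a b.
(* The Caratheodory factor is the difference quotient, completed by its limit at z. *)
exists (fun x => if x == z then d else (h x - h z) / (x - z)); split.
- near=> x; case: eqP => [->|/eqP xz]; first by rewrite !subrr mul0r.
  by rewrite mulrC divfK // subr_eq0.
- by rewrite eqxx.
(* Two expansions, each with error e / 8 times a sum of two terms at most |x - z|, give e / 2 in
   all. *)
- apply/ccontP => e e0; have e4 : 0 < e / 8 by rewrite divr_gt0.
  rewrite eqxx; apply: filterS2 (C1_expansion e4 Ca) (C1_expansion e4 Cb) => x.
  rewrite eyx -exy => ea eb; have [_|xz] := eqVneq x z.
    by rewrite subrr normc0.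
  have xz0 : x - z != 0 by rewrite subr_eq0.
  have -> : (h x - h z) / (x - z) - d = (h x - h z - d * (x - z)) / (x - z).
    by field.
  rewrite normcM normcV ltr_pdivrMr ?normc_gt0 //.
  apply: le_lt_trans (le_normc_abs _) _.
  have eRe : `|Re x - Re z| <= normc (x - z).
    by rewrite -ReN -ReD abs_Re_le_normc.
  have eIm : `|Im x - Im z| <= normc (x - z).
    by rewrite -ImN -ImD abs_Im_le_normc.
  have {}ea : `|Re (h x - h z - d * (x - z))| <= e / 8 * (`|Re x - Re z| + `|Im x - Im z|).
    apply: le_trans ea; rewrite !(ReD, ImD, ReN, ImN, ReM, ImM) /=.
    by rewrite mulNr.
  have {}eb : `|Im (h x - h z - d * (x - z))| <= e / 8 * (`|Re x - Re z| + `|Im x - Im z|).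
    apply: le_trans eb; rewrite !(ReD, ImD, ReN, ImN, ReM, ImM) /=.
    by rewrite [X in _ - X]addrC.
  have n0 : 0 < normc (x - z) by rewrite normc_gt0.
  apply: (le_lt_trans (lerD ea eb)).
  have : e / 8 * (`|Re x - Re z| + `|Im x - Im z|) <= e / 8 * (normc (x - z) + normc (x - z)).
    by rewrite ler_pM2l // lerD.
  have : 0 < e * normc (x - z) by rewrite mulr_gt0.
  by set N := normc _; set M := e / 8 * (_ + _ : R); lra.
Unshelve. all: end_near. Qed.

(** The way back to [intrinsic]: functions built on the complex plane, such as a cut-off divided by
    a quadratic polynomial, must be fed to the hypothesis on the calculus. *)
Lemma holo_cauchy_riemann D h h' z : copen D -> holo D h h' -> D z ->
  cauchy_riemann (fun x y => Re (h (x +i* y))) (fun x y => Im (h (x +i* y)))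
    (Re z) (Im z).
Proof.
move=> oD hh Dz.
have eta (x : R[i]) : (Re x +i* Im x) = x by case: x.
have dx x : D x -> cder (fun t => h (t +i* Im x)) (Re x) (h' x).
  move=> Dx; rewrite -[h' x]mulr1; apply: cder_comp; first by rewrite eta; case: (hh x Dx).
  by split => /=; [exact: is_derive_id | exact: is_derive_cst].
have dy x : D x -> cder (fun t => h (Re x +i* t)) (Im x) (h' x * (0 +i* 1)).
  move=> Dx; apply: cder_comp; first by rewrite eta; case: (hh x Dx).
  by split => /=; [exact: is_derive_cst | exact: is_derive_id].
have cont (f : R -> R -> R) (g : R[i] -> R) :
    (forall x, D x -> f (Re x) (Im x) = g x) ->
    g x @[x --> cnbhs z] --> g z ->
    {for (Re z, Im z), continuous (fun p : R * R => f p.1 p.2)}.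
  move=> fg /cvgrPdist_lt gz; apply/cvgrPdist_lt => e /gz /= ge.
  apply/(near_complex z (fun a b => `|f (Re z) (Im z) - f a b| < e)).
  by apply: filterS2 (oD z Dz) ge => x Dx; rewrite !fg.
have pxR x : D x -> partialx (fun x y => Re (h (x +i* y))) (Re x) (Im x) = Re (h' x).
  by move=> /dx[+ _] => d; rewrite /partialx derive1E derive_val.
have pxI x : D x -> partialx (fun x y => Im (h (x +i* y))) (Re x) (Im x) = Im (h' x).
  by move=> /dx[_] d; rewrite /partialx derive1E derive_val.
have pyR x : D x -> partialy (fun x y => Re (h (x +i* y))) (Re x) (Im x) = - Im (h' x).
  move=> /dy[+ _] => d; rewrite /partialy derive1E derive_val.
  by rewrite ReM /= mulr0 mulr1 sub0r.
have pyI x : D x -> partialy (fun x y => Im (h (x +i* y))) (Re x) (Im x) = Re (h' x).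
  move=> /dy[_] d; rewrite /partialy derive1E derive_val.
  by rewrite ImM /= mulr0 mulr1 addr0.
have [_ [hR hI]] := hh z Dz.
split.
- split; [by have [[]] := dx z Dz | by have [[]] := dy z Dz | |].
    exact: cont hR.
  by apply: cont (cvgN hI); exact: pyR.
- split; [by have [_ []] := dx z Dz | by have [_ []] := dy z Dz | |].
    exact: cont hI.
  exact: cont hR.
- by rewrite pxR // pyI.
- by rewrite pyR // pxI.
Qed.

End Holomorphy.

(** * An integrable majorant on the half line *)

Section Majorant.
Context (R : realType).
Local Notation mu := (@lebesgue_measure R).

Definition halfline : set R := `]0, +oo[%classic.

Lemma halflineE (r : R) : halfline r = (0 < r) :> Prop.
Proof. by rewrite /halfline /= in_itv /= andbT. Qed.

Lemma measurable_halfline : measurable halfline.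
Proof. exact: measurable_itv. Qed.

(** The decay required in N^0. The resolvent contributes a further 1 / r, so [dom a r / r] is the
    majorant of every ray integral. *)
Definition dom (a r : R) : R := r `^ a / (1 + r `^ (2 * a)).

Lemma dom_den (a r : R) : 0 < 1 + r `^ (2 * a).
Proof. by rewrite ltr_pwDl // powR_ge0. Qed.

Lemma dom_ge0 (a r : R) : 0 <= dom a r.
Proof. by rewrite divr_ge0 ?powR_ge0 // ltW // dom_den. Qed.

Lemma dom_le_pow (a r : R) : dom a r <= r `^ a.
Proof.
rewrite ler_pdivrMr ?dom_den // ler_peMr ?powR_ge0 //.
by rewrite lerDl powR_ge0.
Qed.

(** The symmetry that lets the ends 0 and infinity of a ray share one estimate. *)
Lemma domV (a r : R) : 0 < r -> dom a r^-1 = dom a r.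
Proof.
move=> r0; have hV b : r^-1 `^ b = (r `^ b)^-1.
  apply: (@mulIf _ (r `^ b)); first by rewrite gt_eqF // powR_gt0.
  by rewrite -powRM ?invr_ge0 ?ltW // mulVf ?gt_eqF // powR1 mulVf // gt_eqF // powR_gt0.
have h2 : r `^ (2 * a) = r `^ a ^+ 2.
  by rewrite mulrC powRrM powR_mulrn ?powR_ge0.
have p0 : 0 < r `^ a by rewrite powR_gt0.
rewrite /dom !hV h2; field.
by rewrite !gt_eqF ?addr_gt0 ?exprn_gt0.
Qed.

(** Compact and away from 0. The shift by two keeps the end points distinct for n = 0, as the
    fundamental theorem of calculus requires. *)
Definition exhaust (n : nat) : set R := `[n.+2%:R^-1, n.+2%:R].

Lemma exhaust_lt (n : nat) : (n.+2%:R^-1 : R) < n.+2%:R.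
Proof.
by rewrite (@lt_trans _ _ 1) // ?ltr1n // invf_lt1 // ?ltr1n // ltr0n.
Qed.

Lemma exhaust_sub n : exhaust n `<=` halfline.
Proof.
move=> r; rewrite /exhaust /halfline /= !in_itv /= andbT => /andP[+ _].
by apply: lt_le_trans; rewrite invr_gt0 ltr0n.
Qed.

Lemma exhaustS n : exhaust n `<=` exhaust n.+1.
Proof.
move=> r; rewrite /exhaust /= !in_itv /= => /andP[h1 h2]; apply/andP; split.
  by apply: le_trans h1; rewrite lef_pV2 ?posrE ?ltr0n // ler_nat.
by apply: le_trans h2 _; rewrite ler_nat.
Qed.

Lemma exhaust_nd : {homo exhaust : n m / (n <= m)%N >-> (n <= m)%O}.
Proof. by apply/nondecreasing_seqP => n; apply/subsetPset; exact: exhaustS. Qed.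

Lemma exhaust_bigcup : \bigcup_n exhaust n = halfline.
Proof.
apply/seteqP; split; first by move=> r [n _]; exact: exhaust_sub.
move=> r; rewrite halflineE => r0.
pose m := (Num.truncn (r + r^-1)).
have rm : r + r^-1 < m.+1%:R.
  by rewrite truncnS_gt.
exists m => //; rewrite /exhaust /= in_itv /=; apply/andP; split.
  rewrite -[leRHS]invrK lef_pV2 ?posrE ?invr_gt0 ?ltr0n //.
  apply/ltW/(lt_trans _ (_ : m.+1%:R < _)); last by rewrite ltr_nat.
  by apply: le_lt_trans rm; rewrite lerDr ltW.
apply/ltW/(lt_trans _ (_ : m.+1%:R < _)); last by rewrite ltr_nat.
by apply: le_lt_trans rm; rewrite lerDl invr_ge0 ltW.
Qed.

Lemma is_derive_dom_primitive (a r : R) : 0 < a -> 0 < r ->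
  is_derive r 1 (fun t => a^-1 * atan (t `^ a)) (dom a r / r).
Proof.
move=> a0 r0.
have h := is_derive1_comp (g := fun t => t `^ a) (is_derive1_atan (r `^ a)) (is_derive1_powR a r0).
have := @is_deriveZ _ _ _ _ a^-1 _ _ _ h.
congr (is_derive _ _ _ _); rewrite /GRing.scale /= /dom.
have -> : r `^ (2 * a) = r `^ a ^+ 2.
  by rewrite mulrC powRrM powR_mulrn ?powR_ge0.
have -> : r `^ (a - 1) = r `^ a / r.
  by rewrite powRB ?powRr1 ?ltW // (gt_eqF r0) implybT.
have d0 : 1 + r `^ a ^+ 2 != 0.
  by rewrite gt_eqF // ltr_pwDl // exprn_ge0 // powR_ge0.
by field; rewrite d0 !gt_eqF.
Qed.

Lemma continuous_powR_gt0 (a r : R) : 0 < r -> {for r, continuous (fun t => t `^ a)}.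
Proof.
move=> /(is_derive1_powR a) [+ _].
by move=> /derivable1_diffP/differentiable_continuous.
Qed.

Lemma continuous_dom (a r : R) : 0 < r -> {for r, continuous (fun t => dom a t / t)}.
Proof.
move=> r0; apply: cvgM; last by apply: cvgV; [rewrite gt_eqF | exact: cvg_id].
apply: cvgM; first exact: continuous_powR_gt0.
apply: cvgV; first by rewrite gt_eqF // dom_den.
by apply: cvgD; [exact: cvg_cst | exact: continuous_powR_gt0].
Qed.

Lemma measurable_halfline_continuous (f : R -> R) :
  (forall r, 0 < r -> {for r, continuous f}) -> measurable_fun halfline f.
Proof.
move=> fc; apply: open_continuous_measurable_fun; first exact: interval_open.
by move=> r; rewrite inE halflineE => /fc.
Qed.

(** The primitive a^-1 atan (r^a) lies between 0 and a^-1 pi / 2, which bounds the integrals over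
    all exhausting intervals; monotone convergence concludes. *)
Lemma integrable_dom (a : R) : 0 < a ->
  mu.-integrable halfline (EFin \o (fun r => dom a r / r)).
Proof.
move=> a0; pose m r := dom a r / r.
have m0 r : halfline r -> 0 <= m r.
  by rewrite halflineE => r0; rewrite divr_ge0 ?dom_ge0 // ltW.
have mm : measurable_fun halfline m.
  by apply: measurable_halfline_continuous => r; exact: continuous_dom.
apply/integrableP; split; first exact/measurable_EFinP.
have -> : (\int[mu]_(r in halfline) `|(EFin \o m) r|)%E
    = (\int[mu]_(r in halfline) (m r)%:E)%E.
  by apply: eq_integral => r; rewrite inE => /m0 hr; rewrite /= ger0_norm.
have mc : (\int[mu]_(r in exhaust n) (m r)%:E)%E @[n --> \oo]
    --> (\int[mu]_(r in halfline) (m r)%:E)%E.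
  rewrite -exhaust_bigcup; apply: ge0_nondecreasing_set_cvg_integral.
  - exact: exhaust_nd.
  - by move=> i; exact: measurable_itv.
  - move=> i; apply/measurable_EFinP; apply: measurable_funS mm.
      exact: measurable_halfline.
    exact: exhaust_sub.
  - by move=> i r /exhaust_sub/m0; rewrite lee_fin.
apply: (@le_lt_trans _ _ (a^-1 * (pi / 2))%:E); last by rewrite ltry.
rewrite -(cvg_lim _ mc) //; apply: lime_le; first by apply/cvg_ex; eexists; exact: mc.
apply: nearW => n.
have en0 : (0 : R) < n.+2%:R^-1 by rewrite invr_gt0 ltr0n.
pose F t : R := a^-1 * atan (t `^ a).
have dF (r : R) : 0 < r -> is_derive r 1 F (m r).
  by move=> r0; exact: is_derive_dom_primitive.
have cF (r : R) : 0 < r -> {for r, continuous F}.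
  by move=> /dF[/derivable1_diffP/differentiable_continuous].
rewrite (@continuous_FTC2 _ m F _ _ (exhaust_lt n)).
- rewrite -EFinB lee_fin lerBlDr -[leLHS]addr0 lerD //.
    by rewrite ler_pM2l ?invr_gt0 // ltW // atan_ltpi2.
  rewrite mulr_ge0 ?invr_ge0 ?(ltW a0) //.
  by rewrite -atan0 le_atan // powR_ge0.
- apply: continuous_in_subspaceT => r; rewrite inE /= in_itv /= => /andP[rn _].
  by apply: continuous_dom; exact: lt_le_trans rn.
- split.
  + by move=> r; rewrite in_itv /= => /andP[rn _]; case: (dF r (lt_trans en0 rn)).
  + by apply: cvg_at_right_filter; exact: cF.
  + by apply: cvg_at_left_filter; apply: cF; rewrite ltr0n.
- move=> r; rewrite in_itv /= => /andP[rn _].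
  by rewrite derive1E; have [_] := dF r (lt_trans en0 rn).
Qed.

Lemma cvg_exhaust_Rintegral (g : R -> R) : mu.-integrable halfline (EFin \o g) ->
  (\int[mu]_(r in exhaust n) g r) @[n --> \oo] --> \int[mu]_(r in halfline) g r.
Proof.
move=> ig; have mH := measurable_halfline.
have mg : measurable_fun halfline (EFin \o g) := measurable_int _ ig.
have gE n : \int[mu]_(r in exhaust n) g r =
    fine (\int[mu]_(r in halfline) ((g \_ (exhaust n)) r)%:E)%E.
  by rewrite -[exhaust n in LHS](setIidr (@exhaust_sub n)) Rintegral_mkcondr.
under eq_fun do rewrite gE.
apply: fine_cvg; rewrite fineK; last exact: integrable_fin_num.
pose f_ n r := ((g \_ (exhaust n)) r)%:E.
have mf n : measurable_fun halfline (f_ n).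
  apply/measurable_EFinP; apply/measurable_restrict => //.
    exact: measurable_itv.
  apply: (measurable_funS mH); first exact: subIsetl.
  exact/measurable_EFinP.
have cf : {ae mu, forall r, halfline r -> f_ ^~ r @ \oo --> (EFin \o g) r}.
  apply/aeW => r; rewrite -exhaust_bigcup => -[m _ mr].
  apply: cvg_near_cst; near=> k; rewrite /f_ patchE mem_set //.
  have mk : (m <= k)%N by near: k; exact: nbhs_infty_ge.
  by move/exhaust_nd: mk => /subsetPset; apply.
have ig' : mu.-integrable halfline (fun r => `|g r|%:E).
  exact: integrable_norm.
have bf : {ae mu, forall r n, halfline r -> (`|f_ n r| <= `|g r|%:E)%E}.
  apply/aeW => r n _; rewrite /f_ /= lee_fin patchE; case: ifP => // _.
  by rewrite normr0.
by have [] := @dominated_convergence _ _ _ mu _ mH f_ _ _ mf mg cf ig' bf.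
Unshelve. all: end_near. Qed.

Lemma dom_cvg0 (a : R) : 0 < a -> dom a n.+2%:R @[n --> \oo] --> (0 : R).
Proof.
move=> a0; apply: (@squeeze_cvgr _ _ _ _ (fun=> 0) (fun n => (n.+2%:R^-1 : R) `^ a)).
- near=> n; rewrite dom_ge0 /= -domV ?ltr0n //; exact: dom_le_pow.
- exact: cvg_cst.
- have h : (n.+2%:R^-1 : R) @[n --> \oo] --> 0^'+.
    move=> P [e /= e0 eP]; rewrite nbhs_filterE /fmap /=; near=> n.
    have n0 : (0 : R) < n.+2%:R^-1 by rewrite invr_gt0 ltr0n.
    apply: (eP _ _ n0); rewrite /= sub0r normrN ger0_norm ?(ltW n0) //.
    apply: le_lt_trans (_ : n.+1%:R^-1 < e).
      by rewrite lef_pV2 ?posrE ?ltr0n // ler_nat.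
    near: n; move/cvgrPdist_lt: (@cvg_harmonic R) => /(_ _ e0).
    apply: filterS => n; rewrite sub0r normrN; apply: le_lt_trans.
    by rewrite ler_norm.
  exact: cvg_comp h (powR_cvg0 a0).
Unshelve. all: end_near. Qed.

End Majorant.

(** * Cauchy's theorem as the rotation of a ray *)

Section RayIntegral.
Context (R : realType).
Local Notation mu := (@lebesgue_measure R).
Implicit Types (z d : R[i]) (F : R[i] -> R[i]).

Lemma cderM (g g' : R -> R[i]) (t : R) d d' : cder g t d -> cder g' t d' ->
  cder (fun x => g x * g' x) t (d * g' t + g t * d').
Proof.
move=> [gR gI] [gR' gI']; split.
  have := is_deriveB (is_deriveM gR gR') (is_deriveM gI gI').
  rewrite (_ : _ - _ = (fun x => Re (g x * g' x))); last first.
    by apply/funext => x; rewrite ReM.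
  congr (is_derive _ _ _ _); rewrite /GRing.scale /= ReD !ReM.
  by ring.
have := is_deriveD (is_deriveM gR gI') (is_deriveM gI gR').
rewrite (_ : _ + _ = (fun x => Im (g x * g' x))); last first.
  by apply/funext => x; rewrite ImM.
congr (is_derive _ _ _ _); rewrite /GRing.scale /= ImD !ImM.
by ring.
Qed.

Lemma cder_cst (c : R[i]) (t : R) : cder (fun=> c) t 0.
Proof. by split; exact: is_derive_cst. Qed.

Lemma cder_real (t : R) : cder (fun r => r%:C) t 1.
Proof. by split; [exact: is_derive_id | exact: is_derive_cst]. Qed.

Definition cexp (t : R) : R[i] := cos t +i* sin t.

Local Notation iC := (0 +i* 1 : R[i]).

Lemma cder_cexp (t : R) : cder cexp t (iC * cexp t).
Proof.
split; rewrite ?ReM ?ImM /= !mul0r !mul1r ?sub0r ?add0r.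
  exact: is_derive_cos.
exact: is_derive_sin.
Qed.

Lemma normc_cexp (t : R) : normc (cexp t) = 1.
Proof. by rewrite /= cos2Dsin2 sqrtr1. Qed.

Lemma normc_real (r : R) : normc r%:C = `|r|.
Proof. by rewrite /= expr0n addr0 sqrtr_sqr. Qed.

Definition pol (r t : R) : R[i] := r%:C * cexp t.

Lemma normc_pol (r t : R) : 0 < r -> normc (pol r t) = r.
Proof. by move=> r0; rewrite normcM normc_cexp normc_real mulr1 gtr0_norm. Qed.

Lemma cder_pol_r (r t : R) : cder (pol ^~ t) r (cexp t).
Proof.
have := cderM (cder_real r) (cder_cst (cexp t) r).
by rewrite mul1r mulr0 addr0.
Qed.

Lemma cder_pol_t (r t : R) : cder (pol r) t (r%:C * (iC * cexp t)).
Proof. by have := cderM (cder_cst r%:C t) (cder_cexp t); rewrite mul0r add0r. Qed.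

(* For s = r e^{it}, s/|s| is e^{it} and ds_J = e^{it} (-J) dr, whence the
   imaginary part. *)
Definition ray F (t r : R) : R := Im (F (pol r t) * cexp t).

Definition ray_integral F (t : R) : R := \int[mu]_(r in @halfline R) ray F t r.

Lemma abs_ray_le F (t r : R) : `|ray F t r| <= normc (F (pol r t)).
Proof. by apply: le_trans (abs_Im_le_normc _) _; rewrite normcM normc_cexp mulr1. Qed.

Section Rotation.
Variables (D : set R[i]) (F F' : R[i] -> R[i]) (u v : R).
Hypothesis FD : holo D F F'.
Hypothesis Dpol : forall r t, 0 < r -> t \in `]u, v[ -> D (pol r t).

(** Cauchy-Riemann in polar coordinates: the t-derivative of F(z) e^{it} is i times the r-derivative
    of r F(z) e^{it}, where z = r e^{it}. So [P] is both the angular derivative of the integrand and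
    the radial derivative of [H]. *)
Let P (r t : R) : R :=
  Re (F (pol r t) * cexp t + r%:C * F' (pol r t) * cexp t * cexp t).

Let H (t r : R) : R := Re (r%:C * F (pol r t) * cexp t).

Lemma is_derive_ray (r t : R) : 0 < r -> t \in `]u, v[ ->
  is_derive t 1 (fun s => ray F s r) (P r t).
Proof.
move=> r0 /(Dpol r0)/FD[dF _].
have [_] := cderM (cder_comp dF (cder_pol_t r t)) (cder_cexp t).
congr (is_derive _ _ _ _).
have ImR (z : R[i]) : Im (iC * z) = Re z by rewrite ImM /= mul0r mul1r add0r.
by rewrite /P -ImR; congr (Im _); ring.
Qed.

Lemma is_derive_flux (r t : R) : 0 < r -> t \in `]u, v[ ->
  is_derive r 1 (H t) (P r t).
Proof.
move=> r0 /(Dpol r0)/FD[dF _].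
have [+ _] := cderM (cderM (cder_real r) (cder_comp (g := pol ^~ t) dF (cder_pol_r r t)))
  (cder_cst (cexp t) r).
by congr (is_derive _ _ _ _); rewrite /P; congr (Re _); ring.
Qed.

Lemma continuous_rotation (r t : R) : 0 < r -> t \in `]u, v[ ->
  {for (r, t), continuous (fun p : R * R => P p.1 p.2)}.
Proof.
move=> r0 tuv; have Dp := Dpol r0 tuv; have [_ F'c] := FD Dp.
have Fc := holo_ccont FD Dp.
have cr : clim (fun p : R * R => p.1%:C) (nbhs (r, t)) r%:C.
  by split; [exact: cvg_fst | exact: cvg_cst].
have ct : clim (fun p : R * R => cexp p.2) (nbhs (r, t)) (cexp t).
  split; apply: (@cvg_comp _ _ _ snd _ _ (nbhs t)); try exact: cvg_snd.
    exact: continuous_cos.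
  exact: continuous_sin.
have cp : clim (fun p : R * R => pol p.1 p.2) (nbhs (r, t)) (pol r t).
  exact: climM.
have [+ _] : clim (fun p : R * R => F (pol p.1 p.2) * cexp p.2 + p.1%:C *
  F' (pol p.1 p.2) * cexp p.2 * cexp p.2) (nbhs (r, t))
  (F (pol r t) * cexp t + r%:C * F' (pol r t) * cexp t * cexp t).
  apply: climD; first by apply: climM => //; exact: clim_comp Fc.
  apply: climM => //; apply: climM => //; apply: climM => //.
  exact: clim_comp F'c.
exact.
Qed.

Lemma continuous_rotation_r (r t : R) : 0 < r -> t \in `]u, v[ ->
  {for r, continuous (fun s => P s t)}.
Proof.
move=> r0 tuv; have h := continuous_rotation r0 tuv.
have c : (s, t) @[s --> r] --> (r, t).
  by apply: (@cvg_pair _ _ _ _ (nbhs r) (nbhs t)); [exact: cvg_id | exact: cvg_cst].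
exact: cvg_comp c h.
Qed.

Lemma continuous_ray (r t : R) : 0 < r -> t \in `]u, v[ ->
  {for r, continuous (ray F t)}.
Proof.
move=> r0 /(Dpol r0)/FD[dF _].
have [_ [+ _]] := cderM (cder_comp (g := pol ^~ t) dF (cder_pol_r r t)) (cder_cst (cexp t) r).
by move=> /derivable1_diffP/differentiable_continuous.
Qed.

Variables (K a : R).
Hypothesis a0 : 0 < a.
Hypothesis FK : forall r t, 0 < r -> t \in `]u, v[ ->
  normc (F (pol r t)) <= K * (dom a r / r).

Lemma integrable_ray (t : R) : t \in `]u, v[ ->
  mu.-integrable (@halfline R) (EFin \o ray F t).
Proof.
move=> tuv; have mray : measurable_fun (@halfline R) (ray F t).
  by apply: measurable_halfline_continuous => r r0; exact: continuous_ray.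
have hK := @integrableZl _ _ _ mu _ (@measurable_halfline R) K _ (integrable_dom a0).
apply: le_integrable hK => //; first exact: measurable_itv.
  exact/measurable_EFinP.
move=> r; rewrite halflineE => r0; rewrite /= lee_fin.
by apply: le_trans (abs_ray_le _ _ _) _; apply: le_trans (FK r0 tuv) _; rewrite ler_norm.
Qed.

Let B n := @exhaust R n.

Lemma exhaust_gt0 n r : B n r -> 0 < r.
Proof. by move=> /exhaust_sub; rewrite halflineE. Qed.

(** [P] is continuous on a compact rectangle of radii and angles; the bound is the constant majorant
    for differentiating under the integral. *)
Lemma rotation_bound n (t1 t2 : R) : t1 \in `]u, v[ -> t2 \in `]u, v[ -> t1 <= t2 ->
  exists M, forall r t, B n r -> t \in `[t1, t2] -> `|P r t| <= M.
Proof.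
move=> h1 h2 t12; pose A : set (R * R) := B n `*` `[t1, t2]%classic.
have cA : compact A by apply: compact_setX; exact: segment_compact.
have cP : {within A, continuous (fun p : R * R => P p.1 p.2)}.
  apply: continuous_in_subspaceT => -[r t]; rewrite inE => -[/= /exhaust_gt0 r0].
  rewrite in_itv /= => /andP[tt1 tt2]; apply: continuous_rotation => //.
  move: h1 h2; rewrite !in_itv /= => /andP[h _] /andP[_ h'].
  by rewrite (lt_le_trans h) // (le_lt_trans tt2).
have [M [_ hM]] := compact_bounded (continuous_compact cP cA).
exists (M + 1) => r t Br tt; apply: (hM (M + 1)); first by rewrite ltrDl.
by exists (r, t).
Qed.

Let I n t := \int[mu]_(r in B n) ray F t r.

Lemma integrable_ray_exhaust n t : t \in `]u, v[ -> mu.-integrable (B n) (EFin \o ray F t).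
Proof.
move=> /integrable_ray; apply: integrableS => //.
- exact: measurable_itv.
- exact: measurable_itv.
- exact: exhaust_sub.
Qed.

Lemma is_derive_exhaust n t : t \in `]u, v[ ->
  is_derive t 1 (I n) (H t n.+2%:R - H t n.+2%:R^-1).
Proof.
move=> tuv; have := tuv; rewrite in_itv /= => /andP[ut tv].
(* A closed interval of angles around t inside the open one, on which [rotation_bound] is
   available. *)
pose u' := (u + t) / 2; pose v' := (t + v) / 2.
have sub s : s \in `[u', v'] -> s \in `]u, v[.
  rewrite !in_itv /= => /andP[s1 s2]; apply/andP; split.
    by apply: lt_le_trans s1; rewrite /u'; lra.
  by apply: le_lt_trans s2 _; rewrite /v'; lra.
have u'v' : u' <= v' by rewrite /u' /v'; lra.
have u'i : u' \in `]u, v[ by apply: sub; rewrite in_itv /= lexx.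
have v'i : v' \in `]u, v[ by apply: sub; rewrite in_itv /= lexx andbT.
have [M hM] := rotation_bound n u'i v'i u'v'.
have tI : `]u', v'[%classic t by rewrite /= in_itv /=; apply/andP; split; rewrite /u' /v'; lra.
have mB : measurable (B n) by exact: measurable_itv.
have subI s : `]u', v'[%classic s -> s \in `[u', v'].
  by rewrite /= !in_itv /= => /andP[/ltW -> /ltW ->].
have d1 r s : B n r -> `]u', v'[%classic s -> partial1of2 (ray F) s r = P r s.
  move=> /exhaust_gt0 r0 /subI/sub/(is_derive_ray r0)[_].
  by rewrite partial1of2E.
have intf s : `]u', v'[%classic s -> mu.-integrable (B n) (EFin \o ray F s).
  by move=> /subI/sub; exact: integrable_ray_exhaust.
have derf s r : `]u', v'[%classic s -> B n r -> derivable ((ray F)^~ r) s 1.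
  by move=> /subI/sub si /exhaust_gt0 r0; case: (is_derive_ray r0 si).
have intG : mu.-integrable (B n) (EFin \o (fun=> `|M|)).
  apply: continuous_compact_integrable; first exact: segment_compact.
  by move=> ?; exact: cvg_cst.
have Gub s r : `]u', v'[%classic s -> B n r -> `|partial1of2 (ray F) s r| <= `|M|.
  by move=> sI Br; rewrite d1 // (le_trans (hM _ _ Br (subI _ sI))) // ler_norm.
have dI := @derivable_under_integral R _ _ mu (ray F) (B n) mB t u' v' tI intf derf
  (fun=> `|M|) (fun=> normr_ge0 M) intG Gub.
have dE := @differentiation_under_integral R _ _ mu (ray F) (B n) mB t u' v' tI intf derf
  (fun=> `|M|) (fun=> normr_ge0 M) intG Gub.
split; first exact: dI.
rewrite -derive1E dE.
transitivity (\int[mu]_(r in B n) P r t).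
  by apply: eq_Rintegral => r; rewrite inE => Br; rewrite -(d1 r t Br tI).
have en0 : (0 : R) < n.+2%:R^-1 by rewrite invr_gt0 ltr0n.
have dH (r : R) : 0 < r -> is_derive r 1 (H t) (P r t).
  by move=> r0; exact: is_derive_flux.
have cH (r : R) : 0 < r -> {for r, continuous (H t)}.
  by move=> /dH[/derivable1_diffP/differentiable_continuous].
rewrite /Rintegral (@continuous_FTC2 _ (fun r => P r t) (H t) _ _ (exhaust_lt R n)) //.
- apply: continuous_in_subspaceT => r; rewrite inE /= in_itv /= => /andP[rn _].
  have r0 : 0 < r := lt_le_trans en0 rn.
  exact: continuous_rotation_r.
- split.
  + by move=> r; rewrite in_itv /= => /andP[rn _]; case: (dH r (lt_trans en0 rn)).
  + by apply: cvg_at_right_filter; exact: cH.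
  + by apply: cvg_at_left_filter; apply: cH; rewrite ltr0n.
- move=> r; rewrite in_itv /= => /andP[rn _].
  by rewrite derive1E; have [_] := dH r (lt_trans en0 rn).
Qed.

Lemma flux_bound t r : 0 < r -> t \in `]u, v[ -> `|H t r| <= K * dom a r.
Proof.
move=> r0 tuv; apply: le_trans (abs_Re_le_normc _) _.
rewrite !normcM normc_cexp mulr1 normc_real gtr0_norm //.
apply: le_trans (_ : r * (K * (dom a r / r)) <= _).
  by rewrite ler_pM2l // FK.
by rewrite mulrCA [r * _]mulrC divfK // gt_eqF.
Qed.

(* d/dt of the integral over the ray of angle t is the flux H through its ends,
   which vanishes in the limit. *)
Lemma ray_integral_rotation t1 t2 : t1 \in `]u, v[ -> t2 \in `]u, v[ ->
  ray_integral F t1 = ray_integral F t2.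
Proof.
wlog t12 : t1 t2 / t1 <= t2.
  by move=> h; have [/h//|/ltW/h e h1 h2] := leP t1 t2; rewrite e.
move=> h1 h2; have c1 := cvg_exhaust_Rintegral (integrable_ray h1).
have c2 := cvg_exhaust_Rintegral (integrable_ray h2).
have c0 : I n t2 - I n t1 @[n --> \oo] --> (0 : R).
  (* By the mean value theorem in the angle, the difference is t2 - t1 times a flux through two
     ends. By [domV] each end costs at most K times [dom a n.+2]. *)
  have c3 : (K *+ 2) * dom a n.+2%:R * (t2 - t1) @[n --> \oo] --> (0 : R).
    have -> : (0 : R) = (K *+ 2) * 0 * (t2 - t1) by rewrite mulr0 mul0r.
    apply: cvgM (cvg_cst _); apply: cvgM (dom_cvg0 a0); exact: cvg_cst.
  apply/norm_cvg0P; apply: squeeze_cvgr (cvg_cst 0) c3.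
  near=> n; rewrite normr_ge0 /=.
  have in12 c : c \in `[t1, t2] -> c \in `]u, v[.
    move: h1 h2; rewrite !in_itv /= => /andP[l1 l2] /andP[l3 l4] /andP[l5 l6].
    by rewrite (lt_le_trans l1) // (le_lt_trans l6).
  have dI c (hc : c \in `]t1, t2[) := is_derive_exhaust n (in12 c (subset_itv_oo_cc hc)).
  have cI : {within `[t1, t2], continuous (I n)}.
    by apply: derivable_within_continuous => c /in12/(is_derive_exhaust n)[].
  have [c ct ->] := MVT_segment t12 dI cI.
  rewrite normrM (ger0_norm (_ : 0 <= t2 - t1)) ?subr_ge0 //.
  rewrite ler_wpM2r ?subr_ge0 //.
  apply: le_trans (ler_normB _ _) _; rewrite mulrnAl mulr2n lerD //.
    by apply: flux_bound; [rewrite ltr0n | exact: in12].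
  rewrite -domV ?ltr0n //; apply: flux_bound; last exact: in12.
  by rewrite invr_gt0 ltr0n.
have : I n t2 - I n t1 @[n --> \oo] --> ray_integral F t2 - ray_integral F t1.
  exact: cvgB.
move=> h; apply/esym/eqP; rewrite -subr_eq0 -(cvg_lim _ h) // (cvg_lim _ c0) //.
Unshelve. all: end_near. Qed.

End Rotation.

End RayIntegral.

(** * From Bochner integrals to real integrals *)

Section Bochner.
Context (R : realType) (n : nat) (V : rightHilbertModule R n).
Context (d : measure_display) (X : measurableType d) (mu : {measure set X -> \bar R}).
Variables (D : set X) (g : X -> V) (u : V) (l : V -> R).
Hypotheses (mD : measurable D) (gu : is_bochner mu D g u).
Hypotheses (bl : bounded_functional l) (mlg : measurable_fun D (l \o g)).

Lemma functional_sum (I : Type) (s : seq I) (F : I -> V) :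
  l (\sum_(i <- s) F i) = \sum_(i <- s) l (F i).
Proof.
elim: s => [|i s IH]; first by rewrite !big_nil functional0.
by rewrite !big_cons functionalD // IH.
Qed.

Lemma functional_step (h : stepfun X V) :
  (forall i, [/\ measurable (step_set i), step_set i `<=` D
     & (mu (@step_set _ _ h i) < +oo)%E]) ->
  mu.-integrable D (EFin \o (l \o step_eval h)) /\
  \int[mu]_(x in D) l (step_eval h x) = l (step_integral mu h).
Proof.
move=> hA.
pose f (i : 'I_(step_size h)) (x : X) : R := l (step_val i) * \1_(step_set i) x.
have fE x : l (step_eval h x) = \sum_i f i x.
  rewrite /step_eval functional_sum; apply: eq_bigr => i _.
  by rewrite functionalZ // mulrC.
have i1 (i : 'I_(step_size h)) : mu.-integrable D (EFin \o \1_(step_set i)).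
  have [mA AD fA] := hA i; apply/integrableP; split.
    exact/measurable_EFinP.
  under eq_integral do rewrite /= ger0_norm //.
  by rewrite integral_indic // (setIidl AD).
have fi i : mu.-integrable D (EFin \o f i).
  by have := integrableZl mD (l (step_val i)) (i1 i).
have -> : l \o step_eval h = fun x => \sum_i f i x by apply/funext => x; exact: fE.
split.
  have := @integrable_sum _ _ _ mu _ mD _ (index_enum _) xpredT _ (fun i _ => fi i).
  apply: eq_integrable => // x _ /=; by rewrite sumEFin.
under eq_Rintegral do rewrite fE.
rewrite /step_integral functional_sum /Rintegral.
under eq_integral do rewrite -sumEFin.
rewrite integral_sum //.
rewrite (eq_bigr (fun i => (fine (mu (step_set i)) * l (step_val i))%:E)).
  by rewrite sumEFin /=; apply: eq_bigr => i _; rewrite functionalZ.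
move=> i _; have [mA AD fA] := hA i.
under eq_integral do rewrite EFinM.
rewrite integralZl //; last exact: i1.
rewrite integral_indic // (setIidl AD) mulrC EFinM fineK //.
by rewrite ge0_fin_numE.
Qed.

(** A bounded functional commutes with integrals of step functions, and turns convergence in the
    mean of the step functions into convergence of real integrals. Their limit is then both l u and
    the integral of [l \o g]. *)
Lemma bochner_functional :
  mu.-integrable D (EFin \o (l \o g)) /\ l u = \int[mu]_(x in D) l (g x).
Proof.
case: gu => h [hA mh h0 hu]; have [_ [M M0 lM]] := bl.
pose e k := (\int[mu]_(x in D) (`|g x - step_eval (h k) x|)%:E)%E.
have hi k := (functional_step (hA k)).1.
have hE k := (functional_step (hA k)).2.
have ei k : (e k < +oo)%E -> mu.-integrable D
    (EFin \o (fun x => `|g x - step_eval (h k) x|)).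
  move=> ek; apply/integrableP; split; first exact/measurable_EFinP.
  by under eq_integral do rewrite /= normr_id.
have lgh k x : `|l (g x) - l (step_eval (h k) x)| <= M * `|g x - step_eval (h k) x|.
  by rewrite -(functionalN bl) -(functionalD bl).
have intg k : (e k < +oo)%E -> mu.-integrable D (EFin \o (l \o g)).
  move=> /ei/(integrableZl mD M) i1.
  have i2 : mu.-integrable D (EFin \o (Num.norm \o (l \o step_eval (h k)))).
    exact: integrable_norm.
  apply: le_integrable (integrableD mD i1 i2) => //; first exact/measurable_EFinP.
  move=> x _; rewrite /= lee_fin; apply: le_trans (ler_norm _).
  rewrite -lerBlDr; apply: le_trans (lgh k x).
  by apply: le_trans (lerB_dist _ _).
(* Finiteness of the error integrals is known only for large k, as part of their convergence to
   0. *)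
have ne : \forall k \near \oo, (e k < +oo)%E.
  have /fine_cvgP[+ _] := h0; apply: filterS => k.
  by rewrite -/(e k) fin_numElt => /andP[].
have ig : mu.-integrable D (EFin \o (l \o g)).
  by have [k ek] := filter_ex ne; exact: intg ek.
split => //.
have c1 : l (step_integral mu (h k)) @[k --> \oo] --> l u.
  apply/cvgrPdist_le => eps eps0.
  have M1 : 0 < M + 1 by rewrite ltr_wpDl.
  have em : 0 < eps / (M + 1) by rewrite divr_gt0.
  move/cvgrPdist_le: hu => /(_ _ em); apply: filterS => k hk.
  rewrite -(functionalN bl) -(functionalD bl) (le_trans (lM _)) //.
  apply: le_trans (_ : (M + 1) * `|u - step_integral mu (h k)| <= _).
    by rewrite ler_wpM2r // lerDl.
  by rewrite mulrC -ler_pdivlMr.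
have c2 : l (step_integral mu (h k)) @[k --> \oo] --> \int[mu]_(x in D) l (g x).
  have c0 : M * fine (e k) @[k --> \oo] --> (0 : R).
    rewrite -(mulr0 M); apply: cvgM; first exact: cvg_cst.
    by have /fine_cvgP[] := h0.
  apply/cvgrPdist_le => eps eps0.
  move/cvgrPdist_le: c0 => /(_ _ eps0); apply: filterS2 ne => k ek.
  rewrite sub0r normrN; apply: le_trans; apply: le_trans (ler_norm _).
  rewrite -hE -RintegralB //; last exact: hi.
  have id : mu.-integrable D (EFin \o (fun x => l (g x) - l (step_eval (h k) x))).
    by have := integrableB mD ig (hi k); apply: eq_integrable.
  apply: le_trans (le_normr_Rintegral mD id) _.
  rewrite -(RintegralZl M mD (ei k ek)); apply: le_Rintegral => //.
  - by have := integrable_norm id.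
  - by have := integrableZl mD M (ei k ek).
by rewrite -(cvg_lim _ c1) // (cvg_lim _ c2).
Qed.

End Bochner.

(** * Contour integrals along the boundary of a double sector *)

Section SectorSets.
Context (R : realType).
Implicit Types (z : R[i]) (c t : R).

Definition in_sector c z := c * normc z < `|Re z|.

Lemma normc_dist z z' : `|normc z - normc z'| <= normc (z - z').
Proof.
rewrite ler_norml lerBrDr lerBlDr; apply/andP; split.
  rewrite addrC lerBlDr normcB; have := le_normcD z (z' - z).
  by rewrite addrC subrK addrC.
by have := le_normcD (z - z') z'; rewrite subrK.
Qed.

Lemma dist_Re z z' : `| `|Re z| - `|Re z'| | <= normc (z - z').
Proof.
apply: le_trans (ler_dist_dist _ _) _.
by rewrite -ReN -ReD abs_Re_le_normc.
Qed.

Lemma copen_in_sector c : 0 < c -> c <= 1 -> copen [set z | in_sector c z].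
Proof.
move=> c0 c1 z /= zS; pose e := (`|Re z| - c * normc z) / 2.
have e0 : 0 < e by rewrite divr_gt0 // subr_gt0.
exists e => // x /= xe; rewrite /in_sector.
have := dist_Re x z; have := normc_dist x z.
rewrite !ler_norml => /andP[_ h1] /andP[h2 _].
have h3 : c * (normc x - normc z) <= normc (x - z).
  apply: le_trans (_ : c * normc (x - z) <= _); first by rewrite ler_pM2l.
  by rewrite ler_piMl // normc_ge0.
by move: h3 h2 xe; rewrite /e mulrBr; lra.
Qed.

Lemma copen_off_sector c : 0 < c -> c <= 1 -> copen [set z | off_sector c z].
Proof.
move=> c0 c1 z /= zS; pose e := (c * normc z - `|Re z|) / 2.
have e0 : 0 < e by rewrite divr_gt0 // subr_gt0.
exists e => // x /= xe; rewrite /off_sector.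
have := dist_Re x z; have := normc_dist x z.
rewrite !ler_norml => /andP[h1 _] /andP[_ h2].
have h3 : - normc (x - z) <= c * (normc x - normc z).
  apply: le_trans (_ : c * - normc (x - z) <= _).
    by rewrite mulrN lerN2 ler_piMl // normc_ge0.
  by rewrite ler_pM2l.
by move: h3 h2 xe; rewrite /e mulrBr; lra.
Qed.

Lemma Re_pol r t : Re (pol r t) = r * cos t.
Proof. by rewrite /pol /cexp /=; ring. Qed.

Lemma in_sector_pol c r t : 0 < r -> in_sector c (pol r t) = (c < `|cos t|).
Proof.
move=> r0; rewrite /in_sector normc_pol // Re_pol normrM gtr0_norm //.
by rewrite mulrC ltr_pM2l.
Qed.

Lemma off_sector_pol c r t : 0 < r -> off_sector c (pol r t) = (`|cos t| < c).
Proof.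
move=> r0; rewrite /off_sector normc_pol // Re_pol normrM gtr0_norm //.
by rewrite mulrC [ltRHS]mulrC [r * _]mulrC ltr_pM2r.
Qed.

Lemma cos_norm t : cos `|t| = cos t.
Proof. by case: (ger0P t) => // _; rewrite cosN. Qed.

Lemma lt_cos_norm t t' : `|t| < t' -> t' < pi / 2 -> cos t' < cos t.
Proof.
move=> tt' t'pi; rewrite -(cos_norm t) cos_lt_of_lt // (le_trans (ltW t'pi)) //.
by rewrite ler_pdivrMr // ler_peMr ?pi_ge0 // ler1n.
Qed.

Lemma cos_pi_sub t : cos (pi - t) = - cos t.
Proof. by rewrite cosB cospi sinpi mul0r addr0 mulN1r. Qed.

Lemma cos_sub_pi t : cos (t - pi) = - cos t.
Proof. by rewrite -cosN opprB cos_pi_sub. Qed.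

End SectorSets.

Section Contour.
Context (R : realType).
Implicit Types (z : R[i]) (F : R[i] -> R[i]) (t a K : R).

(* The boundary of the double sector of angle t, which lies to its left. *)
Definition contour F t : R :=
  ray_integral F (- t) - ray_integral F t
  + ray_integral F (pi - t) - ray_integral F (pi + t).

(** Inside the right sector the ray of angle - p turns into that of angle p, inside the left one pi
    - p into pi + p. The members of each pair carry opposite signs. *)
Lemma contour_eq0 F F' (t p a K : R) : 0 < p < t -> t < pi / 2 ->
  holo [set z | in_sector (cos t) z] F F' -> 0 < a ->
  (forall z, in_sector (cos t) z -> normc (F z) <= K * (dom a (normc z) / normc z)) ->
  contour F p = 0.
Proof.
move=> /andP[p0 pt] tpi FF a0 FK.
have c0 : 0 < cos t by apply: cos_gt0_angle; rewrite tpi (lt_trans p0).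
have D1 r s : 0 < r -> s \in `]- t, t[ -> in_sector (cos t) (pol r s).
  move=> r0; rewrite in_itv /= -ltr_norml => st; rewrite in_sector_pol //.
  have cs : cos t < cos s := lt_cos_norm st tpi.
  by rewrite ger0_norm // (le_trans (ltW c0)) // ltW.
have D2 r s : 0 < r -> s \in `](pi - t), (pi + t)[ -> in_sector (cos t) (pol r s).
  move=> r0; rewrite in_itv /= => st; rewrite in_sector_pol //.
  have : cos t < cos (s - pi).
    by move/andP: st => [s1 s2]; apply: lt_cos_norm => //; rewrite ltr_norml; lra.
  by rewrite cos_sub_pi => h; rewrite -normrN (lt_le_trans h) // ler_norm.
have B1 r s : 0 < r -> s \in `]- t, t[ -> normc (F (pol r s)) <= K * (dom a r / r).
  by move=> r0 /(D1 r _ r0)/FK; rewrite normc_pol.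
have B2 r s : 0 < r -> s \in `](pi - t), (pi + t)[ ->
    normc (F (pol r s)) <= K * (dom a r / r).
  by move=> r0 /(D2 r _ r0)/FK; rewrite normc_pol.
have p1 : p \in `]- t, t[ by rewrite in_itv /= pt andbT; lra.
have p2 : - p \in `]- t, t[ by rewrite in_itv /=; apply/andP; split; lra.
have p3 : pi - p \in `](pi - t), (pi + t)[ by rewrite in_itv /=; apply/andP; split; lra.
have p4 : pi + p \in `](pi - t), (pi + t)[ by rewrite in_itv /=; apply/andP; split; lra.
rewrite /contour (ray_integral_rotation FF D1 a0 B1 p2 p1) subrr add0r.
by rewrite (ray_integral_rotation FF D2 a0 B2 p3 p4) subrr.
Qed.

(** Each of the four rays turns within its own component of the region between the angles w and
    t. *)
Lemma contour_rotation F F' (w t p1 p2 a K : R) : 0 < w -> w < p1 < t -> w < p2 < t ->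
  t < pi / 2 ->
  holo [set z | in_sector (cos t) z /\ off_sector (cos w) z] F F' -> 0 < a ->
  (forall z, in_sector (cos t) z -> off_sector (cos w) z ->
     normc (F z) <= K * (dom a (normc z) / normc z)) ->
  contour F p1 = contour F p2.
Proof.
move=> w0 /andP[wp1 p1t] /andP[wp2 p2t] tpi FF a0 FK.
have c0 : 0 < cos t by apply: cos_gt0_angle; rewrite tpi andbT; lra.
pose ok s := cos t < `|cos s| < cos w.
have okE s : w < s < t -> ok s.
  move=> /andP[ws st]; have s0 : 0 < s by lra.
  have cs : cos t < cos s by apply: lt_cos_norm; rewrite ?gtr0_norm.
  have cs0 : 0 < cos s by apply: lt_trans cs.
  have cw : cos s < cos w by apply: lt_cos_norm; rewrite ?gtr0_norm //; lra.
  by rewrite /ok gtr0_norm // cs.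
have rot u v : (forall s, s \in `]u, v[ -> ok s) -> forall s1 s2,
    s1 \in `]u, v[ -> s2 \in `]u, v[ -> ray_integral F s1 = ray_integral F s2.
  move=> hok; have D r s : 0 < r -> s \in `]u, v[ ->
      in_sector (cos t) (pol r s) /\ off_sector (cos w) (pol r s).
    by move=> r0 /hok /andP[h1 h2]; rewrite in_sector_pol // off_sector_pol.
  have B r s : 0 < r -> s \in `]u, v[ -> normc (F (pol r s)) <= K * (dom a r / r).
    by move=> r0 si; have [/FK h /h] := D r s r0 si; rewrite normc_pol.
  by move=> s1 s2 h1 h2; have := ray_integral_rotation FF D a0 B h1 h2.
have r1 := rot w t; have r2 := rot (- t) (- w).
have r3 := rot (pi - t) (pi - w); have r4 := rot (pi + w) (pi + t).
congr (_ - _ + _ - _).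
- apply: r2; rewrite ?in_itv /= ?ltrN2 ?wp1 ?p1t ?wp2 ?p2t // => s.
  rewrite in_itv /= => /andP[h1 h2]; rewrite /ok -(cosN s); apply: (okE (- s)).
  by apply/andP; split; lra.
- by apply: r1; rewrite ?in_itv /= ?wp1 ?p1t ?wp2 ?p2t.
- apply: r3; rewrite ?in_itv /= ?ltrD2l ?ltrN2 ?wp1 ?p1t ?wp2 ?p2t // => s.
  rewrite in_itv /= => /andP[h1 h2]; rewrite /ok -(normrN (cos s)) -cos_pi_sub; apply: (okE (pi - s)).
  by apply/andP; split; lra.
- apply: r4; rewrite ?in_itv /= ?ltrD2l ?wp1 ?p1t ?wp2 ?p2t // => s.
  rewrite in_itv /= => /andP[h1 h2]; rewrite /ok -(normrN (cos s)) -cos_sub_pi; apply: (okE (s - pi)).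
  by apply/andP; split; lra.
Qed.

End Contour.

(** * Holomorphy of the resolvent *)

Section ResolventHolomorphy.
Context (R : realType) (n : nat) (V : rightHilbertModule R n).
Context (T : operator V) (w : R) (T_bisect : bisectorial T w).
Context (J : clifford R n) (sJ : sphere J).
Implicit Types (u v : V) (z : R[i]).

Local Notation Rz := (resolv T J).
Local Notation off := (off_sector (cos w)).

Let hw := angle_w T_bisect.
Let cw0 : 0 < cos w := cos_gt0_angle hw.
Let cw1 : cos w <= 1 := cos_le1 w.

Lemma resolv_dist z z' u : off z -> off z' ->
  Rz z' u - Rz z u = - vmul J (Rz z' (Rz z u)) (z' - z).
Proof.
move=> zO zO'; rewrite (resolvent_identity T_bisect) //.
by rewrite opprB.
Qed.

(** The resolvent identity bounds |R_x u| by N |u| + N |x - z| |R_x u|. The choice |x - z| < 1 / (2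
    (N + 1)) lets the last term be absorbed on the left; N + 1 avoids division by 0. *)
Lemma resolv_near_bound z : off z -> exists2 N, 0 <= N &
  \forall x \near cnbhs z, off x /\ forall u, `|Rz x u| <= N * `|u|.
Proof.
move=> zO; have [_ _ [N N0 hN]] := resolv_bounded_linear T_bisect sJ zO.
exists (N + N); first by rewrite addr_ge0.
have N1 : 0 < N + 1 by rewrite ltr_wpDl.
have e0 : 0 < 2^-1 / (N + 1) by rewrite divr_gt0.
have ne : \forall x \near cnbhs z, normc (x - z) < 2^-1 / (N + 1) by exists (2^-1 / (N + 1)).
apply: filterS2 (copen_off_sector cw0 cw1 zO) ne => x xO xz; split => // u.
have : Rz x u = Rz z u + vmul J (Rz z (Rz x u)) (z - x).
  by rewrite (resolvent_identity T_bisect) // addrC subrK.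
move=> /(congr1 (fun v => `|v|)) /= E.
have : `|Rz x u| <= N * `|u| + 2^-1 * `|Rz x u|.
  rewrite [leLHS]E; apply: le_trans (ler_normD _ _) _; rewrite lerD ?hN //.
  rewrite norm_vmul // normcB.
  apply: le_trans (_ : (2^-1 / (N + 1)) * (N * `|Rz x u|) <= _).
    by rewrite ler_pM // ?normc_ge0 // ltW.
  rewrite mulrA ler_wpM2r // -mulrA ger_pMr ?invr_gt0 //.
  by rewrite mulrC ler_pdivrMr // mul1r lerDl.
by rewrite mulrDl; lra.
Qed.

Variables (l : V -> R) (bl : bounded_functional l).
Local Notation L := (cfun J l).

Lemma cfunB u v : L (u - v) = L u - L v.
Proof. by rewrite cfunD // cfunN. Qed.

Lemma near_small z (M : R) (f : R[i] -> R) : 0 <= M ->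
  (\forall x \near cnbhs z, f x <= M * normc (x - z)) ->
  forall e, 0 < e -> \forall x \near cnbhs z, f x < e.
Proof.
move=> M0 hf e e0; have M1 : 0 < M + 1 by rewrite ltr_wpDl.
have e1 : 0 < e / (M + 1) by rewrite divr_gt0.
have ne : \forall x \near cnbhs z, normc (x - z) < e / (M + 1) by exists (e / (M + 1)).
apply: filterS2 hf ne => x fx; rewrite ltr_pdivlMr // => xz.
apply: le_lt_trans fx _; apply: le_lt_trans xz.
by rewrite mulrC ler_wpM2l ?normc_ge0 // lerDl.
Qed.

Lemma ccont_resolv z u : off z -> ccont (fun x => L (Rz x u)) z.
Proof.
move=> zO; have [N N0 hN] := resolv_near_bound zO.
have [M M0 hM] := cfun_bound sJ bl.
apply/ccontP; apply: (@near_small _ (M * (N * `|Rz z u|))).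
  by rewrite !mulr_ge0.
apply: filterS hN => x [xO hx].
rewrite -cfunB resolv_dist //; apply: le_trans (hM _) _.
rewrite normrN norm_vmul // -!mulrA ler_wpM2l // mulrC mulrA ler_wpM2r ?normc_ge0 //.
Qed.

Lemma ccont_resolv2 z u : off z -> ccont (fun x => L (Rz x (Rz x u))) z.
Proof.
move=> zO; have [N N0 hN] := resolv_near_bound zO.
have [M M0 hM] := cfun_bound sJ bl.
have [zz hzN] := cnbhs_singleton hN.
apply/ccontP; apply: (@near_small _ (M * (N * (N * (N * `|u|)) + N * (N * (N * `|u|))))).
  by rewrite !(mulr_ge0, addr_ge0).
apply: filterS hN => x [xO hx].
rewrite -cfunB.
have -> : Rz x (Rz x u) - Rz z (Rz z u) = (Rz x (Rz z u) - Rz z (Rz z u))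
   + Rz x (Rz x u - Rz z u).
  have bx := resolv_bounded_linear T_bisect sJ xO.
  by rewrite (blinD bx) (blinN bx); cmodule sJ.
apply: le_trans (hM _) _; rewrite -mulrA ler_wpM2l // mulrDl.
apply: le_trans (ler_normD _ _) _; rewrite lerD //.
  rewrite resolv_dist // normrN norm_vmul // mulrC ler_wpM2r ?normc_ge0 //.
  apply: le_trans (hx _) _; rewrite ler_wpM2l //.
  by apply: le_trans (hzN _) _; rewrite ler_wpM2l.
apply: le_trans (hx _) _; rewrite -!mulrA ler_wpM2l //.
rewrite resolv_dist // normrN norm_vmul // mulrC !mulrA ler_wpM2r ?normc_ge0 //.
rewrite -mulrA; apply: le_trans (hx _) _; rewrite ler_wpM2l //.
Qed.

(** The resolvent identity is Caratheodory's form of differentiability, with factor - L (R_x R_z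
    v). *)
Lemma holo_resolv v : holo [set z | off z] (fun x => L (Rz x v))
  (fun x => - L (Rz x (Rz x v))).
Proof.
move=> z /= zO; split; last by apply: ccontN; exact: ccont_resolv2.
exists (fun x => - L (Rz x (Rz z v))); split => //; last first.
  by apply: ccontN; exact: ccont_resolv.
apply: filterS (copen_off_sector cw0 cw1 zO) => x xO.
by rewrite -cfunB resolv_dist // cfunN // cfun_vmul // mulrN mulrC.
Qed.

End ResolventHolomorphy.

(** * Integrability and linearity along the contour *)

Section ContourAlgebra.
Context (R : realType).
Local Notation mu := (@lebesgue_measure R).
Implicit Types (z : R[i]) (F G : R[i] -> R[i]) (p t : R).

Definition on_contour p z := (z != 0) && (`|Re z| == cos p * normc z).

Definition rays_integrable p F := forall t, `|cos t| = cos p ->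
  mu.-integrable (@halfline R) (EFin \o ray F t).

Lemma on_contour_pol p r t : 0 < r -> `|cos t| = cos p -> on_contour p (pol r t).
Proof.
move=> r0 tp; rewrite /on_contour -normc_gt0 normc_pol // r0 andTb.
by rewrite Re_pol normrM gtr0_norm // tp mulrC.
Qed.

Lemma measurable_ray t F : (forall r, 0 < r -> ccont F (pol r t)) ->
  measurable_fun (@halfline R) (ray F t).
Proof.
move=> Fc; apply: measurable_halfline_continuous => r r0.
have cr := cder_clim (cder_pol_r r t).
have ce : clim (fun=> cexp t) (nbhs r) (cexp t) by split; exact: cvg_cst.
by have [_] := climM (clim_comp cr (Fc r r0)) ce.
Qed.

Lemma ray_integrable_bound t F (a K : R) : 0 < a ->
  (forall r, 0 < r -> ccont F (pol r t)) ->
  (forall r, 0 < r -> normc (F (pol r t)) <= K * (dom a r / r)) ->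
  mu.-integrable (@halfline R) (EFin \o ray F t).
Proof.
move=> a0 Fc FK; have mray := measurable_ray Fc.
have hK := @integrableZl _ _ _ mu _ (@measurable_halfline R) K _ (integrable_dom a0).
apply: le_integrable hK => //; first exact: measurable_itv.
  exact/measurable_EFinP.
move=> r; rewrite halflineE => r0; rewrite /= lee_fin.
by apply: le_trans (abs_ray_le _ _ _) _; apply: le_trans (FK r r0) _; rewrite ler_norm.
Qed.

Lemma rays_integrable_bound p F (a K : R) : 0 < a ->
  (forall z, on_contour p z -> ccont F z) ->
  (forall z, on_contour p z -> normc (F z) <= K * (dom a (normc z) / normc z)) ->
  rays_integrable p F.
Proof.
move=> a0 Fc FK t tp; apply: (ray_integrable_bound (K := K) a0) => r r0.
  by apply: Fc; exact: on_contour_pol.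
by have := FK _ (on_contour_pol r0 tp); rewrite normc_pol.
Qed.

Lemma ray_integral_ext F G t p : `|cos t| = cos p ->
  (forall z, on_contour p z -> F z = G z) -> ray_integral F t = ray_integral G t.
Proof.
move=> tp FG; apply: eq_Rintegral => r; rewrite inE halflineE => r0.
by rewrite /ray FG //; exact: on_contour_pol.
Qed.

Lemma ray_integralD F G t : mu.-integrable (@halfline R) (EFin \o ray F t) ->
  mu.-integrable (@halfline R) (EFin \o ray G t) ->
  ray_integral (fun z => F z + G z) t = ray_integral F t + ray_integral G t.
Proof.
move=> iF iG; rewrite /ray_integral -RintegralD //; last exact: measurable_itv.
by apply: eq_Rintegral => r _; rewrite /ray mulrDl ImD.
Qed.

Lemma ray_integralZ (c : R) F t : mu.-integrable (@halfline R) (EFin \o ray F t) ->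
  ray_integral (fun z => c%:C * F z) t = c * ray_integral F t.
Proof.
move=> iF; rewrite /ray_integral -RintegralZl //; last exact: measurable_itv.
by apply: eq_Rintegral => r _; rewrite /ray -mulrA ImM /= mul0r addr0.
Qed.

Section Angles.
Variable p : R.
Hypothesis hp : 0 < p < pi / 2.

Let cp : 0 < cos p := cos_gt0_angle hp.

Lemma contour_angle1 : `|cos (- p)| = cos p.
Proof. by rewrite cosN gtr0_norm. Qed.

Lemma contour_angle2 : `|cos p| = cos p.
Proof. by rewrite gtr0_norm. Qed.

Lemma contour_angle3 : `|cos (pi - p)| = cos p.
Proof. by rewrite cos_pi_sub normrN gtr0_norm. Qed.

Lemma contour_angle4 : `|cos (pi + p)| = cos p.
Proof. by rewrite -[p in LHS]opprK cos_pi_sub normrN cosN gtr0_norm. Qed.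

Lemma contour_ext F G : (forall z, on_contour p z -> F z = G z) ->
  contour F p = contour G p.
Proof.
move=> FG; rewrite /contour.
rewrite (ray_integral_ext contour_angle1 FG) (ray_integral_ext contour_angle2 FG).
by rewrite (ray_integral_ext contour_angle3 FG) (ray_integral_ext contour_angle4 FG).
Qed.

Lemma contourD F G : rays_integrable p F -> rays_integrable p G ->
  contour (fun z => F z + G z) p = contour F p + contour G p.
Proof.
move=> iF iG; rewrite /contour.
rewrite !ray_integralD; first ring;
  by do ?[apply: iF | apply: iG]; rewrite ?contour_angle1 ?contour_angle2 ?contour_angle3 ?contour_angle4.
Qed.

Lemma contourZ (c : R) F : rays_integrable p F ->
  contour (fun z => c%:C * F z) p = c * contour F p.
Proof.
move=> iF; rewrite /contour.
rewrite !ray_integralZ; first ring;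
  by apply: iF; rewrite ?contour_angle1 ?contour_angle2 ?contour_angle3 ?contour_angle4.
Qed.

Lemma contour_cst0 : contour (fun=> 0) p = 0.
Proof.
have i0 : rays_integrable p (fun=> 0).
  move=> t _; apply: (ray_integrable_bound (a := 1) (K := 0)) => //.
    by move=> r _; exact: ccont_cst.
  by move=> r _; rewrite normc0 mul0r.
rewrite -[RHS](mul0r (contour (fun=> 0) p)) -contourZ //.
by apply: contour_ext => z _; rewrite mulr0.
Qed.

End Angles.
End ContourAlgebra.

(** * The functional calculus tested against functionals *)

Section WeakCalculus.
Context (R : realType) (n : nat) (V : rightHilbertModule R n).
Context (T : operator V) (w : R) (T_bisect : bisectorial T w).
Context (th : R) (hth : w < th < pi / 2).
Implicit Types (u v : V) (z : R[i]) (h g : R[i] -> R[i]) (J : clifford R n).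

Local Notation off := (off_sector (cos w)).
Local Notation D := (in_sector (cos th)).

Definition holomorphic h := exists h', holo [set z | D z] h h'.

Definition decays h := exists a K : R, [/\ 0 < a, 0 <= K &
  forall z, D z -> normc (h z) <= K * dom a (normc z)].

Definition resolv_kernel J (l : V -> R) v h z := cfun J l (resolv T J z v) * h z.

(* u = h(T) v, for the calculus with the contour of angle p in C_J. *)
Definition weak_calculus J p h v u := forall l, bounded_functional l ->
  l u = (2 * pi)^-1 * contour (resolv_kernel J l v h) p.

Lemma weak_uniq J p h v u u' :
  weak_calculus J p h v u -> weak_calculus J p h v u' -> u = u'.
Proof. by move=> hu hu'; apply: functional_ext => l bl; rewrite hu // hu'. Qed.

Lemma w_gt0 : 0 < w. Proof. by have /andP[] := angle_w T_bisect. Qed.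

Lemma sector_angle : 0 < th < pi / 2.
Proof. by have /andP[wt ->] := hth; rewrite (lt_trans w_gt0 wt). Qed.

Lemma angleP p : w < p < th -> 0 < p < pi / 2.
Proof.
move=> /andP[wp pt]; have /andP[_ tpi] := hth.
by rewrite (lt_trans w_gt0 wp) (lt_trans pt tpi).
Qed.

Lemma on_contourP p z : w < p < th -> on_contour p z -> off z /\ D z.
Proof.
move=> hp /andP[z0 /eqP zE]; have /andP[p0 ppi] := angleP hp.
have /andP[wp pt] := hp; have /andP[_ tpi] := hth.
have n0 : 0 < normc z by rewrite normc_gt0.
have le_pi (x : R) : x < pi / 2 -> x <= pi.
  by move=> /ltW/le_trans; apply; rewrite ler_pdivrMr // ler_peMr ?pi_ge0 // ler1n.
split; rewrite /off_sector /in_sector zE ltr_pM2r // cos_lt_of_lt // ?(ltW w_gt0) //.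
- exact: le_pi.
- exact: ltW.
- exact: le_pi.
Qed.

Lemma kernel_bound p J l : w < p < pi / 2 -> sphere J -> bounded_functional l ->
  exists2 M : R, 0 <= M & forall v z, z != 0 -> `|Re z| <= cos p * normc z ->
  normc (cfun J l (resolv T J z v)) <= M * `|v| / normc z.
Proof.
move=> hp sJ bl; have [C C0 hC] := resolv_bound T_bisect hp.
have [M M0 hM] := cfun_bound sJ bl; exists (M * C); first exact: mulr_ge0.
move=> v z z0 zp; apply: le_trans (hM _) _; rewrite -!mulrA ler_wpM2l //.
by apply: le_trans (hC J z v sJ z0 zp) _; rewrite mulrAC mulrA.
Qed.

Lemma resolv_kernel_integrable J p l v h : sphere J -> w < p < th ->
  bounded_functional l -> holomorphic h -> decays h ->
  rays_integrable p (resolv_kernel J l v h).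
Proof.
move=> sJ hp bl [h' hh] [a [K [a0 K0 hK]]]; have /andP[_ tpi] := hth.
have hp' : w < p < pi / 2.
  by have /andP[-> pt] := hp; rewrite (lt_trans pt).
have [M M0 hM] := kernel_bound hp' sJ bl.
apply: (rays_integrable_bound (a := a) (K := M * `|v| * K)) => // z zp.
  have [zO zD] := on_contourP hp zp.
  by apply: ccontM; [exact: (ccont_resolv T_bisect) | exact: holo_ccont hh zD].
have [zO zD] := on_contourP hp zp; have /andP[z0 /eqP zE] := zp.
rewrite normcM; apply: le_trans (_ : M * `|v| / normc z * (K * dom a (normc z)) <= _).
  by rewrite ler_pM ?normc_ge0 // ?hK // hM // zE.
by rewrite le_eqVlt; apply/orP; left; apply/eqP; ring.
Qed.

Lemma weak_addl J p h v v' u u' : sphere J -> w < p < th ->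
  holomorphic h -> decays h ->
  weak_calculus J p h v u -> weak_calculus J p h v' u' ->
  weak_calculus J p h (v + v') (u + u').
Proof.
move=> sJ hp hh dh hu hu' l bl; rewrite functionalD // hu // hu' // -mulrDr.
rewrite -contourD ?angleP //; try exact: resolv_kernel_integrable.
congr (_ * _); apply: (contour_ext (angleP hp)) => z /(on_contourP hp)[zO _].
by rewrite /resolv_kernel -mulrDl -cfunD // -(blinD (resolv_bounded_linear T_bisect sJ zO)).
Qed.

Lemma weak_addr J p h g v u u' : sphere J -> w < p < th ->
  holomorphic h -> decays h -> holomorphic g -> decays g ->
  weak_calculus J p h v u -> weak_calculus J p g v u' ->
  weak_calculus J p (fun z => h z + g z) v (u + u').
Proof.
move=> sJ hp hh dh hg dg hu hu' l bl; rewrite functionalD // hu // hu' // -mulrDr.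
rewrite -contourD ?angleP //; try exact: resolv_kernel_integrable.
congr (_ * _); apply: (contour_ext (angleP hp)) => z _.
by rewrite /resolv_kernel -mulrDr.
Qed.

Lemma weak_scaler J p h (c : R) v u : sphere J -> w < p < th ->
  holomorphic h -> decays h ->
  weak_calculus J p h v u ->
  weak_calculus J p (fun z => c%:C * h z) v (c *: u).
Proof.
move=> sJ hp hh dh hu l bl; rewrite functionalZ // hu // mulrCA.
rewrite -contourZ ?angleP //; last exact: resolv_kernel_integrable.
congr (_ * _); apply: (contour_ext (angleP hp)) => z _.
by rewrite /resolv_kernel mulrCA.
Qed.

Lemma weak_ext J p h g v u : w < p < th -> (forall z, D z -> h z = g z) ->
  weak_calculus J p h v u -> weak_calculus J p g v u.
Proof.
move=> hp hg hu l bl; rewrite hu //; congr (_ * _).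
apply: (contour_ext (angleP hp)) => z /(on_contourP hp)[_ zD].
by rewrite /resolv_kernel hg.
Qed.

(** An operator that commutes with the resolvents commutes with h(T): test with [l \o A] instead of
    l. *)
Lemma weak_comp J p h v u (A : V -> V) : w < p < th -> bounded_linear J A ->
  (forall z x, off z -> A (resolv T J z x) = resolv T J z (A x)) ->
  weak_calculus J p h v u -> weak_calculus J p h (A v) (A u).
Proof.
move=> hp bA AR hu l bl; have := hu _ (bounded_functional_comp bA bl).
move=> /= ->; congr (_ * _).
apply: (contour_ext (angleP hp)) => z /(on_contourP hp)[zO _].
by rewrite /resolv_kernel (cfun_comp bA) AR.
Qed.

Lemma weak_rotation J p q h v u : sphere J -> w < p < th -> w < q < th ->
  holomorphic h -> decays h ->
  weak_calculus J p h v u -> weak_calculus J q h v u.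
Proof.
move=> sJ hp hq [h' hh] [a [K [a0 K0 hK]]] hu l bl; rewrite hu //.
have /andP[wth tpi] := hth.
(* The resolvent estimate is uniform only outside of sectors with angle above w, so the region swept
   from p to q is bounded by some w' strictly between w and both. *)
pose w' := (w + Num.min p q) / 2.
have /andP[wp pt] := hp; have /andP[wq qt] := hq.
have wm : w < Num.min p q by rewrite lt_min wp.
have ww' : w < w' by rewrite /w'; lra.
have w'm : w' < Num.min p q by rewrite /w'; lra.
have [w'p w'q] : w' < p /\ w' < q by move: w'm; rewrite lt_min => /andP.
have hw' : w < w' < pi / 2 by rewrite ww'; lra.
have cw : cos w' < cos w.
  have w0 := w_gt0; rewrite cos_lt_of_lt // ?(ltW w_gt0) //.
  have : (pi : R) / 2 <= pi by rewrite ler_pdivrMr // ler_peMr ?pi_ge0 // ler1n.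
  by lra.
have [M M0 hM] := kernel_bound hw' sJ bl.
have w'0 : 0 < w' by apply: lt_trans ww'; exact: w_gt0.
congr (_ * _); apply: (contour_rotation (w := w') (t := th) (a := a) (K := M * `|v| * K)) => //.
- by rewrite w'p.
- by rewrite w'q.
- apply: holoM.
    have sub : [set z | D z /\ off_sector (cos w') z] `<=` [set z | off z].
      move=> z /= [_ zo]; apply: (lt_trans zo).
      by rewrite ltr_pM2r // normc_gt0 (off_sector_neq0 zo).
    exact: holoS sub (holo_resolv T_bisect sJ bl v).
  have sub : [set z | D z /\ off_sector (cos w') z] `<=` [set z | D z] by move=> z [].
  exact: holoS sub hh.
move=> z zD zO; rewrite /resolv_kernel normcM.
apply: le_trans (_ : M * `|v| / normc z * (K * dom a (normc z)) <= _).
  rewrite ler_pM ?normc_ge0 // ?hK // hM //; first exact: off_sector_neq0 zO.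
  exact: ltW.
by rewrite le_eqVlt; apply/orP; left; apply/eqP; ring.
Qed.

End WeakCalculus.

(** * From the contour integrals in V to the tested calculus *)

Section ContourToWeak.
Context (R : realType) (n : nat) (V : rightHilbertModule R n).
Context (T : operator V) (w : R) (T_bisect : bisectorial T w).
Context (th : R) (hth : w < th < pi / 2).
Implicit Types (u v : V) (z : R[i]) (h g : R[i] -> R[i]) (J : clifford R n).

Local Notation mu := (@lebesgue_measure R).
Local Notation off := (off_sector (cos w)).
Local Notation D := (in_sector (cos th)).
Local Notation iC := (0 +i* 1 : R[i]).

Lemma resolv_kernel_ccont J p l v h z : sphere J -> w < p < th ->
  bounded_functional l -> holomorphic th h -> on_contour p z ->
  ccont (resolv_kernel T J l v h) z.
Proof.
move=> sJ hp bl [h' hh] /(on_contourP T_bisect hth hp)[zO zD].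
by apply: ccontM; [exact: (ccont_resolv T_bisect) | exact: holo_ccont hh zD].
Qed.

Lemma emb_iC J : emb J iC = J.
Proof. by rewrite /emb /slice /= scale0r add0r scale1r. Qed.

Lemma ray_bochner J p t f h v u l : sphere J -> w < p < th -> `|cos t| = cos p ->
  holomorphic th h -> (forall z, D z -> f (emb J z) = emb J (h z)) ->
  bounded_functional l ->
  is_ray_integral T f J (emb J (cexp t)) v u ->
  l u = ray_integral (resolv_kernel T J l v h) t.
Proof.
move=> sJ hp tp hh hf bl hu.
pose k (r : R) := ract (ract (resolvent T (r *: emb J (cexp t)) v)
  (f (r *: emb J (cexp t)))) (emb J (cexp t) * - J).
have kE r : halfline r -> l (k r) = ray (resolv_kernel T J l v h) t r.
  rewrite halflineE => r0; have pc := on_contour_pol r0 tp.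
  have [zO zD] := on_contourP T_bisect hth hp pc.
  have rE : r *: emb J (cexp t) = emb J (pol r t).
    by rewrite embM // emb_real -scalerAl mul1r.
  have -> : k r = vmul J (resolv T J (pol r t) v) (h (pol r t) * (cexp t * - iC)).
    rewrite -vmulM // !vmulE; congr (ract (ract _ _) _).
    - by rewrite rE.
    - by rewrite rE hf.
    - by rewrite embM // embN emb_iC.
  (* By definition l is the real part of [cfun J l], and the factor - i from ds_J turns this real
     part into the imaginary part in [ray]. *)
  transitivity (Re (cfun J l (vmul J (resolv T J (pol r t) v)
    (h (pol r t) * (cexp t * - iC))))) => //.
  rewrite cfun_vmul // /ray /resolv_kernel !mulrA mulrN ReN ReM /=.
  by rewrite mulr0 mulr1 sub0r opprK.
have mk : measurable_fun (@halfline R) (l \o k).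
  apply: (eq_measurable_fun (ray (resolv_kernel T J l v h) t)).
    by move=> r /set_mem/kE.
  apply: measurable_ray => r r0; apply: resolv_kernel_ccont sJ hp bl hh _.
  exact: on_contour_pol.
have [_ ->] := @bochner_functional _ _ _ _ _ mu _ k u l (@measurable_halfline R) hu bl mk.
by apply: eq_Rintegral => r /set_mem/kE.
Qed.

Lemma contour_calculus_weak J p f h v u : sphere J -> w < p < th ->
  holomorphic th h -> (forall z, D z -> f (emb J z) = emb J (h z)) ->
  contour_calculus T f p J (v, u) -> weak_calculus T J p h v u.
Proof.
move=> sJ hp hh hf [u1 [u2 [u3 [u4 [i1 i2 i3 i4 /= ->]]]]] l bl.
have hp' := angleP T_bisect hth hp.
(* The directions b, a, - b, - a have the angles - p, p, pi - p, pi + p, in the order of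
   [contour]. *)
have e1 : slice J (cos p) (- sin p) = emb J (cexp (- p)).
  by rewrite /emb /= cosN sinN.
have e3 : - slice J (cos p) (- sin p) = emb J (cexp (pi - p)).
  rewrite /emb /slice /= cos_pi_sub sinB cospi sinpi mul0r mulN1r sub0r opprK.
  by rewrite opprD -!scaleNr opprK.
have e4 : - slice J (cos p) (sin p) = emb J (cexp (pi + p)).
  rewrite /emb /slice /= cosD sinD cospi sinpi !mul0r !mulN1r subr0 add0r.
  by rewrite opprD -!scaleNr.
rewrite e3 in i3; rewrite e4 in i4; rewrite e1 in i1.
have r1 := ray_bochner sJ hp (contour_angle1 hp') hh hf bl i1.
have r2 := ray_bochner sJ hp (contour_angle2 hp') hh hf bl i2.
have r3 := ray_bochner sJ hp (contour_angle3 hp') hh hf bl i3.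
have r4 := ray_bochner sJ hp (contour_angle4 hp') hh hf bl i4.
rewrite functionalZ //; congr (_ * _).
by rewrite !functionalD // !functionalN // r1 r2 r3 r4.
Qed.

(* Pairing a point of the contour with its conjugate leaves a real combination
   of Q_s[T]^-1 v and T Q_s[T]^-1 v, which does not see J. *)
Lemma kernel_pair J J' l v h r t t' : sphere J -> sphere J' ->
  bounded_functional l -> pol r t' = conjc (pol r t) ->
  off (pol r t) -> cexp t' = conjc (cexp t) ->
  h (conjc (pol r t)) = conjc (h (pol r t)) ->
  ray (resolv_kernel T J l v h) t' r - ray (resolv_kernel T J l v h) t r
  = ray (resolv_kernel T J' l v h) t' r - ray (resolv_kernel T J' l v h) t r.
Proof.
move=> sJ sJ' bl pE zO eE hE; rewrite /ray /resolv_kernel pE eE hE.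
have [q [y hqy]] := resolv_pseudo T_bisect v sJ zO.
suff E J0 : sphere J0 ->
    Im (cfun J0 l (resolv T J0 (conjc (pol r t)) v) * conjc (h (pol r t)) * conjc (cexp t))
    - Im (cfun J0 l (resolv T J0 (pol r t) v) * h (pol r t) * cexp t)
    = 2 * (Re (h (pol r t) * cexp t) * Im (pol r t)
      - Im (h (pol r t) * cexp t) * Re (pol r t)) * l q
      + 2 * Im (h (pol r t) * cexp t) * l y.
  by rewrite !E.
move=> sJ0; have [-> ->] := hqy J0 sJ0.
rewrite !(cfunB J0 bl) !cfun_vmul //.
case: (h (pol r t)) => a b; case: (cexp t) => c d; case: (pol r t) => x1 x2 /=.
by ring.
Qed.

Lemma conj_cexp (t : R) : conjc (cexp t) = cexp (- t).
Proof. by rewrite /cexp /= cosN sinN. Qed.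

Lemma conj_pol (r t : R) : conjc (pol r t) = pol r (- t).
Proof. by rewrite /pol -conj_cexp; case: (cexp t) => c d; apply: eqC => /=; ring. Qed.

Definition symmetric h := forall z, D z -> h (conjc z) = conjc (h z).

Lemma weak_imaginary_unit J J' p h v u : sphere J -> sphere J' -> w < p < th ->
  holomorphic th h -> decays th h -> symmetric h ->
  weak_calculus T J p h v u -> weak_calculus T J' p h v u.
Proof.
move=> sJ sJ' hp hh dh sh hu l bl.
suff key : contour (resolv_kernel T J l v h) p = contour (resolv_kernel T J' l v h) p.
  exact: (etrans (hu l bl) (congr1 (fun c => (2 * pi)^-1 * c) key)).
have hp' := angleP T_bisect hth hp.
have i1 := resolv_kernel_integrable T_bisect hth v sJ hp bl hh dh.
have i2 := resolv_kernel_integrable T_bisect hth v sJ' hp bl hh dh.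
have pair t t' : `|cos t| = cos p -> cexp t' = cexp (- t) ->
  ray_integral (resolv_kernel T J l v h) t' - ray_integral (resolv_kernel T J l v h) t
  = ray_integral (resolv_kernel T J' l v h) t' - ray_integral (resolv_kernel T J' l v h) t.
  move=> tp tt'; have t'p : `|cos t'| = cos p.
    by have [-> _] := tt'; rewrite cosN.
  have dE F : rays_integrable p F -> ray_integral F t' - ray_integral F t
      = \int[mu]_(r in @halfline R) (ray F t' r - ray F t r).
    move=> iF; rewrite /ray_integral -RintegralB //; first exact: measurable_itv.
      exact: iF.
    exact: iF.
  rewrite (dE _ i1) (dE _ i2).
  apply: eq_Rintegral => r /set_mem; rewrite halflineE => r0.
  have pc := on_contour_pol r0 tp.
  have [zO zD] := on_contourP T_bisect hth hp pc.
  apply: kernel_pair => //; rewrite ?conj_cexp ?conj_pol ?sh //.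
    by rewrite /pol tt'.
  by rewrite -conj_pol sh.
have E1 := pair p (- p) (contour_angle2 hp') erefl.
(* The left rays are conjugate to each other only modulo 2 pi, which is why [pair] compares values
   of [cexp] and not angles. *)
have eE : cexp (pi - p) = cexp (- (pi + p)).
  rewrite /cexp cosN sinN cosB sinB cosD sinD cospi sinpi !mul0r !mulN1r.
  by congr (_ +i* _); ring.
have E2 := pair (pi + p) (pi - p) (contour_angle4 hp') eE.
rewrite /contour; move: E1 E2.
move: (ray_integral (resolv_kernel T J l v h)) (ray_integral (resolv_kernel T J' l v h)).
by move=> I1 I2 E1 E2; lra.
Qed.

End ContourToWeak.

(** * Products of functions with opposite supports *)

Section FubiniHalfline.
Context (R : realType).
Local Notation mu := (@lebesgue_measure R).
Local Notation H := (@halfline R).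

Lemma halfline_integrable_bound (g m : R -> R) : measurable_fun H g ->
  mu.-integrable H (EFin \o m) -> (forall r, 0 < r -> `|g r| <= m r) ->
  mu.-integrable H (EFin \o g).
Proof.
move=> mg im gm; apply: le_integrable im; first exact: measurable_halfline.
  exact/measurable_EFinP.
move=> r; rewrite halflineE => r0; rewrite /= lee_fin.
by apply: le_trans (gm r r0) _; exact: ler_norm.
Qed.

Lemma halfline_integrable0 (g : R -> R) : (forall r, g r = 0) ->
  mu.-integrable H (EFin \o g).
Proof.
move=> g0; rewrite (_ : _ \o _ = cst 0%E); first exact: integrable0.
by apply/funext => r; rewrite /= g0.
Qed.

(** Since f vanishes off the open quadrant, Fubini's theorem can be applied on the whole plane;
    Tonelli's theorem and the product majorant give integrability. *)
Lemma halfline_fubini (f : R -> R -> R) (m1 m2 : R -> R) :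
  measurable_fun setT (fun q : R * R => f q.1 q.2) ->
  (forall r r', ~ (0 < r /\ 0 < r') -> f r r' = 0) ->
  (forall r r', 0 < r -> 0 < r' -> `|f r r'| <= m1 r * m2 r') ->
  mu.-integrable H (EFin \o m1) -> mu.-integrable H (EFin \o m2) ->
  mu.-integrable H (EFin \o (fun r => \int[mu]_(r' in H) f r r')) /\
  \int[mu]_(r in H) \int[mu]_(r' in H) f r r'
  = \int[mu]_(r' in H) \int[mu]_(r in H) f r r'.
Proof.
move=> mf f0 fm i1 i2; have mH := @measurable_halfline R.
pose F q : \bar R := (f q.1 q.2)%:E.
have mF : measurable_fun setT F by exact/measurable_EFinP.
have iE (g : R -> R) : (forall r, ~ 0 < r -> g r = 0) ->
    (\int[mu]_r (g r)%:E = \int[mu]_(r in H) (g r)%:E)%E.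
  move=> g0; rewrite [RHS]integral_mkcond; apply: eq_integral => r _.
  by rewrite patchE; case: ifPn => // /negP; rewrite inE halflineE => /g0 ->.
have ig r : mu.-integrable H (EFin \o f r).
  have [r0|r0] := pselect (0 < r); last first.
    by apply: halfline_integrable0 => r'; rewrite f0 // => -[].
  apply: (halfline_integrable_bound (m := fun r' => m1 r * m2 r')).
  - by apply: measurable_funTS; exact: (measurable_fun_pair2 r mf).
  - by have := @integrableZl _ _ _ mu _ mH (m1 r) _ i2.
  - by move=> r' r'0; exact: fm.
pose c := \int[mu]_(r in H) `|m2 r|.
have inner r : (\int[mu]_r' `|F (r, r')| = (\int[mu]_(r' in H) `|f r r'|)%:E)%E.
  transitivity (\int[mu]_r' (`|f r r'|)%:E)%E => //.
  rewrite (iE (fun r' => `|f r r'|)); last by move=> r' r'0; rewrite f0 ?normr0 // => -[].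
  rewrite /Rintegral fineK //; apply: integrable_fin_num => //.
  by have := integrable_abse (ig r).
have le_inner r : 0 < r -> \int[mu]_(r' in H) `|f r r'| <= `|m1 r| * c.
  move=> r0; rewrite /c -RintegralZl //; last by have := integrable_abse i2.
  apply: le_Rintegral => //.
  - by have := integrable_abse (ig r).
  - by have := @integrableZl _ _ _ mu _ mH `|m1 r| _ (integrable_abse i2).
  - move=> r'; rewrite halflineE => r'0; apply: le_trans (fm _ _ r0 r'0) _.
    by rewrite -normrM ler_norm.
have iF : (mu \x mu)%E.-integrable setT F.
  apply/integrable12ltyP => //.
  suff : (\int[mu]_x \int[mu]_y `|F (x, y)| < +oo)%E by [].
  have -> : (\int[mu]_x \int[mu]_y `|F (x, y)|
      = \int[mu]_(r in H) (\int[mu]_(r' in H) `|f r r'|)%:E)%E.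
    rewrite -iE; last first.
      move=> r r0; rewrite /Rintegral integral0_eq // => r' _.
      by rewrite f0 ?normr0 // => -[].
    by apply: eq_integral => r _; exact: inner.
  apply: (@le_lt_trans _ _ (\int[mu]_(r in H) (`|m1 r| * c)%:E)%E).
    apply: ge0_le_integral => //.
    - by move=> r _; rewrite lee_fin; apply: Rintegral_ge0 => r' _.
    - apply: measurable_funTS; rewrite (_ : (fun _ => _) = fun r => \int[mu]_r' `|F (r, r')|)%E.
        2: by apply/funext => r; rewrite inner.
      apply: (@measurable_fun_fubini_tonelli_F _ _ _ _ _ mu (abse \o F)).
        exact: measurableT_comp.
      by move=> x; exact: abse_ge0.
    - apply/measurable_EFinP; apply: measurable_funM => //.
      by apply: measurableT_comp => //; have /measurable_EFinP := measurable_int _ i1.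
    - by move=> r; rewrite halflineE => r0; rewrite lee_fin le_inner.
  have : mu.-integrable H (EFin \o (fun r => `|m1 r| * c)).
    have := @integrableZr _ _ _ mu _ mH c _ (integrable_abse i1).
    by apply: eq_integrable => // r _.
  move=> /integrable_fin_num -/(_ mH); rewrite fin_numElt => /andP[_].
  by apply: le_lt_trans.
have hF r : (fubini_F mu F r = (\int[mu]_(r' in H) f r r')%:E)%E.
  rewrite /fubini_F /F /= iE; last by move=> r' r'0; rewrite f0 // => -[].
  by rewrite /Rintegral fineK //; apply: integrable_fin_num => //; exact: ig.
split.
  have h := integrable_fubini_F iF.
  rewrite (_ : _ \o _ = fubini_F mu F); last by apply/funext => r; rewrite hF.
  by apply: (integrableS _ _ _ h) => //; exact: measurable_halfline.
have fin a : (\int[mu]_(x in H) (f x a)%:E)%E \is a fin_num.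
  apply: integrable_fin_num => //.
  have [a0|a0] := pselect (0 < a); last first.
    by apply: (@halfline_integrable0 (f ^~ a)) => r'; rewrite f0 // => -[].
  apply: (@halfline_integrable_bound (f ^~ a) (fun r => m1 r * m2 a)).
  - by apply: measurable_funTS; exact: (measurable_fun_pair1 a mf).
  - by have := @integrableZr _ _ _ mu _ mH (m2 a) _ i1.
  - by move=> r' r'0; exact: fm.
have fub : (\int[mu]_x \int[mu]_y F (x, y) = \int[mu]_y \int[mu]_x F (x, y))%E := Fubini iF.
have e1 : (\int[mu]_x \int[mu]_y F (x, y)
    = \int[mu]_(r in H) (\int[mu]_(r' in H) f r r')%:E)%E.
  rewrite -iE; last first.
    move=> r r0; rewrite /Rintegral integral0_eq // => r' _.
    by rewrite f0 // => -[].
  by apply: eq_integral => r _; exact: hF.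
have e2 : (\int[mu]_y \int[mu]_x F (x, y)
    = \int[mu]_(r' in H) (\int[mu]_(r in H) f r r')%:E)%E.
  rewrite -iE; last first.
    move=> r r0; rewrite /Rintegral integral0_eq // => r' _.
    by rewrite f0 // => -[].
  apply: eq_integral => a _; rewrite /Rintegral fineK // -[RHS](iE (f ^~ a)) //.
  by move=> r r0; rewrite f0 // => -[].
by move: fub; rewrite e1 e2 => /(congr1 fine).
Qed.

End FubiniHalfline.

(** * Double contour integrals and the exchange of their order *)

Section DoubleContour.
Context (R : realType).
Local Notation mu := (@lebesgue_measure R).
Local Notation H := (@halfline R).
Implicit Types (A B : R -> R[i]) (k : R[i] -> R[i] -> R[i]) (s p : R[i]).

Local Notation iC := (0 +i* 1 : R[i]).

Definition cmeasurable (d : measure_display) (X : measurableType d) (E : set X)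
    (f : X -> R[i]) :=
  measurable_fun E (fun x => Re (f x)) /\ measurable_fun E (fun x => Im (f x)).

Lemma cmeasurableM d (X : measurableType d) (f g : X -> R[i]) :
  cmeasurable setT f -> cmeasurable setT g -> cmeasurable setT (fun x => f x * g x).
Proof.
move=> [fR fI] [gR gI]; split.
  under eq_fun do rewrite ReM.
  by apply: measurable_funB; exact: measurable_funM.
under eq_fun do rewrite ImM.
by apply: measurable_funD; exact: measurable_funM.
Qed.

Lemma cmeasurableB d (X : measurableType d) (f g : X -> R[i]) :
  cmeasurable setT f -> cmeasurable setT g -> cmeasurable setT (fun x => f x - g x).
Proof.
move=> [fR fI] [gR gI]; split.
  by under eq_fun do rewrite ReD ReN; exact: measurable_funB.
by under eq_fun do rewrite ImD ImN; exact: measurable_funB.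
Qed.

Lemma cmeasurableV d (X : measurableType d) (f : X -> R[i]) :
  cmeasurable setT f -> cmeasurable setT (fun x => (f x)^-1).
Proof.
move=> [fR fI].
have mN : measurable_fun setT (fun x => (Re (f x) ^+ 2 + Im (f x) ^+ 2)^-1).
  rewrite (_ : (fun _ => _) = (fun x => (Re (f x) ^+ 2 + Im (f x) ^+ 2) `^ (-1))).
    apply: (measurableT_comp (measurable_powR _)).
    by apply: measurable_funD; exact: measurable_funX.
  by apply/funext => x; rewrite powR_inv1 // addr_ge0 ?sqr_ge0.
split.
  by under eq_fun do rewrite ReV; exact: measurable_funM.
under eq_fun do rewrite ImV -mulNr.
by apply: measurable_funM => //; exact: measurableT_comp.
Qed.

Definition cpatch A (r : R) : R[i] := if 0 < r then A r else 0.

Lemma cmeasurable_patch A : cmeasurable H A -> cmeasurable setT (cpatch A).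
Proof.
have patE (g : R -> R) : (fun r => if 0 < r then g r else 0) = g \_ H.
  apply/funext => r; rewrite patchE; case: ifPn => [r0|r0].
    by rewrite mem_set // halflineE.
  by rewrite memNset // halflineE; apply/negP.
move=> [mR mI]; split.
  rewrite (_ : (fun _ => _) = (fun r => if 0 < r then Re (A r) else 0)).
    by rewrite patE; apply/(measurable_restrictT _ (@measurable_halfline R)).
  by apply/funext => r; rewrite /cpatch; case: ifP.
rewrite (_ : (fun _ => _) = (fun r => if 0 < r then Im (A r) else 0)).
  by rewrite patE; apply/(measurable_restrictT _ (@measurable_halfline R)).
by apply/funext => r; rewrite /cpatch; case: ifP.
Qed.

(* The kernels of the double contour integral of k (s, p) ds_J dp_J. *)
Definition ray_kernel k t r p : R[i] := - iC * k (pol r t) p * cexp t.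

(** The integrand is the imaginary part of - i k e^{it} e^{it'}, which is symmetric in the two rays.
    Exchanging two contours is then Fubini's theorem for each pair of rays. *)
Lemma ray_kernel_flip k t r t' r' :
  ray (ray_kernel (fun p s => k s p) t' r') t r = ray (ray_kernel k t r) t' r'.
Proof. by rewrite /ray /ray_kernel; congr Im; ring. Qed.

Definition cauchy_kernel (F G : R[i] -> R[i]) s p := F s * G p / (s - p).

Lemma cmeasurable_fst A : cmeasurable H A ->
  cmeasurable setT (fun q : R * R => cpatch A q.1).
Proof.
move=> /cmeasurable_patch[h1 h2].
by split; [exact: (measurableT_comp h1) | exact: (measurableT_comp h2)].
Qed.

Lemma cmeasurable_snd A : cmeasurable H A ->
  cmeasurable setT (fun q : R * R => cpatch A q.2).
Proof.
move=> /cmeasurable_patch[h1 h2].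
by split; [exact: (measurableT_comp h1) | exact: (measurableT_comp h2)].
Qed.

Lemma cmeasurable_ccont F t : (forall r, 0 < r -> ccont F (pol r t)) ->
  cmeasurable H (fun r => F (pol r t)).
Proof.
move=> Fc; have cr r := cder_clim (cder_pol_r r t).
split; apply: measurable_halfline_continuous => r r0;
  by have [] := clim_comp (cr r) (Fc r r0).
Qed.

Lemma cauchy_kernel_fubini (F G : R[i] -> R[i]) t t' (m1 m2 : R -> R) :
  (forall r, 0 < r -> ccont F (pol r t)) ->
  (forall r, 0 < r -> ccont G (pol r t')) ->
  (forall r r', 0 < r -> 0 < r' ->
    normc (cauchy_kernel F G (pol r t) (pol r' t')) <= m1 r * m2 r') ->
  mu.-integrable H (EFin \o m1) -> mu.-integrable H (EFin \o m2) ->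
  let X := fun r r' => ray (ray_kernel (cauchy_kernel F G) t r) t' r' in
  [/\ mu.-integrable H (EFin \o (fun r => \int[mu]_(r' in H) X r r')),
      mu.-integrable H (EFin \o (fun r' => \int[mu]_(r in H) X r r')) &
      \int[mu]_(r in H) \int[mu]_(r' in H) X r r'
      = \int[mu]_(r' in H) \int[mu]_(r in H) X r r'].
Proof.
move=> Fc Gc hm i1 i2 X.
pose f r r' := Im (cpatch (fun r => F (pol r t)) r * cpatch (fun r => G (pol r t')) r'
  / (cpatch (fun a => pol a t) r - cpatch (fun a => pol a t') r') * cpatch (fun=> - iC * cexp t * cexp t') r).
have Xf r r' : H r -> H r' -> X r r' = f r r'.
  rewrite !halflineE => r0 r'0; rewrite /X /f /ray /ray_kernel /cauchy_kernel /cpatch.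
  by rewrite r0 r'0; congr Im; ring.
have mf : measurable_fun setT (fun q : R * R => f q.1 q.2).
  have mc (c : R[i]) : cmeasurable H (fun=> c) by split; exact: measurable_cst.
  have mid u : cmeasurable H (fun a => pol a u).
    by apply: (@cmeasurable_ccont id) => r _; exact: ccont_id.
  suff [] : cmeasurable setT (fun q : R * R =>
    cpatch (fun r => F (pol r t)) q.1 * cpatch (fun r => G (pol r t')) q.2
    / (cpatch (fun a => pol a t) q.1 - cpatch (fun a => pol a t') q.2) *
      cpatch (fun=> - iC * cexp t * cexp t') q.1) by [].
  apply: cmeasurableM; last exact: cmeasurable_fst.
  apply: cmeasurableM; first apply: cmeasurableM.
  - by apply: cmeasurable_fst; exact: cmeasurable_ccont.
  - by apply: cmeasurable_snd; exact: cmeasurable_ccont.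
  - apply: cmeasurableV; apply: cmeasurableB; first exact: cmeasurable_fst.
    exact: cmeasurable_snd.
have f0 r r' : ~ (0 < r /\ 0 < r') -> f r r' = 0.
  rewrite /f /cpatch; case: (0 < r); case: (0 < r') => // h; last 2 first.
  - by rewrite !mul0r.
  - by rewrite !mul0r.
  - by exfalso; exact: h.
  - by rewrite mulr0 !mul0r.
have fm r r' : 0 < r -> 0 < r' -> `|f r r'| <= m1 r * m2 r'.
  move=> r0 r'0; rewrite -Xf ?halflineE //; apply: le_trans (hm _ _ r0 r'0).
  apply: le_trans (abs_ray_le _ _ _) _; rewrite /ray_kernel !normcM normc_cexp mulr1.
  by rewrite normcN /= expr0n add0r expr1n sqrtr1 mul1r.
clearbody f; have [h1 h2] := halfline_fubini mf f0 fm i1 i2.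
(* The transposed function gives integrability of the other inner integral. *)
have [h3 _] : mu.-integrable H (EFin \o (fun r' => \int[mu]_(r in H) f r r')) /\
    \int[mu]_(r' in H) \int[mu]_(r in H) f r r'
    = \int[mu]_(r in H) \int[mu]_(r' in H) f r r'.
  apply: (@halfline_fubini _ (fun r' r => f r r') m2 m1) => //.
  - exact: (measurableT_comp mf (@measurable_swap _ _ _ _)).
  - by move=> r' r h; apply: f0 => -[r0 r'0]; exact: h.
  - by move=> r' r r'0 r0; rewrite mulrC fm.
have e1 r : H r -> \int[mu]_(r' in H) X r r' = \int[mu]_(r' in H) f r r'.
  by move=> Hr; apply: eq_Rintegral => r' /set_mem; exact: Xf.
have e2 r' : H r' -> \int[mu]_(r in H) X r r' = \int[mu]_(r in H) f r r'.
  by move=> Hr'; apply: eq_Rintegral => r /set_mem Hr; exact: Xf.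
split.
- apply: (eq_integrable _ _ _ _ h1); first exact: measurable_halfline.
  by move=> r /set_mem Hr /=; rewrite e1.
- apply: (eq_integrable _ _ _ _ h3); first exact: measurable_halfline.
  by move=> r /set_mem Hr /=; rewrite e2.
transitivity (\int[mu]_(r in H) \int[mu]_(r' in H) f r r').
  by apply: eq_Rintegral => r /set_mem; exact: e1.
by rewrite h2; apply: eq_Rintegral => r /set_mem Hr; rewrite e2.
Qed.

(** The outer integrals are taken over r alone, because [ray_kernel] already contains the factor
    [cexp t] of the outer ray. *)
Definition dcontour k (p : R) : R :=
  let I t := \int[mu]_(r in H) contour (ray_kernel k t r) p in
  I (- p) - I p + I (pi - p) - I (pi + p).

Section Exchange.
Variables (p : R) (F G : R[i] -> R[i]) (m1 m2 : R -> R).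
Hypothesis hp : 0 < p < pi / 2.
Hypothesis Fc : forall z, on_contour p z -> ccont F z.
Hypothesis Gc : forall z, on_contour p z -> ccont G z.
Hypothesis FGm : forall s q, on_contour p s -> on_contour p q ->
  normc (cauchy_kernel F G s q) <= m1 (normc s) * m2 (normc q).
Hypothesis i1 : mu.-integrable H (EFin \o m1).
Hypothesis i2 : mu.-integrable H (EFin \o m2).

Let k := cauchy_kernel F G.
Let X t t' r r' := ray (ray_kernel k t r) t' r'.

Let fub t t' : `|cos t| = cos p -> `|cos t'| = cos p ->
  [/\ mu.-integrable H (EFin \o (fun r => \int[mu]_(r' in H) X t t' r r')),
      mu.-integrable H (EFin \o (fun r' => \int[mu]_(r in H) X t t' r r')) &
      \int[mu]_(r in H) \int[mu]_(r' in H) X t t' r r'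
      = \int[mu]_(r' in H) \int[mu]_(r in H) X t t' r r'].
Proof.
move=> tp t'p; apply: (cauchy_kernel_fubini (m1 := m1) (m2 := m2)) => //.
- by move=> r r0; apply: Fc; exact: on_contour_pol.
- by move=> r r0; apply: Gc; exact: on_contour_pol.
- move=> r r' r0 r'0.
  have := FGm (on_contour_pol r0 tp) (on_contour_pol r'0 t'p).
  by rewrite !normc_pol.
Qed.

Let combine (g1 g2 g3 g4 : R -> R) :
  mu.-integrable H (EFin \o g1) -> mu.-integrable H (EFin \o g2) ->
  mu.-integrable H (EFin \o g3) -> mu.-integrable H (EFin \o g4) ->
  mu.-integrable H (EFin \o (fun r => g1 r - g2 r + g3 r - g4 r)) /\
  \int[mu]_(r in H) (g1 r - g2 r + g3 r - g4 r) = \int[mu]_(r in H) g1 r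
   - \int[mu]_(r in H) g2 r + \int[mu]_(r in H) g3 r - \int[mu]_(r in H) g4 r.
Proof.
move=> j1 j2 j3 j4; have mH := @measurable_halfline R.
have j12 : mu.-integrable H (EFin \o (fun r => g1 r - g2 r)).
  by have := @integrableB _ _ _ mu H mH _ _ j1 j2.
have j123 : mu.-integrable H (EFin \o (fun r => g1 r - g2 r + g3 r)).
  by have := @integrableD _ _ _ mu H mH _ _ j12 j3.
split; first by have := @integrableB _ _ _ mu H mH _ _ j123 j4.
by rewrite RintegralB // RintegralD // RintegralB.
Qed.

Lemma integrable_inner_contour t : `|cos t| = cos p ->
  mu.-integrable H (EFin \o (fun r => contour (ray_kernel k t r) p)).
Proof.
move=> tp.
have [h1 _ _] := fub tp (contour_angle1 hp); have [h2 _ _] := fub tp (contour_angle2 hp).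
have [h3 _ _] := fub tp (contour_angle3 hp); have [h4 _ _] := fub tp (contour_angle4 hp).
by have [] := combine h1 h2 h3 h4.
Qed.

Lemma dcontour_exchange : dcontour k p = dcontour (fun q s => k s q) p.
Proof.
have a1 := contour_angle1 hp; have a2 := contour_angle2 hp.
have a3 := contour_angle3 hp; have a4 := contour_angle4 hp.
pose Y t t' := \int[mu]_(r in H) \int[mu]_(r' in H) X t t' r r'.
have e1 t : `|cos t| = cos p -> \int[mu]_(r in H) contour (ray_kernel k t r) p
  = Y t (- p)
  - Y t p
  + Y t (pi - p)
  - Y t (pi + p).
  move=> tp; have [h1 _ _] := fub tp a1; have [h2 _ _] := fub tp a2.
  have [h3 _ _] := fub tp a3; have [h4 _ _] := fub tp a4.
  by have [_ <-] := combine h1 h2 h3 h4.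
have e2 t' : `|cos t'| = cos p ->
  \int[mu]_(r' in H) contour (ray_kernel (fun q s => k s q) t' r') p
  = Y (- p) t'
  - Y p t'
  + Y (pi - p) t'
  - Y (pi + p) t'.
  move=> tp; rewrite /Y; have [_ h1 ->] := fub a1 tp; have [_ h2 ->] := fub a2 tp.
  have [_ h3 ->] := fub a3 tp; have [_ h4 ->] := fub a4 tp.
  have [_ <-] := combine h1 h2 h3 h4.
  apply: eq_Rintegral => r' _; rewrite /contour /ray_integral.
  by congr (_ - _ + _ - _); apply: eq_Rintegral => r _; rewrite ray_kernel_flip.
rewrite /dcontour (e1 _ a1) (e1 _ a2) (e1 _ a3) (e1 _ a4).
rewrite (e2 _ a1) (e2 _ a2) (e2 _ a3) (e2 _ a4); clear e1 e2.
by clearbody Y; ring.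
Qed.

End Exchange.
End DoubleContour.

Section DoubleContourZero.
Context (R : realType) (p : R) (hp : 0 < p < pi / 2).
Local Notation mu := (@lebesgue_measure R).
Local Notation H := (@halfline R).
Implicit Types k : R[i] -> R[i] -> R[i].

Lemma dcontour_zero k : (forall t r, `|cos t| = cos p -> 0 < r ->
    contour (ray_kernel k t r) p = 0) -> dcontour k p = 0.
Proof.
move=> k0; have z0 t : `|cos t| = cos p ->
    \int[mu]_(r in H) contour (ray_kernel k t r) p = 0.
  move=> tp; transitivity (\int[mu]_(r in H) (0 : R)).
    by apply: eq_Rintegral => r /set_mem; rewrite halflineE; exact: k0.
  by rewrite /Rintegral integral0_eq.
rewrite /dcontour (z0 _ (contour_angle1 hp)) (z0 _ (contour_angle2 hp)).
by rewrite (z0 _ (contour_angle3 hp)) (z0 _ (contour_angle4 hp)) !subr0 addr0.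
Qed.

Lemma contour_iterated (c : R) F k :
  (forall t, `|cos t| = cos p ->
    mu.-integrable H (EFin \o (fun r => contour (ray_kernel k t r) p))) ->
  (forall t r, `|cos t| = cos p -> 0 < r ->
    ray F t r = c * contour (ray_kernel k t r) p) ->
  contour F p = c * dcontour k p.
Proof.
move=> ik hF; have E t : `|cos t| = cos p -> ray_integral F t
    = c * \int[mu]_(r in H) contour (ray_kernel k t r) p.
  move=> tp; rewrite -(@RintegralZl _ _ _ mu H _ _ (@measurable_halfline R) (ik t tp)).
  by apply: eq_Rintegral => r /set_mem; rewrite halflineE; exact: hF.
rewrite /contour (E _ (contour_angle1 hp)) (E _ (contour_angle2 hp)).
by rewrite (E _ (contour_angle3 hp)) (E _ (contour_angle4 hp)) -!mulrBr -mulrDr -mulrBr.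
Qed.

End DoubleContourZero.

(** * Cauchy kernels with a pole in the opposite half sector *)

Section CauchyTransform.
Context (R : realType) (t : R) (ht : 0 < t < pi / 2).
Implicit Types (z s q : R[i]) (h g : R[i] -> R[i]) (e : R).

Local Notation D := (in_sector (cos t)).

Let ct0 : 0 < cos t := cos_gt0_angle ht.
Let oD : copen [set z | D z] := copen_in_sector ct0 (cos_le1 t).

Lemma in_sector_Re_neq0 z : D z -> Re z != 0.
Proof.
move=> zD; rewrite -normr_gt0; apply: le_lt_trans zD.
by rewrite mulr_ge0 ?normc_ge0 // ltW.
Qed.

Lemma in_sector_neq0 z : D z -> z != 0.
Proof. by move=> zD; apply: contraTneq (in_sector_Re_neq0 zD) => ->; rewrite eqxx. Qed.

Lemma near_half e z : 0 < e * Re z -> \forall x \near cnbhs z, 0 < e * Re x.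
Proof.
move=> h; have [hR _] := ccont_id z.
have : e * Re x @[x --> cnbhs z] --> e * Re z by apply: cvgM => //; exact: cvg_cst.
by move=> /(@cvgr_gt R _ (cnbhs z) _ _ _) /(_ _ h).
Qed.

(** Through the sign of e both half sectors are treated at once; replacing e by - e exchanges
    them. *)
Definition half e h z : R[i] := if 0 < e * Re z then h z else 0.

Lemma half_sides e z : e != 0 -> D z -> 0 < e * Re z \/ 0 < - e * Re z.
Proof.
move=> e0 zD; have : e * Re z != 0 by rewrite mulf_neq0 // in_sector_Re_neq0.
by rewrite neq_lt mulNr oppr_gt0 => /orP[]; [right|left].
Qed.

Lemma half_off e h z : 0 < - e * Re z -> half e h z = 0.
Proof. by rewrite /half mulNr oppr_gt0 => h0; rewrite ltNge ltW. Qed.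

(** The double sector avoids the imaginary axis, so its halves are separated and a cut-off to 0 on
    one of them stays holomorphic. *)
Lemma half_holo e h h' : e != 0 -> holo [set z | D z /\ 0 < e * Re z] h h' ->
  holo [set z | D z] (half e h) (half e h').
Proof.
move=> e0 hh z zD; case: (half_sides e0 zD) => ez.
  have [h1 h2] := hh z (conj zD ez).
  have hE k : \forall x \near cnbhs z, k x = half e k x.
    by apply: filterS (near_half ez) => x xe; rewrite /half xe.
  by split; [rewrite {2}/half ez; exact: near_cdiff h1 | exact: near_ccont h2].
have hE k : \forall x \near cnbhs z, 0 = half e k x.
  by apply: filterS (near_half ez) => x xe; rewrite half_off.
split; first by rewrite (half_off h' ez); exact: near_cdiff (cdiff_cst 0 z).
exact: near_ccont (ccont_cst 0 z).
Qed.

(** Across the imaginary axis the real parts add up, so the horizontal distance is at least |Re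
    s|. *)
Lemma normc_opposite (c : R) s q : Re s * Re q < 0 -> c * normc s < `|Re s| ->
  c * normc s <= normc (s - q).
Proof.
move=> h1 h2; apply: le_trans (ltW h2) _; apply: le_trans (abs_Re_le_normc _).
rewrite ReD ReN -(@ler_pXn2r _ 2) ?nnegrE // !real_normK ?num_real //.
by have := sqr_ge0 (Re q); nra.
Qed.

Section Fixed.
Variables (s : R[i]) (g g' : R[i] -> R[i]) (Ds : D s).
Hypothesis gg : holo [set z | D z] g g'.
Hypothesis g0 : forall q, D q -> 0 < Re s * Re q -> g q = 0.

(** The pole q = s lies in the half where g vanishes. On the other half s - q has no zero, and
    [half_holo] glues. *)
Lemma cauchy_transform_holo : exists d, holo [set z | D z] (fun q => g q / (s - q)) d.
Proof.
have s0 : - Re s != 0 by rewrite oppr_eq0 in_sector_Re_neq0.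
have sq q : 0 < - Re s * Re q -> s - q != 0.
  apply: contraTneq => /eqP; rewrite subr_eq0 => /eqP ->.
  by rewrite mulNr oppr_gt0 -leNgt -expr2 sqr_ge0.
have := @holoD _ _ (fun=> s) (fun=> 0) (fun q => - q) (fun=> - 1)
  (@holo_cst _ [set z | D z /\ 0 < - Re s * Re z] s).
move=> /(_ (fun x _ => conj (cdiffN (cdiff_id x)) (ccont_cst _ x))).
move=> /holoV -/(_ (fun q qE => sq q qE.2)) h.
have gS : holo [set z | D z /\ 0 < - Re s * Re z] g g' by apply: holoS gg => x [].
eexists; apply: (eq_holo oD _ (half_holo s0 (holoM gS h))) => z zD.
rewrite /half; case: ifPn => // sz; rewrite g0 ?mul0r //.
by case: (half_sides s0 zD) => //; rewrite ?(negbTE sz) // opprK.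
Qed.

Lemma cauchy_transform_bound (a K : R) : 0 <= K ->
  (forall z, D z -> normc (g z) <= K * dom a (normc z)) ->
  forall q, D q -> normc (g q / (s - q)) <= K / cos t * (dom a (normc q) / normc q).
Proof.
move=> K0 gK q qD; have nq : 0 < normc q by rewrite normc_gt0 in_sector_neq0.
have b0 : 0 <= K / cos t * (dom a (normc q) / normc q).
  by rewrite mulr_ge0 // divr_ge0 ?dom_ge0 // ltW.
case: (half_sides (in_sector_Re_neq0 Ds) qD) => sq; first by rewrite g0 // mul0r normc0.
move: sq; rewrite mulNr oppr_gt0 mulrC => sq.
have := normc_opposite sq qD; rewrite normcB => h.
have cq : 0 < cos t * normc q by rewrite mulr_gt0.
rewrite normcM normcV; apply: le_trans (_ : K * dom a (normc q) / (cos t * normc q) <= _).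
  rewrite ler_pM ?normc_ge0 ?invr_ge0 ?gK // ?normc_ge0 //.
  by rewrite lef_pV2 // posrE (lt_le_trans cq).
by rewrite invfM le_eqVlt; apply/orP; left; apply/eqP; ring.
Qed.

End Fixed.
End CauchyTransform.

(** * Multiplication by z and products that vanish *)

Section WeakProducts.
Context (R : realType) (n : nat) (V : rightHilbertModule R n).
Context (T : operator V) (w : R) (T_bisect : bisectorial T w).
Context (th : R) (hth : w < th < pi / 2).
Context (J : clifford R n) (sJ : sphere J) (p : R) (hp : w < p < th).
Implicit Types (u v : V) (z s q : R[i]) (h g : R[i] -> R[i]).

Local Notation mu := (@lebesgue_measure R).
Local Notation H := (@halfline R).
Local Notation off := (off_sector (cos w)).
Local Notation D := (in_sector (cos th)).
Local Notation iC := (0 +i* 1 : R[i]).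
Local Notation Rz := (resolv T J).
Local Notation holomorphic := (holomorphic th).
Local Notation decays := (decays th).
Local Notation weak := (weak_calculus T J p).

Let hpp := angleP T_bisect hth hp.
Let pth : 0 < p < th.
Proof. by have /andP[-> _] := hpp; have /andP[_ ->] := hp. Qed.
Let thpi : th < pi / 2. Proof. by have /andP[] := hth. Qed.
Let hth0 := sector_angle T_bisect hth.

Lemma bounded_linear_comp (A B : V -> V) : bounded_linear J A -> bounded_linear J B ->
  bounded_linear J (fun v => A (B v)).
Proof.
move=> bA bB; case: (bA) (bB) => [A1 A2 [M M0 hM]] [B1 B2 [N N0 hN]]; split.
- by move=> a u v; rewrite B1 A1.
- by move=> v; rewrite B2 A2.
- exists (M * N); first exact: mulr_ge0.
  by move=> v; apply: le_trans (hM _) _; rewrite -mulrA ler_wpM2l.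
Qed.

Lemma iC_off : off iC.
Proof.
rewrite /off_sector /= normr0 expr0n add0r expr1n sqrtr1 mulr1.
exact: cos_gt0_angle (angle_w T_bisect).
Qed.

(** The unbounded T is reached through its resolvent at i: it suffices that R_i (y i - y') = y.
    Under the integral, R_i R_z v (i - z) is R_z v - R_i v, and the constant vector R_i v
    contributes nothing by Cauchy's theorem. *)
Lemma weak_mul_id g v y y' : holomorphic g -> decays g -> decays (fun z => z * g z) ->
  weak g v y -> weak (fun z => z * g z) v y' -> T (y, y').
Proof.
move=> hg dg dzg wy wy'.
have hzg : holomorphic (fun z => z * g z).
  by have [g' gg] := hg; eexists; apply: holoM gg; exact: holo_id.
have nO := iC_off.
suff E : Rz iC (vmul J y iC - y') = y.
  have := resolvP T_bisect (vmul J y iC - y') sJ nO; rewrite E.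
  by rewrite opprB addrC subrK.
have bA2 := resolv_bounded_linear T_bisect sJ nO.
have bA1 := bounded_linear_comp bA2 (@bounded_linear_vmul _ _ V J iC sJ).
apply: functional_ext => l bl.
rewrite (blinD bA2) (blinN bA2) functionalD // functionalN //.
have := wy _ (bounded_functional_comp bA1 bl) => /= ->.
have := wy' _ (bounded_functional_comp bA2 bl) => /= ->.
rewrite (wy _ bl) -mulrBr; congr (_ * _); apply/eqP; rewrite subr_eq; apply/eqP.
pose c := cfun J l (Rz iC v).
have [g' gg] := hg; have [a [K [a0 K0 hK]]] := dzg.
(* Decay of z g(z) replaces the factor 1 / |z| that the resolvent would have given, so g is
   integrable on its own. *)
have hb z : D z -> normc (- c * g z) <= normc c * K * (dom a (normc z) / normc z).
  move=> zD; rewrite normcM normcN -mulrA ler_wpM2l ?normc_ge0 // mulrA.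
  rewrite ler_pdivlMr ?normc_gt0 ?(in_sector_neq0 hth0 zD) //.
  by have := hK z zD; rewrite normcM mulrC.
have K40 : contour (fun z => - c * g z) p = 0.
  by apply: (contour_eq0 pth thpi _ a0 hb); apply: holoM gg; exact: holo_cst.
have i3 := resolv_kernel_integrable T_bisect hth v sJ hp bl hg dg.
have i2 := resolv_kernel_integrable T_bisect hth v sJ hp
  (bounded_functional_comp bA2 bl) hzg dzg.
have i4 : rays_integrable p (fun z => - c * g z).
  apply: (rays_integrable_bound a0) => z /(on_contourP T_bisect hth hp)[zO zD].
    by apply: ccontM; [exact: ccont_cst | exact: holo_ccont gg zD].
  exact: hb.
have i34 : rays_integrable p (fun z => resolv_kernel T J l v g z + - c * g z).
  move=> t tp; rewrite (_ : _ \o _ = EFin \o (fun r =>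
      ray (resolv_kernel T J l v g) t r + ray (fun z => - c * g z) t r)).
    by have := @integrableD _ _ _ mu H (@measurable_halfline R) _ _ (i3 t tp) (i4 t tp).
  by apply/funext => r; rewrite /= /ray mulrDl ImD.
rewrite [RHS]addrC -[X in _ = _ + X]addr0 -[X in _ = _ + (_ + X)]K40.
rewrite -!contourD //; apply: (contour_ext hpp) => z /(on_contourP T_bisect hth hp)[zO zD].
rewrite /resolv_kernel !(cfun_comp bA1) !(cfun_comp bA2) (blin_vmul bA2) cfun_vmul //.
have := resolvent_identity T_bisect v sJ nO zO.
move=> /(congr1 (cfun J l)); rewrite cfun_vmul // cfunB // -/c => E.
rewrite -mulrDl -E; ring.
Qed.

(** Neither function is tied to a side: where one is nonzero, the other vanishes on the whole half
    sector of that point. *)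
Definition opposite g1 g2 := forall s q, D s -> D q -> 0 < Re s * Re q ->
  g1 s = 0 \/ g2 q = 0.

Section Disjoint.
Variables (g1 g2 : R[i] -> R[i]) (v x y : V) (l : V -> R).
Hypotheses (hg1 : holomorphic g1) (dg1 : decays g1).
Hypotheses (hg2 : holomorphic g2) (dg2 : decays g2).
Hypothesis opp : opposite g1 g2.
Hypothesis bl : bounded_functional l.

Let L := cfun J l.
Let G2 := resolv_kernel T J l v g2.
Let k := cauchy_kernel g1 G2.

Let hwp : w < p < pi / 2.
Proof. by have /andP[-> _] := hp; have /andP[_ ->] := hpp. Qed.

Let opp2 s q : D s -> D q -> g1 s != 0 -> 0 < Re s * Re q -> g2 q = 0.
Proof. by move=> sD qD g0 sq; case: (opp sD qD sq) => // /eqP; rewrite (negbTE g0). Qed.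

Let opp1 s q : D s -> D q -> g2 q != 0 -> 0 < Re q * Re s -> g1 s = 0.
Proof.
move=> sD qD g0; rewrite mulrC => sq.
by case: (opp sD qD sq) => // /eqP; rewrite (negbTE g0).
Qed.

(** With q fixed the resolvent factor is a constant, and the rest is g1(z) / (q - z), holomorphic on
    the whole double sector unless g2(q) = 0. *)
Lemma contour_inner_zero t r : `|cos t| = cos p -> 0 < r ->
  contour (ray_kernel (fun q s => k s q) t r) p = 0.
Proof.
move=> tp r0; set q := pol r t.
have [qO qD] := on_contourP T_bisect hth hp (on_contour_pol r0 tp).
pose c := iC * G2 q * cexp t.
have E z : ray_kernel (fun q s => k s q) t r z = c * (g1 z / (q - z)).
  rewrite /ray_kernel /k /cauchy_kernel -/q /c -[z - q]opprB invrN; ring.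
have [q0|q0] := eqVneq (g2 q) 0.
  rewrite -[RHS](contour_cst0 hpp); apply: (contour_ext hpp) => z _.
  by rewrite E /c /G2 /resolv_kernel q0 !(mulr0, mul0r).
have [g1' gg1] := hg1; have [a [K [a0 K0 hK]]] := dg1.
have g10 z : D z -> 0 < Re q * Re z -> g1 z = 0 by move=> zD; exact: opp1.
have [d hd] := cauchy_transform_holo hth0 qD gg1 g10.
apply: (contour_eq0 (F := ray_kernel (fun q s => k s q) t r) (a := a)
  (F' := fun z => 0 * (g1 z / (q - z)) + c * d z)
  (K := normc c * (K / cos th)) pth thpi) => //.
  apply: (@eq_holo _ _ (fun z => c * (g1 z / (q - z)))).
  - by apply: copen_in_sector (cos_le1 th); exact: cos_gt0_angle.
  - by move=> z _; rewrite E.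
  - by apply: holoM hd; exact: holo_cst.
move=> z zD; rewrite E normcM -mulrA ler_wpM2l ?normc_ge0 //.
exact: (cauchy_transform_bound hth0 qD g10 K0 hK zD).
Qed.

(** The vector R_s g2(T) v is the integral of R_s R_q v g2(q), and R_s R_q = (R_q - R_s) / (s - q).
    The part with R_s v is a constant times g2(q) / (s - q), whose integral is 0. *)
Lemma contour_inner t r : weak g2 v y -> `|cos t| = cos p -> 0 < r ->
  ray (resolv_kernel T J l y g1) t r = (2 * pi)^-1 * contour (ray_kernel k t r) p.
Proof.
move=> wy tp r0; set s := pol r t.
have [sO sD] := on_contourP T_bisect hth hp (on_contour_pol r0 tp).
pose c := - iC * g1 s * cexp t.
have bR := resolv_bounded_linear T_bisect sJ sO.
have bA := bounded_linear_comp (@bounded_linear_vmul _ _ V J c sJ) bR.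
have -> : ray (resolv_kernel T J l y g1) t r = l (vmul J (Rz s y) c).
  transitivity (Re (L (vmul J (Rz s y) c))) => //.
  rewrite /L cfun_vmul // /c /ray /resolv_kernel -/s !(ReM, ImM, ReN, ImN) /=; ring.
have := wy _ (bounded_functional_comp bA bl) => /= ->; congr (_ * _).
have kE q : ray_kernel k t r q = c * (L (Rz q v) * (g2 q / (s - q))).
  by rewrite /ray_kernel /k /cauchy_kernel /G2 /resolv_kernel -/s -/L /c; ring.
have [s0|s0] := eqVneq (g1 s) 0.
  apply: (contour_ext hpp) => z _; rewrite kE /resolv_kernel (cfun_comp bA).
  by rewrite cfun_vmul // /c s0; ring.
have [g2' gg2] := hg2; have [a [K [a0 K0 hK]]] := dg2.
have g20 z : D z -> 0 < Re s * Re z -> g2 z = 0 by move=> zD; exact: opp2.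
have [d hd] := cauchy_transform_holo hth0 sD gg2 g20.
have hb := cauchy_transform_bound hth0 sD g20 K0 hK.
pose c' := c * L (Rz s v).
have K50 : contour (fun q => c' * (g2 q / (s - q))) p = 0.
  apply: (contour_eq0 (a := a) (F' := fun z => 0 * (g2 z / (s - z)) + c' * d z)
    (K := normc c' * (K / cos th)) pth thpi) => //.
    by apply: holoM hd; exact: holo_cst.
  by move=> z zD; rewrite normcM -mulrA ler_wpM2l ?normc_ge0 // hb.
have i5 : rays_integrable p (fun q => c' * (g2 q / (s - q))).
  apply: (rays_integrable_bound (a := a) (K := normc c' * (K / cos th))) => //.
    move=> z /(on_contourP T_bisect hth hp)[zO zD].
    by apply: ccontM; [exact: ccont_cst | exact: holo_ccont hd zD].
  move=> z /(on_contourP T_bisect hth hp)[zO zD].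
  by rewrite normcM -mulrA ler_wpM2l ?normc_ge0 // hb.
have ik : rays_integrable p (resolv_kernel T J (l \o (fun u => vmul J (Rz s u) c)) v g2).
  exact: (resolv_kernel_integrable T_bisect hth v sJ hp (bounded_functional_comp bA bl) hg2 dg2).
rewrite -[LHS]addr0 -K50 -(contourD hpp) //.
apply: (contour_ext hpp) => z /(on_contourP T_bisect hth hp)[zO zD].
rewrite kE /resolv_kernel (cfun_comp bA) cfun_vmul // -/L /c'.
(* On the diagonal the quotient is 0 by convention, which is consistent because g2 vanishes
   there. *)
have [sz|sz] := eqVneq s z.
  have -> : g2 z = 0.
    by rewrite g20 // -sz -expr2 lt_def sqrf_eq0 sqr_ge0 (in_sector_Re_neq0 hth0 sD).
  by rewrite !(mul0r, mulr0, addr0).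
have sz0 : s - z != 0 by rewrite subr_eq0.
have := resolvent_identity T_bisect v sJ sO zO.
move=> /(congr1 L); rewrite /L cfun_vmul // cfunB // -/L => E.
have -> : L (Rz z v) = L (Rz s (Rz z v)) * (s - z) + L (Rz s v) by rewrite E subrK.
by field.
Qed.

Lemma weak_disjoint_functional : weak g2 v y -> weak g1 y x -> l x = 0.
Proof.
move=> wy wx; rewrite (wx _ bl).
have a1 := contour_angle1 hpp; have a2 := contour_angle2 hpp.
have a3 := contour_angle3 hpp; have a4 := contour_angle4 hpp.
have [M M0 hM] := kernel_bound T_bisect hwp sJ bl.
have [e1 [K1 [e10 K10 hK1]]] := dg1; have [e2 [K2 [e20 K20 hK2]]] := dg2.
have ct0 : 0 < cos th := cos_gt0_angle hth0.
pose m1 r := K1 / cos th * (dom e1 r / r).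
pose m2 r := M * `|v| * K2 * (dom e2 r / r).
have mH := @measurable_halfline R.
have i1 : mu.-integrable H (EFin \o m1).
  by have := @integrableZl _ _ _ mu H mH (K1 / cos th) _ (integrable_dom e10).
have i2 : mu.-integrable H (EFin \o m2).
  by have := @integrableZl _ _ _ mu H mH (M * `|v| * K2) _ (integrable_dom e20).
have Fc z : on_contour p z -> ccont g1 z.
  move=> /(on_contourP T_bisect hth hp)[_ zD].
  by have [g1' gg1] := hg1; exact: holo_ccont gg1 zD.
have Gc z : on_contour p z -> ccont G2 z.
  exact: (resolv_kernel_ccont T_bisect hth v sJ hp bl hg2).
have bG z : on_contour p z -> normc (G2 z) <= m2 (normc z).
  move=> zp; have [zO zD] := on_contourP T_bisect hth hp zp; have /andP[z0 /eqP zE] := zp.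
  rewrite /G2 /resolv_kernel normcM.
  apply: le_trans (_ : M * `|v| / normc z * (K2 * dom e2 (normc z)) <= _).
    by rewrite ler_pM ?normc_ge0 ?hK2 // hM // zE.
  by rewrite /m2 le_eqVlt; apply/orP; left; apply/eqP; ring.
have m20 z : 0 <= m2 (normc z).
  apply: mulr_ge0; first by rewrite !mulr_ge0.
  by rewrite divr_ge0 ?dom_ge0 ?normc_ge0.
have FGm s q : on_contour p s -> on_contour p q ->
    normc (k s q) <= m1 (normc s) * m2 (normc q).
  move=> sp qp; have [sO sD] := on_contourP T_bisect hth hp sp.
  have [qO qD] := on_contourP T_bisect hth hp qp.
  have m10 : 0 <= m1 (normc s).
    apply: mulr_ge0; first by rewrite divr_ge0 // ltW.
    by rewrite divr_ge0 ?dom_ge0 ?normc_ge0.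
  (* If g2(q) is nonzero, g1 vanishes on the half sector of q, and |g1(s) / (s - q)| has a bound in
     |s| alone. This splits the majorant into a product. *)
  have [q0|q0] := eqVneq (g2 q) 0.
    by rewrite /k /cauchy_kernel /G2 /resolv_kernel q0 mulr0 mulr0 mul0r normc0 mulr_ge0.
  have g10 z : D z -> 0 < Re q * Re z -> g1 z = 0 by move=> zD; exact: opp1.
  have := cauchy_transform_bound hth0 qD g10 K10 hK1 sD.
  rewrite normcM normcV normcB -normcV -normcM => h.
  have -> : k s q = g1 s / (s - q) * G2 q by rewrite /k /cauchy_kernel mulrAC.
  by rewrite normcM ler_pM ?normc_ge0 ?bG.
have ik t (tp : `|cos t| = cos p) := integrable_inner_contour hpp Fc Gc FGm i1 i2 tp.
rewrite (contour_iterated hpp ik (fun t r tp r0 => contour_inner wy tp r0)).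
rewrite (dcontour_exchange hpp Fc Gc FGm i1 i2).
by rewrite (dcontour_zero hpp contour_inner_zero) !mulr0.
Qed.

End Disjoint.

(* By the resolvent identity g1(T) g2(T) has the double contour integral of the
   Cauchy kernel, of which either integral vanishes once it is the inner one. *)
Lemma weak_disjoint g1 g2 v y x : holomorphic g1 -> decays g1 ->
  holomorphic g2 -> decays g2 -> opposite g1 g2 ->
  weak g2 v y -> weak g1 y x -> x = 0.
Proof.
move=> hg1 dg1 hg2 dg2 opp wy wx; apply: functional_ext => l bl.
by rewrite (functional0 bl) (weak_disjoint_functional hg1 dg1 hg2 dg2 opp bl wy wx).
Qed.

End WeakProducts.

(** * Intrinsic functions and regularization *)

Section IntrinsicFunctions.
Context (R : realType) (n : nat) (J0 : clifford R n) (sJ0 : sphere J0).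
Context (th : R) (hth : 0 < th < pi / 2).
Implicit Types (z : R[i]) (h g : R[i] -> R[i]) (J s : clifford R n).
Implicit Type f : clifford R n -> clifford R n.

Local Notation D := (in_sector (cos th)).
Local Notation U := (double_sector n th).

Let cth0 : 0 < cos th := cos_gt0_angle hth.
Let oD : copen [set z | D z] := copen_in_sector cth0 (cos_le1 th).

Definition represents f h := forall J z, sphere J -> D z -> f (emb J z) = emb J (h z).

Lemma double_sector_emb J z : sphere J -> double_sector n th (emb J z) <-> D z.
Proof.
move=> sJ; rewrite (double_sectorE _ hth) Sc_emb // cnorm_emb //.
by split=> [[]//|zD]; split => //; exact: paravector_emb.
Qed.

Lemma intrinsic_represents f : intrinsic U f ->
  exists h, [/\ represents f h, holomorphic th h & symmetric th h].
Proof.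
move=> [a [b hab]].
have Uz J z : sphere J -> D z -> U (slice J (Re z) (Im z)).
  by move=> sJ zD; apply/(double_sector_emb z sJ).
exists (cpair a b); split.
- by move=> J z sJ /(Uz _ _ sJ) /(hab _ _ _ sJ)[].
- eexists; apply: cauchy_riemann_holo => // z /(Uz _ _ sJ0) /(hab _ _ _ sJ0)[_ _ _].
  exact.
- move=> z /(Uz _ _ sJ0) /(hab _ _ _ sJ0)[_ h1 h2 _].
  by rewrite /cpair; case: z h1 h2 => x y /= -> ->.
Qed.

Lemma represents_intrinsic f h : represents f h -> holomorphic th h ->
  symmetric th h -> intrinsic U f.
Proof.
move=> fh [h' hh] sh.
exists (fun x y => Re (h (x +i* y))), (fun x y => Im (h (x +i* y))) => J x y sJ.
move=> /(double_sector_emb (x +i* y) sJ) zD; have := sh _ zD => /= E.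
rewrite E; case: (h _) (fh J _ sJ zD) => u v /= fE; split => //.
exact: (holo_cauchy_riemann oD hh zD).
Qed.

Lemma double_sector_is_emb s : U s -> exists J z, [/\ sphere J, D z & s = emb J z].
Proof.
move=> Us; have [ps _] := (double_sectorE s hth).1 Us.
have [J [z [sJ sE]]] := paravector_is_emb sJ0 ps.
by exists J, z; split => //; rewrite sE in Us; apply/(double_sector_emb z sJ).
Qed.

Lemma N0_represents f : N0 U f ->
  exists h, [/\ represents f h, holomorphic th h, decays th h & symmetric th h].
Proof.
move=> [/intrinsic_represents[h [fh hh sh]] [a [C [a0 C0 hC]]]].
exists h; split => //; exists a, C; split => // z zD.
have := hC (emb J0 z) ((double_sector_emb z sJ0).2 zD).
by rewrite fh // !cnorm_emb.
Qed.

Lemma represents_N0 f h : represents f h -> holomorphic th h -> decays th h ->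
  symmetric th h -> N0 U f.
Proof.
move=> fh hh [a [C [a0 C0 hC]]] sh; split; first exact: represents_intrinsic fh hh sh.
exists a, C; split => // s /double_sector_is_emb[J [z [sJ zD ->]]].
by rewrite fh // !cnorm_emb //; exact: hC.
Qed.

Definition bounded_on_sector h := exists2 C : R, 0 <= C & forall z, D z -> normc (h z) <= C.

Lemma represents_Ninfty f h : represents f h -> holomorphic th h ->
  bounded_on_sector h -> symmetric th h -> Ninfty U f.
Proof.
move=> fh hh [C C0 hC] sh; split; first exact: represents_intrinsic fh hh sh.
exists C => s /double_sector_is_emb[J [z [sJ zD ->]]].
by rewrite fh // !cnorm_emb //; exact: hC.
Qed.

(* s = emb J (Sc s +i* y) for J = (s - Sc s) / y; the second term is 0 if y is. *)
Definition lift h s : clifford R n :=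
  let y := cnorm (s - Sc s *: 1) in
  Re (h (Sc s +i* y)) *: 1 + (Im (h (Sc s +i* y)) / y) *: (s - Sc s *: 1).

Lemma lift_represents h : symmetric th h -> represents (lift h) h.
Proof.
move=> sh J z sJ zD; have sz := sh z zD.
rewrite /lift Sc_emb //; have -> : emb J z - Re z *: 1 = Im z *: J.
  by rewrite /emb /slice addrC addKr.
rewrite cnormZ; have -> : cnorm J = 1 by rewrite -(emb_iC J) cnorm_emb //= expr0n add0r expr1n sqrtr1.
rewrite mulr1 /emb /slice; case: z zD sz => x y zD /= sz.
case: (ltgtP y 0) => y0.
- rewrite ltr0_norm // sz; case: (h _) => a b /=; congr (_ + _); rewrite scalerA.
  by congr (_ *: _); rewrite invrN mulrNN divfK // lt_eqF.
- by rewrite gtr0_norm // scalerA divfK // gt_eqF.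
- move: sz; rewrite y0 normr0 oppr0 scale0r scaler0 addr0.
  case: (h _) => a b /= [] bN; have -> : b = 0 by lra.
  by rewrite scale0r addr0.
Qed.

Lemma representsM f f' h h' : represents f h -> represents f' h' ->
  represents (fun s => f s * f' s) (fun z => h z * h' z).
Proof. by move=> fh fh' J z sJ zD; rewrite fh // fh' // -embM. Qed.

Lemma symmetricM h g : symmetric th h -> symmetric th g ->
  symmetric th (fun z => h z * g z).
Proof.
move=> sh sg z zD; rewrite sh // sg //.
by case: (h z) => a b; case: (g z) => c d; apply: eqC => /=; ring.
Qed.

Lemma holomorphicM h g : holomorphic th h -> holomorphic th g ->
  holomorphic th (fun z => h z * g z).
Proof. by move=> [h' hh] [g' gg]; eexists; apply: holoM; [exact: hh|exact: gg]. Qed.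

Lemma decays_bounded h g : decays th h -> bounded_on_sector g ->
  decays th (fun z => h z * g z).
Proof.
move=> [a [K [a0 K0 hK]]] [C C0 hC]; exists a, (K * C); split => //.
  exact: mulr_ge0.
by move=> z zD; rewrite normcM mulrAC ler_pM ?normc_ge0 ?hK ?hC.
Qed.

End IntrinsicFunctions.

(** * Bounded functions supported on one half sector *)

Section HalfSector.
Context (R : realType) (th : R) (hth : 0 < th < pi / 2).
Implicit Types (z m : R[i]) (h g : R[i] -> R[i]) (e : R).

Local Notation D := (in_sector (cos th)).

Let cth0 : 0 < cos th := cos_gt0_angle hth.
Let oD : copen [set z | D z] := copen_in_sector cth0 (cos_le1 th).

Lemma half_symmetric e h : (forall z, D z -> 0 < e * Re z -> h (conjc z) = conjc (h z)) ->
  symmetric th (half e h).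
Proof.
move=> sh z zD; rewrite /half; have -> : Re (conjc z) = Re z by case: z {zD}.
by case: ifP => [ez|_]; [exact: sh | apply: eqC; rewrite /= ?oppr0].
Qed.

Lemma half_opposite e h g : e != 0 -> opposite th (half e h) (half (- e) g).
Proof.
move=> e0 s q sD qD; case: (half_sides hth e0 sD) => es; last by left; exact: half_off.
case: (half_sides hth e0 qD) => eq; first by right; apply: half_off; rewrite opprK.
move: es eq => es eq h1; exfalso.
have : e ^+ 2 * (Re s * Re q) <= 0 by nra.
by rewrite leNgt mulr_gt0 // lt_def sqrf_eq0 e0 sqr_ge0.
Qed.

Section Quadratic.
Variables (m : R[i]) (e : R).
Hypotheses (m0 : m != 0) (e0 : e != 0) (em : e * Re m <= 0).

Definition quad z : R[i] := z * z + (- (2 * Re m))%:C * z + (normc m ^+ 2)%:C.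

Lemma quadE z : quad z = (z - m) * (z - conjc m).
Proof.
rewrite /quad sqr_normcE.
by case: z => a b; case: m => c d; apply: eqC => /=; ring.
Qed.

(** As m' is not on the side of z, |Re (z - m')| is at least |Re z|, hence at least cos th |z|. The
    triangle inequality then trades |z| for |m'|. *)
Lemma dist_half z m' : e * Re m' <= 0 -> D z -> 0 < e * Re z ->
  cos th * normc z <= normc (z - m') /\ cos th * normc m' <= 2 * normc (z - m').
Proof.
move=> em' zD ez; have h1 : cos th * normc z <= normc (z - m').
  apply: le_trans (ltW zD) _; apply: le_trans (abs_Re_le_normc _).
  rewrite ReD ReN -(@ler_pXn2r _ 2) ?nnegrE // !real_normK ?num_real //.
  have e2 : 0 < e ^+ 2 by rewrite lt_def sqrf_eq0 e0 sqr_ge0.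
  have : 0 <= e ^+ 2 * ((Re z - Re m') ^+ 2 - Re z ^+ 2) by nra.
  by rewrite pmulr_rge0 // subr_ge0.
split => //; have := le_normcD (m' - z) z; rewrite subrK normcB => h2.
have : cos th * normc m' <= cos th * normc (z - m') + cos th * normc z.
  by rewrite -mulrDr ler_pM2l.
move=> h3; have : cos th * normc (z - m') <= normc (z - m').
  by rewrite ler_piMl ?normc_ge0 ?cos_le1.
by lra.
Qed.

(** The two inequalities make 1 / q and z / q bounded. Each root is at distance at least a = cos th
    |m| / 2 and at least cos th |z| from z; a > 0 is where m != 0 enters. *)
Lemma quad_bound : exists2 c : R, 0 < c & forall z, D z -> 0 < e * Re z ->
  c <= normc (quad z) /\ c * normc z <= normc (quad z).
Proof.
have nm : 0 < normc m by rewrite normc_gt0.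
pose a := cos th * normc m / 2.
have a0 : 0 < a by rewrite divr_gt0 // mulr_gt0.
have em' : e * Re (conjc m) <= 0 by case: m em.
exists (Num.min (a * a) (a * cos th)); first by rewrite lt_min !mulr_gt0.
move=> z zD ez; rewrite quadE normcM.
have [h1 h2] := dist_half em zD ez; have [h3 h4] := dist_half em' zD ez.
rewrite normc_conj in h4.
have b1 : a <= normc (z - m) by rewrite /a; lra.
have b2 : a <= normc (z - conjc m) by rewrite /a; lra.
split; first by rewrite ge_min ler_pM // ltW.
apply: le_trans (_ : a * cos th * normc z <= _).
  by rewrite ler_wpM2r ?normc_ge0 // ge_min lexx orbT.
by rewrite -mulrA mulrC ler_pM ?normc_ge0 // ?(ltW a0) // mulr_ge0 ?normc_ge0 // ltW.
Qed.

Lemma quad_neq0 z : D z -> 0 < e * Re z -> quad z != 0.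
Proof.
have [c c0 hc] := quad_bound => zD ez; rewrite -normc_gt0.
by have [h _] := hc z zD ez; exact: lt_le_trans h.
Qed.

Lemma quad_conj z : quad (conjc z) = conjc (quad z).
Proof.
by rewrite /quad; case: z => a b; apply: eqC => /=; ring.
Qed.

Lemma holo_quad (E : set R[i]) : exists q', holo E quad q'.
Proof.
have hid := @holo_id R E.
have := holoD (holoD (holoM hid hid) (holoM (@holo_cst R E (- (2 * Re m))%:C) hid))
  (@holo_cst R E (normc m ^+ 2)%:C).
by move=> h; eexists; exact: h.
Qed.

Definition admissible h := [/\ holomorphic th h, symmetric th h & bounded_on_sector th h].

Lemma admissible_half1 : admissible (half e (fun=> 1)).
Proof.
split.
- by exists (half e (fun=> 0)); apply: (half_holo hth) => //; exact: holo_cst.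
- by apply: half_symmetric => z _ _; apply: eqC; rewrite /= ?oppr0.
- exists 1 => // z zD; rewrite /half; case: ifP => _; last by rewrite normc0.
  by rewrite /= expr1n expr0n addr0 sqrtr1.
Qed.

Let hol_div h h' : holo setT h h' ->
  exists d, holo [set z | D z /\ 0 < e * Re z] (fun z => h z / quad z) d.
Proof.
move=> hh; have [q' hq] := holo_quad [set z | D z /\ 0 < e * Re z].
eexists; apply: holoM; first exact: holoS hh.
by apply: holoV; [exact: hq | move=> z [zD ez]; exact: quad_neq0].
Qed.

Let conj_div (a b : R[i]) : conjc a / conjc b = conjc (a / b).
Proof. by case: a => a1 a2; case: b => b1 b2; apply: eqC => /=; rewrite ?sqrrN; ring. Qed.

Lemma admissible_half_inv : admissible (half e (fun z => 1 / quad z)).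
Proof.
have [d hd] := hol_div (@holo_cst R setT 1); have [c c0 hc] := quad_bound.
split.
- by exists (half e d); exact: (half_holo hth).
- apply: half_symmetric => z _ _; rewrite quad_conj -conj_div; congr (_ / _).
  by apply: eqC; rewrite /= ?oppr0.
- exists c^-1; first by rewrite invr_ge0 ltW.
  move=> z zD; rewrite /half; case: ifP => ez; last by rewrite normc0 invr_ge0 ltW.
  have [h1 _] := hc z zD ez; rewrite mul1r normcV lef_pV2 // posrE.
  exact: lt_le_trans h1.
Qed.

Lemma admissible_half_id : admissible (half e (fun z => z / quad z)).
Proof.
have [d hd] := hol_div (@holo_id R setT); have [c c0 hc] := quad_bound.
split.
- by exists (half e d); exact: (half_holo hth).
- by apply: half_symmetric => z _ _; rewrite quad_conj -conj_div.
- exists c^-1; first by rewrite invr_ge0 ltW.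
  move=> z zD; rewrite /half; case: ifP => ez; last by rewrite normc0 invr_ge0 ltW.
  have [h1 h2] := hc z zD ez; have q0 : 0 < normc (quad z) by exact: lt_le_trans h1.
  by rewrite normcM normcV ler_pdivrMr // mulrC ler_pdivlMr // mulrC.
Qed.

(** Division with remainder, z^2 = q + 2 Re m z - |m|^2: applying T to (z / q)(T) yields a
    combination of bounded functions of T. *)
Lemma half_quadE z : D z -> z * half e (fun z => z / quad z) z
  = half e (fun=> 1) z + (2 * Re m)%:C * half e (fun z => z / quad z) z
    + (- normc m ^+ 2)%:C * half e (fun z => 1 / quad z) z.
Proof.
move=> zD; rewrite /half; case: ifP => ez; last by rewrite !mulr0 !addr0.
have q0 := quad_neq0 zD ez.
apply: (mulIf q0); rewrite !mulrDl -!mulrA !mulVf // !mulr1 mul1r.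
rewrite {1}/quad; case: z {zD ez q0} => a b; case: (m) => c d; apply: eqC => /=; ring.
Qed.

Lemma half_idE z : half e (fun z => z / quad z) z = z * half e (fun z => 1 / quad z) z.
Proof. by rewrite /half; case: ifP; rewrite ?mulr0 // mul1r. Qed.

End Quadratic.
End HalfSector.

(** * The regularized calculus of bounded functions *)

Section RegularizedCalculus.
Context (R : realType) (n : nat) (V : rightHilbertModule R n).
Context (T : operator V) (w : R) (T_bisect : bisectorial T w).
Context (th : R) (hth : w < th < pi / 2).
Context (J : clifford R n) (sJ : sphere J) (p : R) (hp : w < p < th).
Implicit Types (u v y : V) (z : R[i]) (h g : R[i] -> R[i]) (A B : V -> V).

Local Notation off := (off_sector (cos w)).
Local Notation D := (in_sector (cos th)).
Local Notation iC := (0 +i* 1 : R[i]).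
Local Notation Rz := (resolv T J).
Local Notation holomorphic := (holomorphic th).
Local Notation decays := (decays th).
Local Notation admissible := (admissible th).
Local Notation weak := (weak_calculus T J p).

Let hth0 := sector_angle T_bisect hth.

Definition right_operator A :=
  [/\ forall u v, A (u + v) = A u + A v,
      forall v s, A (ract v s) = ract (A v) s &
      exists2 M : R, 0 <= M & forall v, `|A v| <= M * `|v|].

Lemma right_operator_bounded_linear A : right_operator A -> bounded_linear J A.
Proof.
move=> [AD Ar Ab]; split => // a u v.
by rewrite AD -!(ract_real _ a) Ar.
Qed.

Lemma bounded_operator_fun (P : operator V) : bounded_operator setT P ->
  exists2 A, right_operator A & forall v u, P (v, u) <-> u = A v.
Proof.
move=> [[sv P0 Padd Pr] dom _ [c hc]].
have /choice[A hA] : forall v, exists u, P (v, u).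
  by move=> v; have : [set: V] v by []; rewrite -dom.
have PE v u : P (v, u) <-> u = A v by split=> [Pu|->//]; exact: sv Pu (hA v).
exists A => //; split.
- by move=> u v; apply/esym/PE; exact: Padd.
- by move=> v s; apply/esym/PE; exact: Pr.
- exists `|c| => // v; apply: le_trans (hc v (A v) (hA v)) _.
  by rewrite ler_wpM2r // ler_norm.
Qed.

(* h(T) is everywhere defined and injective. *)
Definition regularizer h :=
  [/\ holomorphic h, decays h, forall v, exists y, weak h v y &
      forall u u' y, weak h u y -> weak h u' y -> u = u'].

(* A = h(T)^-1 (h g)(T) *)
Definition regularized h g A := forall v, exists y,
  weak h (A v) y /\ weak (fun z => h z * g z) v y.

(** The definition of the calculus chooses an angle and a unit for each function; here all of them
    are moved to one contour and one J. *)
Lemma contour_calculus_transfer J' p' f h v u : sphere J' -> w < p' < th ->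
  represents th f h -> holomorphic h -> decays h -> symmetric th h ->
  contour_calculus T f p' J' (v, u) -> weak h v u.
Proof.
move=> sJ' hp' fh hh dh sh hu.
have := contour_calculus_weak T_bisect hth sJ' hp' hh (fun z => fh J' z sJ') hu.
move=> /(weak_rotation T_bisect hth sJ' hp' hp hh dh).
exact: (weak_imaginary_unit T_bisect hth sJ' sJ hp hh dh sh).
Qed.

Lemma weak_zero h : weak h 0 0.
Proof.
move=> l bl; rewrite functional0 //.
rewrite (_ : contour _ p = 0) ?mulr0 //.
have hpp := angleP T_bisect hth hp; rewrite -(contour_cst0 hpp).
apply: (contour_ext hpp) => z /(on_contourP T_bisect hth hp)[zO zD].
have bR := resolv_bounded_linear T_bisect sJ zO.
rewrite /resolv_kernel (blin0 bR) -(subrr (0 : V)) cfunD // cfunN //.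
by rewrite subrr mul0r.
Qed.

Section Existence.
Hypothesis T_Hinfty : bounded_Hinfty T w.

(** The regularizer hidden in P serves every admissible g': the hypothesis on the calculus applies
    to relations with this regularizer, and boundedness on V includes that they are defined
    everywhere. *)
Lemma hinfty_regularizer f g (P : operator V) : represents th f g -> admissible g ->
  is_Hinfty_calculus T w th f P ->
  exists h, [/\ regularizer h,
    exists A, [/\ right_operator A, forall v u, P (v, u) <-> u = A v & regularized h g A] &
    forall g', admissible g' -> exists2 A, right_operator A & regularized h g' A].
Proof.
move=> fg ag hP; have [C C0 hC] := T_Hinfty hth.
have ninf f' g' : represents th f' g' -> admissible g' -> Ninfty (double_sector n th) f'.
  by move=> fg' [hg sg bg]; exact: (represents_Ninfty sJ hth0 fg' hg bg sg).
have [bP _] := hC f (ninf _ _ fg ag) P hP.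
have [A rA hA] := bounded_operator_fun bP.
case: hP => e [eT [efT [[Ne Nef] [p1 [J1 [hp1 sJ1 eTE]]] [p2 [J2 [hp2 sJ2 efTE]]] inj PE]]].
have [h [eh hh dh sh]] := N0_represents sJ hth0 Ne.
have prod f' g' : represents th f' g' -> admissible g' ->
    [/\ represents th (fun s => e s * f' s) (fun z => h z * g' z),
        holomorphic (fun z => h z * g' z), decays (fun z => h z * g' z) &
        symmetric th (fun z => h z * g' z)].
  move=> fg' [hg sg bg]; split; first exact: representsM eh fg'.
  - exact: holomorphicM.
  - exact: decays_bounded.
  - exact: symmetricM.
have eTw v u : eT (v, u) -> weak h v u.
  by rewrite eTE; exact: contour_calculus_transfer sJ1 hp1 eh hh dh sh.
have exA f' g' : represents th f' g' -> admissible g' ->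
    exists2 A', right_operator A' & forall v, exists2 y,
      contour_calculus T (fun s => e s * f' s) p1 J1 (v, y) & eT (A' v, y).
  move=> fg' ag'; have [r1 r2 r3 r4] := prod _ _ fg' ag'.
  (* The contour is that of [eT], so that f' = 1 gives back e(T) itself. *)
  pose P' := opcomp (opinv eT) (contour_calculus T (fun s => e s * f' s) p1 J1).
  have hP' : is_Hinfty_calculus T w th f' P'.
    exists e, eT, (contour_calculus T (fun s => e s * f' s) p1 J1); split => //.
    - by split => //; exact: (represents_N0 sJ hth0 r1 r2 r3 r4).
    - by exists p1, J1.
    - by exists p1, J1.
  have [bP' _] := hC f' (ninf _ _ fg' ag') P' hP'.
  have [A' rA' hA'] := bounded_operator_fun bP'.
  by exists A' => // v; have /hA'[y] : A' v = A' v by []; exists y.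
have ex g' : admissible g' -> exists2 A', right_operator A' & regularized h g' A'.
  move=> ag'; have [_ sg _] := ag'; have fg' : represents th (@lift R n g') g' by exact: lift_represents.
  have [A' rA' hA'] := exA _ _ fg' ag'; have [r1 r2 r3 r4] := prod _ _ fg' ag'.
  exists A' => // v; have [y y1 y2] := hA' v; exists y; split; first exact: eTw.
  exact: contour_calculus_transfer sJ1 hp1 r1 r2 r3 r4 y1.
have a1 : admissible (fun=> 1).
  split; first by exists (fun=> 0); exact: holo_cst.
    by move=> z _; apply: eqC; rewrite /= ?oppr0.
  by exists 1 => // z _; rewrite /= expr1n expr0n addr0 sqrtr1.
(* The constant function 1 as f': e(T)^-1 e(T) is everywhere defined only if e(T) is. *)
have total v : exists y, eT (v, y).
  have r1 : represents th (fun _ : clifford R n => 1) (fun=> 1).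
    by move=> J' z sJ' _; rewrite /emb /slice /= scale1r scale0r addr0.
  have [A' _ hA'] := exA _ _ r1 a1; have [y + _] := hA' v.
  rewrite (_ : (fun s => _) = e); last by apply/funext => s; rewrite mulr1.
  by rewrite -eTE; exists y.
exists h; split => //.
- split => //; first by move=> v; have [y /eTw] := total v; exists y.
  move=> u u' y hu hu'; have [y1 h1] := total u; have [y2 h2] := total u'.
  apply: (inj _ _ y).
    by rewrite (weak_uniq hu (eTw _ _ h1)).
  by rewrite (weak_uniq hu' (eTw _ _ h2)).
- exists A; split => // v; have /hA : A v = A v by [].
  have [r1 r2 r3 r4] := prod _ _ fg ag.
  rewrite PE => -[y /= h1 h2]; exists y; split; first exact: eTw.
  rewrite efTE in h1.
  exact: contour_calculus_transfer sJ2 hp2 r1 r2 r3 r4 h1.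
Qed.

End Existence.

Section Algebra.
Variables (h : R[i] -> R[i]) (rh : regularizer h).

Let hh : holomorphic h. Proof. by case: rh. Qed.
Let dh : decays h. Proof. by case: rh. Qed.
Let inj u u' y : weak h u y -> weak h u' y -> u = u'.
Proof. by case: rh => _ _ _; apply. Qed.

Lemma regularizer_inj0 u : weak h u 0 -> u = 0.
Proof. by move=> hu; apply: inj hu (weak_zero h). Qed.

(** Both sides are sent by h(T) to R_z (h g)(T) v, and h(T) is injective. *)
Lemma regularized_resolv g A z v : right_operator A -> regularized h g A -> off z ->
  A (Rz z v) = Rz z (A v).
Proof.
move=> rA cA zO; have bR := resolv_bounded_linear T_bisect sJ zO.
have cR z' x : off z' -> Rz z (Rz z' x) = Rz z' (Rz z x).
  by move=> z'O; exact: (resolv_comm T_bisect).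
have [y [h1 h2]] := cA v; have [y' [h3 h4]] := cA (Rz z v).
have h5 := weak_comp T_bisect hth hp bR cR h1.
have h6 := weak_comp T_bisect hth hp bR cR h2.
by rewrite (weak_uniq h4 h6) in h3; exact: inj h3 h5.
Qed.

(** T u = y is rewritten as u = R_i (u i - y), to which the commutation of A with the resolvent
    applies. *)
Lemma regularized_commute g A u y : right_operator A -> regularized h g A ->
  T (u, y) -> T (A u, A y).
Proof.
move=> rA cA uy; have nO := iC_off T_bisect; have bA := right_operator_bounded_linear rA.
have uE := resolv_uniq T_bisect sJ nO uy.
have := resolvP T_bisect (vmul J (A u) iC - A y) sJ nO.
have -> : Rz iC (vmul J (A u) iC - A y) = A u.
  by rewrite -(blin_vmul bA) -(blinN bA) -(blinD bA) -(regularized_resolv _ rA cA nO) uE.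
by rewrite opprB addrC subrK.
Qed.

(** Membership in the graph is pulled back along h(T): R_i (u i - u1) and u both have the image y,
    so they agree by injectivity. *)
Lemma weak_graph u u1 y y1 : weak h u y -> weak h u1 y1 -> T (y, y1) -> T (u, u1).
Proof.
move=> hu hu1 yT; have nO := iC_off T_bisect; have bR := resolv_bounded_linear T_bisect sJ nO.
have bM := @bounded_linear_vmul _ _ V J iC sJ.
have cM z x : off z -> vmul J (Rz z x) iC = Rz z (vmul J x iC).
  by move=> zO; rewrite (blin_vmul (resolv_bounded_linear T_bisect sJ zO)).
have cR z x : off z -> Rz iC (Rz z x) = Rz z (Rz iC x).
  by move=> zO; exact: (resolv_comm T_bisect).
have bN : bounded_linear J (fun v : V => - v).
  split; [by move=> a v v'; rewrite opprD scalerN | by move=> v; rewrite ractNl |].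
  by exists 1 => // v; rewrite normrN mul1r.
have cN z x : off z -> - Rz z x = Rz z (- x).
  by move=> zO; rewrite (blinN (resolv_bounded_linear T_bisect sJ zO)).
have h1 := weak_comp T_bisect hth hp bM cM hu.
have h2 := weak_comp T_bisect hth hp bN cN hu1.
have h3 := weak_addl T_bisect hth sJ hp hh dh h1 h2.
have := weak_comp T_bisect hth hp bR cR h3; rewrite (resolv_uniq T_bisect sJ nO yT).
move=> h4; rewrite (inj hu h4).
have := resolvP T_bisect (vmul J u iC - u1) sJ nO.
by rewrite -(inj hu h4) opprB addrC subrK.
Qed.

Lemma regularized_uniq g g' A A' : (forall z, D z -> g z = g' z) ->
  regularized h g A -> regularized h g' A' -> forall v, A v = A' v.
Proof.
move=> gE cA cA' v; have [y [h1 h2]] := cA v; have [y' [h3 h4]] := cA' v.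
have h5 : weak (fun z => h z * g z) v y'.
  by apply: (weak_ext T_bisect hth hp) h4 => z zD; rewrite gE.
by rewrite (weak_uniq h2 h5) in h1; exact: inj h1 h3.
Qed.

Lemma regularized_add g g' A A' : admissible g -> admissible g' ->
  regularized h g A -> regularized h g' A' ->
  regularized h (fun z => g z + g' z) (fun v => A v + A' v).
Proof.
move=> [hg _ bg] [hg' _ bg'] cA cA' v.
have [y [h1 h2]] := cA v; have [y' [h3 h4]] := cA' v; exists (y + y'); split.
  exact: (weak_addl T_bisect hth sJ hp hh dh h1 h3).
have := weak_addr T_bisect hth sJ hp (holomorphicM hh hg) (decays_bounded dh bg)
  (holomorphicM hh hg') (decays_bounded dh bg') h2 h4.
by apply: (weak_ext T_bisect hth hp) => z _; rewrite mulrDr.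
Qed.

Lemma regularized_one : regularized h (fun=> 1) id.
Proof.
move=> v; case: rh => _ _ /(_ v)[y hy] _; exists y; split => //.
by apply: (weak_ext T_bisect hth hp) hy => z _; rewrite mulr1.
Qed.

Lemma regularized_scale g A (c : R) : admissible g ->
  regularized h g A -> regularized h (fun z => c%:C * g z) (fun v => c *: A v).
Proof.
move=> [hg _ bg] cA v; have [y [h1 h2]] := cA v; exists (c *: y); split.
  have bZ : bounded_linear J (fun v : V => c *: v).
    split; [by move=> a x x'; rewrite scalerDr scalerA mulrC -scalerA | by move=> x; rewrite ractZl |].
    by exists `|c| => // x; rewrite normrZ.
  apply: (weak_comp T_bisect hth hp bZ) h1 => z x zO.
  by rewrite (blinZ (resolv_bounded_linear T_bisect sJ zO)).
have := weak_scaler T_bisect hth c sJ hp (holomorphicM hh hg) (decays_bounded dh bg) h2.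
by apply: (weak_ext T_bisect hth hp) => z _; rewrite mulrCA.
Qed.

(* T h(T)^-1 (h g)(T) = h(T)^-1 (h z g)(T) *)
Lemma regularized_mul_id g g' A A' : admissible g -> admissible g' ->
  (forall z, D z -> g' z = z * g z) ->
  regularized h g A -> regularized h g' A' -> forall v, T (A v, A' v).
Proof.
move=> [hg _ bg] [hg' _ bg'] gE cA cA' v.
have [y [h1 h2]] := cA v; have [y' [h3 h4]] := cA' v.
apply: weak_graph h1 h3 _.
have dzg : decays (fun z => z * (h z * g z)).
  have [a [K [a0 K0 hK]]] := decays_bounded dh bg'; exists a, K; split => // z zD.
  by rewrite mulrCA -gE // hK.
apply: (weak_mul_id T_bisect hth sJ hp (holomorphicM hh hg) (decays_bounded dh bg) dzg h2).
by apply: (weak_ext T_bisect hth hp) h4 => z zD; rewrite gE // mulrCA.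
Qed.

End Algebra.

(** The regularizers are removed one at a time. With y2 = h2(T) A2 v, h1(T) A1 y2 is (h1 g1)(T) (h2
    g2)(T) v = 0, so A1 y2 = 0. As A1 commutes with h2(T), this is h2(T) A1 A2 v = 0. *)
Lemma regularized_opposite h1 h2 g1 g2 A1 A2 : regularizer h1 -> regularizer h2 ->
  admissible g1 -> admissible g2 -> opposite th g1 g2 ->
  right_operator A1 ->
  regularized h1 g1 A1 -> regularized h2 g2 A2 -> forall v, A1 (A2 v) = 0.
Proof.
move=> r1 r2 [hg1 _ bg1] [hg2 _ bg2] opp rA1 c1 c2 v.
have [hh1 dh1 _ _] := r1; have [hh2 dh2 _ _] := r2.
have [y2 [k1 k2]] := c2 v; have [x [k3 k4]] := c1 y2.
have x0 : x = 0.
  apply: (weak_disjoint T_bisect hth sJ hp (holomorphicM hh1 hg1) (decays_bounded dh1 bg1)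
    (holomorphicM hh2 hg2) (decays_bounded dh2 bg2) _ k2 k4) => s q sD qD sq.
  by case: (opp s q sD qD sq) => ->; [left|right]; rewrite mulr0.
rewrite x0 in k3; have y20 := regularizer_inj0 r1 k3.
have := weak_comp T_bisect hth hp (right_operator_bounded_linear rA1)
  (fun z u zO => regularized_resolv r1 u rA1 c1 zO) k1.
by rewrite y20; exact: regularizer_inj0.
Qed.

End RegularizedCalculus.

(** * Restrictions and spectral projections *)

Section Restriction.
Context (R : realType) (n : nat) (V : rightHilbertModule R n).
Context (T : operator V) (T_lin : right_linear T).
Implicit Types (u v y x : V) (s : clifford R n) (A B N : V -> V).

Lemma right_operator0 A : right_operator A -> A 0 = 0.
Proof. by move=> [AD _ _]; apply: (addIr (A 0)); rewrite -AD !add0r. Qed.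

Lemma right_operatorZ A (a : R) v : right_operator A -> A (a *: v) = a *: A v.
Proof. by move=> [_ Ar _]; rewrite -!(ract_real _ a) Ar. Qed.

Lemma right_operatorN A v : right_operator A -> A (- v) = - A v.
Proof. by move=> rA; rewrite -scaleN1r right_operatorZ // scaleN1r. Qed.

Lemma Qop_add (P : operator V) s v v' u u' : right_linear P ->
  Qop P s (v, u) -> Qop P s (v', u') -> Qop P s (v + v', u + u').
Proof.
move=> [_ _ Padd _] [y [x [h1 h2 /= ->]]] [y' [x' [h3 h4 /= ->]]].
exists (y + y'), (x + x'); split; [exact: Padd | exact: Padd |].
by rewrite /= !scalerDr opprD addrACA; congr (_ + _); rewrite addrACA.
Qed.

Lemma Qop_ract (P : operator V) s v u t : right_linear P ->
  Qop P s (v, u) -> Qop P s (ract v t, ract u t).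
Proof.
move=> [_ _ _ Pr] [y [x [h1 h2 /= ->]]].
exists (ract y t), (ract x t); split; [exact: Pr | exact: Pr |].
by rewrite /= !ractDl ractNl !ractZl.
Qed.

Lemma Qop_zero (P : operator V) s : right_linear P -> Qop P s (0, 0).
Proof.
move=> [_ P0 _ _]; exists 0, 0; split => //=.
by rewrite !scaler0 subr0 addr0.
Qed.

Lemma Qop_fun s v u u' : Qop T s (v, u) -> Qop T s (v, u') -> u = u'.
Proof.
case: T_lin => sv _ _ _ [y [x [h1 h2 /= ->]]] [y' [x' [h3 h4 /= ->]]].
by have yE := sv _ _ _ h1 h3; rewrite -yE in h4 *; rewrite (sv _ _ _ h2 h4).
Qed.

Lemma Qop_sub (P P' : operator V) s : P `<=` P' -> Qop P s `<=` Qop P' s.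
Proof.
move=> PP [v u] [y [x [h1 h2 h3]]]; exists y, x.
by split => //; exact: PP.
Qed.

Definition commutes A := forall v y, T (v, y) -> T (A v, A y).

Lemma Qop_commute A s v u : right_operator A -> commutes A ->
  Qop T s (v, u) -> Qop T s (A v, A u).
Proof.
move=> rA cA [y [x [h1 h2 /= ->]]]; have [AD _ _] := rA.
exists (A y), (A x); split; [exact: cA | exact: cA |].
by rewrite /= !AD (right_operatorN _ rA) !(right_operatorZ _ _ rA).
Qed.

Lemma inverse_linear (P : operator V) s : right_linear P ->
  (forall v v' u, Qop P s (v, u) -> Qop P s (v', u) -> v = v') ->
  right_linear (opinv (Qop P s)).
Proof.
move=> lP inj; split.
- by move=> u v v' h h'; exact: inj h h'.
- exact: Qop_zero.
- by move=> u v u' v'; exact: Qop_add.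
- by move=> u v t; exact: Qop_ract.
Qed.

Section Projection.
Variables (A : V -> V) (rA : right_operator A) (cA : commutes A).
Hypothesis AA : forall v, A (A v) = A v.
Variable W : set V.
Hypothesis WE : forall v, W v <-> A v = v.

Local Notation TW := (oprestrict T W).

Lemma restrict_linear : right_linear TW.
Proof.
have [sv T0 Ta Tr] := T_lin; have [AD Ar _] := rA.
split.
- by move=> v y y' [h _] [h' _]; exact: sv h h'.
- by split => //; apply/WE; exact: right_operator0.
- move=> v y v' y' [h /WE hv] [h' /WE hv']; split; first exact: Ta.
  by apply/WE; rewrite /= AD hv hv'.
- move=> v y t [h /WE hv]; split; first exact: Tr.
  by apply/WE; rewrite /= Ar hv.
Qed.

Lemma restrict_sub : TW `<=` T. Proof. by move=> q []. Qed.

Lemma Qop_restrict s v u : Qop T s (v, u) -> Qop TW s (A v, A u).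
Proof.
move=> [y [x [h1 h2 /= ->]]]; have [AD _ _] := rA.
exists (A y), (A x); split.
- by split; [exact: cA | apply/WE; exact: AA].
- by split; [exact: cA | apply/WE; exact: AA].
- by rewrite /= !AD (right_operatorN _ rA) !(right_operatorZ _ _ rA).
Qed.

(** [oprestrict] constrains only the argument; that T maps into W is a consequence of A commuting
    with T. *)
Lemma Qop_restrict_ran s v u : Qop TW s (v, u) -> W v /\ W u.
Proof.
have [sv _ _ _] := T_lin; have [AD _ _] := rA.
move=> [y [x [[h1 /WE /= h2] [h3 /WE /= h4] /= ->]]]; split; first exact/WE.
have xE : A x = x by have := cA h3; rewrite h4 => h5; exact: sv h5 h3.
by apply/WE; rewrite !AD (right_operatorN _ rA) !(right_operatorZ _ _ rA) // h2 h4 xE.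
Qed.

(** The estimate yields injectivity as well, applied to the difference of two solutions. *)
Lemma restrict_bounded_operator s (c : R) :
  (forall u, W u -> exists v, Qop TW s (v, u)) ->
  (forall v u, Qop TW s (v, u) -> `|v| <= c * `|u|) ->
  bounded_operator W (opinv (Qop TW s)).
Proof.
move=> dom hc; have lW := restrict_linear; split.
- apply: inverse_linear => // v v' u h h'.
  have [_ lW0 _ _] := lW.
  have hN : Qop TW s (- v', - u).
    by have := Qop_ract (-1 *: 1) lW h'; rewrite !ract_real !scaleN1r.
  have := hc _ _ (Qop_add lW h hN); rewrite subrr normr0 mulr0 normr_le0 subr_eq0.
  by move=> /eqP.
- apply/seteqP; split; first by move=> u [v] /Qop_restrict_ran[].
  by move=> u /dom[v hv]; exists v.
- by move=> v [u] /Qop_restrict_ran[].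
- by exists c => u v; exact: hc.
Qed.

Lemma restrict_resolvent s : S_resolvent_set setT T s -> S_resolvent_set W TW s.
Proof.
move=> [ps [_ dom _ [c hc]]]; split => //; apply: (@restrict_bounded_operator _ c).
  move=> u /WE uE; have : [set: V] u by [].
  rewrite -dom => -[v]; rewrite /opinv /= => /Qop_restrict.
  by rewrite uE; exists (A v).
by move=> v u h; apply: (hc u v); exact: Qop_sub restrict_sub _ h.
Qed.

(** B is a right inverse of Q_s[T] on W. Commutation with T makes it a left inverse: if Q v = u with
    v in W, then B u and v are both the value of Q at B v. *)
Lemma restrict_resolvent_inverse s B : paravector s -> right_operator B ->
  commutes B -> (forall v, Qop T s (B v, A v)) -> (forall v, A (B v) = B v) ->
  S_resolvent_set W TW s.
Proof.
move=> ps rB cB QB AB; have [_ _ [M M0 hM]] := rB.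
split => //; apply: (@restrict_bounded_operator _ M).
  by move=> u /WE uE; exists (B u); have := Qop_restrict (QB u); rewrite AB AA uE.
move=> v u h; have [/WE vE _] := Qop_restrict_ran h.
have := Qop_commute rB cB (Qop_sub restrict_sub h).
have := QB v; rewrite vE => h1 h2; rewrite (Qop_fun h1 h2).
exact: hM.
Qed.

End Projection.

(** The inverse on V is the inverse on [WA] after A plus the inverse on [WN] after N. *)
Lemma resolvent_of_restrictions A N WA WN s : right_operator A -> right_operator N ->
  commutes A -> commutes N ->
  (forall v, A (A v) = A v) -> (forall v, N (N v) = N v) ->
  (forall v, A v + N v = v) ->
  (forall v, WA v <-> A v = v) -> (forall v, WN v <-> N v = v) ->
  S_resolvent_set WA (oprestrict T WA) s -> S_resolvent_set WN (oprestrict T WN) s ->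
  S_resolvent_set setT T s.
Proof.
move=> rA rN cA cN AA NN AN WAE WNE [ps [[i1 _ _ _] d1 _ [c1 h1]]] [_ [[i2 _ _ _] d2 _ [c2 h2]]].
have [_ _ [M1 M10 hM1]] := rA; have [_ _ [M2 M20 hM2]] := rN.
have QA v u := @Qop_restrict A rA cA AA WA WAE s v u.
have QN v u := @Qop_restrict N rN cN NN WN WNE s v u.
split => //; split.
- apply: inverse_linear => // v v' u h h'; rewrite -(AN v) -(AN v').
  by rewrite (i1 _ _ _ (QA _ _ h) (QA _ _ h')) (i2 _ _ _ (QN _ _ h) (QN _ _ h')).
- apply/seteqP; split => // u _.
  have : WA (A u) by apply/WAE.
  rewrite -d1 => -[v hv]; have : WN (N u) by apply/WNE.
  rewrite -d2 => -[v' hv']; exists (v + v'); rewrite /opinv /= -(AN u).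
  by apply: Qop_add => //; [apply: Qop_sub hv | apply: Qop_sub hv'];
    exact: restrict_sub.
- by [].
- exists (`|c1| * M1 + `|c2| * M2) => u v /= h; rewrite -{1}(AN v).
  apply: le_trans (ler_normD _ _) _; rewrite mulrDl lerD //.
    apply: le_trans (h1 _ _ (QA _ _ h)) _.
    apply: le_trans (_ : `|c1| * `|A u| <= _); first by rewrite ler_wpM2r // ler_norm.
    by rewrite -mulrA ler_wpM2l.
  apply: le_trans (h2 _ _ (QN _ _ h)) _.
  apply: le_trans (_ : `|c2| * `|N u| <= _); first by rewrite ler_wpM2r // ler_norm.
  by rewrite -mulrA ler_wpM2l.
Qed.

End Restriction.

(** * The projections of the two half sectors *)

Section SpectralProjections.
Context (R : realType) (n : nat) (V : rightHilbertModule R n).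
Context (T : operator V) (w : R) (T_bisect : bisectorial T w).
Context (th : R) (hth : w < th < pi / 2).
Context (J : clifford R n) (sJ : sphere J) (p : R) (hp : w < p < th).
Implicit Types (u v y : V) (z : R[i]) (h g : R[i] -> R[i]) (A B N : V -> V) (e : R).

Local Notation D := (in_sector (cos th)).
Local Notation admissible := (admissible th).
Local Notation regularizer := (regularizer T th J p).
Local Notation regularized := (regularized T J p).

Let hth0 := sector_angle T_bisect hth.

Lemma admissibleD g g' : admissible g -> admissible g' -> admissible (fun z => g z + g' z).
Proof.
move=> [[d hd] sg [C C0 hC]] [[d' hd'] sg' [C' C'0 hC']]; split.
- by eexists; exact: holoD hd hd'.
- move=> z zD; rewrite sg // sg' //.
  by case: (g z) (g' z) => a b [c e]; apply: eqC => /=; ring.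
- exists (C + C'); first exact: addr_ge0.
  by move=> z zD; apply: le_trans (le_normcD _ _) _; rewrite lerD ?hC ?hC'.
Qed.

Lemma admissibleZ (c : R) g : admissible g -> admissible (fun z => c%:C * g z).
Proof.
move=> [[d hd] sg [C C0 hC]]; split.
- by eexists; apply: holoM hd; exact: holo_cst.
- by move=> z zD; rewrite sg //; case: (g z) => a b; apply: eqC => /=; ring.
- exists (`|c| * C); first exact: mulr_ge0.
  by move=> z zD; rewrite normcM normc_real ler_wpM2l // hC.
Qed.

Definition side e := half e (fun=> 1 : R[i]).

Definition regularizable h := forall g, admissible g ->
  exists2 A, right_operator A & regularized h g A.

Section Pair.
Variables (e : R) (e0 : e != 0) (h1 h2 : R[i] -> R[i]) (A N : V -> V).
Hypotheses (r1 : regularizer h1) (r2 : regularizer h2).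
Hypotheses (ex1 : regularizable h1) (ex2 : regularizable h2).
Hypotheses (rA : right_operator A) (rN : right_operator N).
Hypotheses (cA : regularized h1 (side e) A) (cN : regularized h2 (side (- e)) N).

Let e0N : - e != 0. Proof. by rewrite oppr_eq0. Qed.
Let aS := admissible_half1 hth0 e0.
Let aSN := admissible_half1 hth0 e0N.
Let oppAN := half_opposite hth0 (fun=> 1) (fun=> 1) e0.
Let oppNA : opposite th (side (- e)) (side e).
Proof. by have := half_opposite hth0 (fun=> 1) (fun=> 1) e0N; rewrite opprK. Qed.

Lemma projections_ortho v : A (N v) = 0 /\ N (A v) = 0.
Proof.
split.
  exact: (regularized_opposite T_bisect hth sJ hp r1 r2 aS aSN oppAN rA cA cN).
exact: (regularized_opposite T_bisect hth sJ hp r2 r1 aSN aS oppNA rN cN cA).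
Qed.

(* The complements 1 - A and 1 - N are the functions of T for the opposite
   half sectors, hence (1 - A) (1 - N) = 0. *)
Lemma projections_sum v : A v + N v = v.
Proof.
have [A' rA' cA'] := ex1 aSN; have [N' rN' cN'] := ex2 aS.
have sum z : D z -> side e z + side (- e) z = 1.
  move=> zD; have := half_sides hth0 e0 zD; rewrite /side /half => -[] ez; rewrite ez.
    by rewrite ltNge mulNr oppr_le0 (ltW ez) addr0.
  by move: (ez); rewrite mulNr oppr_gt0 => ez'; rewrite ltNge (ltW ez') add0r.
have E1 x : A x + A' x = x.
  exact: (regularized_uniq T_bisect hth hp r1 sum
    (regularized_add T_bisect hth sJ hp r1 aS aSN cA cA') (regularized_one T_bisect hth hp r1)).
have sum' z : D z -> side (- e) z + side e z = 1 by move=> zD; rewrite addrC sum.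
have E2 x : N x + N' x = x.
  exact: (regularized_uniq T_bisect hth hp r2 sum'
    (regularized_add T_bisect hth sJ hp r2 aSN aS cN cN') (regularized_one T_bisect hth hp r2)).
have := regularized_opposite T_bisect hth sJ hp r1 r2 aSN aS oppNA rA' cA' cN' v.
have N'E x : N' x = x - N x by rewrite -{2}(E2 x) addrC addKr.
have A'E x : A' x = x - A x by rewrite -{2}(E1 x) addrC addKr.
have [AD _ _] := rA; have [AN _] := projections_ortho v.
rewrite N'E A'E AD (right_operatorN _ rA) AN subr0.
by move=> /eqP; rewrite subr_eq0 subr_eq => /eqP.
Qed.

Lemma projection_idem v : A (A v) = A v.
Proof. by have := projections_sum (A v); have [_ ->] := projections_ortho v; rewrite addr0. Qed.

Lemma projection_commutes : commutes T A.
Proof. by move=> v y; exact: (regularized_commute T_bisect hth sJ hp r1 rA cA). Qed.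

(** With g = 1_e / q, the operators B, B1 and X below are g(T), T g(T) and T^2 g(T). They combine to
    Q_s[T] B = A. *)
Lemma half_resolvent s (W : set V) : paravector s -> s != 0 -> e * Sc s <= 0 ->
  (forall v, W v <-> A v = v) -> S_resolvent_set W (oprestrict T W) s.
Proof.
move=> ps s0 es WE; have [J' [m [sJ' sE]]] := paravector_is_emb sJ ps.
have m0 : m != 0.
  by rewrite -normc_eq0 -(cnorm_emb _ sJ') -sE cnorm_eq0.
have em : e * Re m <= 0 by rewrite -(Sc_emb _ sJ') -sE.
have a0 := admissible_half_inv hth0 m0 e0 em.
have a1 := admissible_half_id hth0 m0 e0 em.
have [B rB cB] := ex1 a0; have [B1 rB1 cB1] := ex1 a1.
have T1 v : T (B v, B1 v).
  apply: (regularized_mul_id T_bisect hth sJ hp r1 a0 a1 _ cB cB1) => z _.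
  exact: half_idE.
(* The right-hand side of [half_quadE], read as operators. *)
pose X v := A v + (2 * Re m) *: B1 v + (- normc m ^+ 2) *: B v.
have a2 := admissibleD (admissibleD aS (admissibleZ (2 * Re m) a1))
  (admissibleZ (- normc m ^+ 2) a0).
have cX := regularized_add T_bisect hth sJ hp r1
  (admissibleD aS (admissibleZ (2 * Re m) a1)) (admissibleZ (- normc m ^+ 2) a0)
  (regularized_add T_bisect hth sJ hp r1 aS (admissibleZ (2 * Re m) a1) cA
    (regularized_scale T_bisect hth sJ hp r1 (2 * Re m) a1 cB1))
  (regularized_scale T_bisect hth sJ hp r1 (- normc m ^+ 2) a0 cB).
have T2 v : T (B1 v, X v).
  apply: (regularized_mul_id T_bisect hth sJ hp r1 a1 a2 _ cB1 cX) => z zD.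
  by rewrite (half_quadE hth0 m0 e0 em).
have QB v : Qop T s (B v, A v).
  exists (B1 v), (X v); split => //=.
  rewrite sE Sc_emb // cnorm_emb // /X.
  by rewrite addrAC -addrA [_ - _]addrC; cmodule sJ.
have cBT : commutes T B.
  by move=> v y; exact: (regularized_commute T_bisect hth sJ hp r1 rB cB).
have AB v : A (B v) = B v.
  (* The ranges match by supports: 1_{-e} and 1_e / q are opposite, so N B = 0 and A B = B by A + N
     = 1. *)
  have NB : N (B v) = 0.
    apply: (regularized_opposite T_bisect hth sJ hp r2 r1 aSN a0 _ rN cN cB).
    by have := half_opposite hth0 (fun=> 1) (fun z => 1 / quad m z) e0N; rewrite opprK.
  by have := projections_sum (B v); rewrite NB addr0.
exact: (restrict_resolvent_inverse (T_linear T_bisect) rA projection_commutes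
  projection_idem WE ps rB cBT QB AB).
Qed.

End Pair.
End SpectralProjections.

(** * The spectra of the two restrictions *)

Lemma represents_ind_plus (R : realType) (n : nat) (th : R) :
  represents th (@ind_plus R n) (side 1).
Proof.
move=> J z sJ _; rewrite /ind_plus /side /half Sc_emb // mul1r.
by case: ifP => _; rewrite /emb /slice /= scale0r ?scale1r ?addr0 ?scale0r ?add0r.
Qed.

Lemma represents_ind_minus (R : realType) (n : nat) (th : R) :
  represents th (@ind_minus R n) (side (- 1)).
Proof.
move=> J z sJ _; rewrite /ind_minus /side /half Sc_emb // mulN1r oppr_gt0.
by case: ifP => _; rewrite /emb /slice /= scale0r ?scale1r ?addr0 ?scale0r ?add0r.
Qed.

Theorem theorem4p9 (R : realType) (n : nat) (V : rightHilbertModule R n)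
    (T : operator V) (w : R)
    (T_inj : op_injective T) (T_bisect : bisectorial T w)
    (T_Hinfty : bounded_Hinfty T w)
    (theta : R) (theta_int : w < theta < pi / 2)
    (Pp Pm : operator V)
    (Pp_def : is_Hinfty_calculus T w theta (@ind_plus R n) Pp)
    (Pm_def : is_Hinfty_calculus T w theta (@ind_minus R n) Pm) :
  let Vp := opran Pp in
  let Vm := opran Pm in
  let Tp := oprestrict T Vp in
  let Tm := oprestrict T Vm in
  [/\ S_spectrum Vp Tp `\ 0 = S_spectrum setT T `&` @half_plus R n,
      S_spectrum Vm Tm `\ 0 = S_spectrum setT T `&` @half_minus R n &
      S_spectrum setT T 0 <-> (S_spectrum Vp Tp `|` S_spectrum Vm Tm) 0].
Proof.
move=> Vp Vm Tp Tm.
(* A unit J exists because the contour behind [Pp] uses one. *)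
have [J sJ] : exists J : clifford R n, sphere J.
  by case: Pp_def => e [eT [efT [_ [p [J [_ sJ _]]] _ _ _]]]; exists J.
pose p := (w + theta) / 2.
have hp : w < p < theta by case/andP: theta_int => wt _; rewrite /p; apply/andP; split; lra.
have hth0 := sector_angle T_bisect theta_int.
have e1 : (1 : R) != 0 by rewrite oner_eq0.
have eN1 : - (1 : R) != 0 by rewrite oppr_eq0.
have [h1 [r1 [A [rA PA cA]] ex1]] := hinfty_regularizer T_bisect theta_int sJ hp T_Hinfty
  (@represents_ind_plus R n theta) (admissible_half1 hth0 e1) Pp_def.
have [h2 [r2 [N [rN PN cN]] ex2]] := hinfty_regularizer T_bisect theta_int sJ hp T_Hinfty
  (@represents_ind_minus R n theta) (admissible_half1 hth0 eN1) Pm_def.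
(* For e = - 1 the roles of A and N are exchanged, and the opposite side is that of - - 1. *)
have cA' : regularized T J p h1 (side (- - 1)) A by rewrite opprK.
have AN := projections_sum T_bisect theta_int sJ hp e1 r1 r2 ex1 ex2 rA rN cA cN.
have AA := projection_idem T_bisect theta_int sJ hp e1 r1 r2 ex1 ex2 rA rN cA cN.
have NN := projection_idem T_bisect theta_int sJ hp eN1 r2 r1 ex2 ex1 rN rA cN cA'.
have cAT := projection_commutes T_bisect theta_int sJ hp r1 rA cA.
have cNT := projection_commutes T_bisect theta_int sJ hp r2 rN cN.
have VpE v : Vp v <-> A v = v.
  split=> [[x /PA ->]|vE]; first exact: AA.
  by exists v; apply/PA.
have VmE v : Vm v <-> N v = v.
  split=> [[x /PN ->]|vE]; first exact: NN.
  by exists v; apply/PN.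
have lT := T_linear T_bisect.
have down s := restrict_resolvent lT rA cAT AA VpE (s := s).
have downN s := restrict_resolvent lT rN cNT NN VmE (s := s).
have up s := resolvent_of_restrictions lT rA rN cAT cNT AA NN AN VpE VmE (s := s).
have halfp s (ps : paravector s) (s0 : s != 0) (es : Sc s <= 0) :
    S_resolvent_set Vp Tp s.
  apply: (half_resolvent T_bisect theta_int sJ hp e1 r1 r2 ex1 ex2 rA rN cA cN ps s0 _ VpE).
  by rewrite mul1r.
have halfm s (ps : paravector s) (s0 : s != 0) (es : 0 <= Sc s) :
    S_resolvent_set Vm Tm s.
  apply: (half_resolvent T_bisect theta_int sJ hp eN1 r2 r1 ex2 ex1 rN rA cN cA' ps s0 _ VmE).
  by rewrite mulN1r oppr_le0.
have Sc0 : Sc (0 : clifford R n) = 0 by exact: cliff_coef0.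
split.
- apply/seteqP; split => s.
    move=> [[ps ns] /eqP s0]; split; first by split => // /down.
    by split => //; rewrite ltNge; apply/negP => h; apply: ns; exact: halfp.
  move=> [[_ ns] [ps s0]]; have sn0 : s != 0.
    by apply: contraTneq s0 => ->; rewrite Sc0 ltxx.
  (* In the right half plane s is always in the resolvent set of [Tm], so if it were in that of [Tp]
     it would be in that of T. *)
  split; last exact/eqP; split => // h; apply: ns; apply: up => //.
  by apply: halfm => //; exact: ltW.
- apply/seteqP; split => s.
    move=> [[ps ns] /eqP s0]; split; first by split => // /downN.
    by split => //; rewrite ltNge; apply/negP => h; apply: ns; exact: halfm.
  move=> [[_ ns] [ps s0]]; have sn0 : s != 0.
    by apply: contraTneq s0 => ->; rewrite Sc0 ltxx.
  split; last exact/eqP; split => // h; apply: ns; apply: up => //.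
  by apply: halfp => //; exact: ltW.
(* At 0 neither half space gives information; what remains is that the resolvent set of T is the
   intersection of those of its restrictions. *)
- split=> [[p0 ns]|[[p0 ns]|[p0 ns]]].
  + have [h|h] := pselect (S_resolvent_set Vp Tp 0); last by left.
    by right; split => // h'; apply: ns; exact: up.
  + by split => // /down.
  + by split => // /downN.
Qed.
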